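(* Let $V_{SRPT}$ be the steady-state sojourn time of a customer in a stable $GI/GI/1$ queue with light-tailed service times under the preemptive shortest remaining processing time discipline. Let $x_B=\sup\{x:\mathbb{P}\{B>x\}>0\}$ be the right endpoint of the service-time distribution, and suppose that $\mathbb{P}\{B=x_B\}>0$. Then, as $x\to\infty$, $\log\mathbb{P}\{V_{SRPT}>x\}\sim-\gamma_v x$, i.e. $\lim_{x\to\infty}\frac1x\log\mathbb{P}\{V_{SRPT}>x\}=-\gamma_v$, where $$\gamma_v=\sup_{s\in[0,\gamma_w]}\{s-\Psi_1(s)\},\qquad \gamma_w=\sup\{s:\Phi_A(-s)\Phi_B(s)\le 1\},$$ $$\Psi_1(s)=-\Phi_{A_1}^{-1}\!\left(\frac{1}{\Phi_{B_1}(s)}\right),$$ with $A_1$, $B_1$ as follows: $B_1$ has distribution $\mathbb{P}\{B_1\le x\}=\mathbb{P}\{B\le x\mid B<x_B\}$, $x\ge 0$, and $A_1$ is the sum of a geometric number of i.i.d. copies of $A$, with $$\Phi_{A_1}(s)=\frac{p\,\Phi_A(s)}{1-(1-p)\Phi_A(s)},\qquad p=\mathbb{P}\{B<x_B\}.$$ If $p=0$ (deterministic service times), $\Psi_1$ is understood to be identically $0$.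
   Context: Queue: single server working at unit speed; i.i.d. inter-arrival times distributed as $A\ge0$ and, independently, i.i.d. service times distributed as $B\ge 0$. Standing assumptions: $\rho=\mathbb{E}\{B\}/\mathbb{E}\{A\}<1$; $\mathbb{P}\{B>A\}>0$ for independent $A,B$; $B$ is light-tailed, i.e. $\mathbb{E}\{e^{sB}\}<\infty$ for $s$ in a neighborhood of $0$. The queue is in steady state. Notation: $\Phi_X(s)=\mathbb{E}\{e^{sX}\}$. $\Phi_{A_1}$ restricted to $(-\infty,0]$ is strictly increasing with range $(\mathbb{P}\{A_1=0\},1]$, and $\Phi_{A_1}^{-1}$ is its inverse; conventions: $1/\infty=0$ and $\Phi_{A_1}^{-1}(u)=-\infty$ for $0\le u\le\mathbb{P}\{A_1=0\}$ (so $\Psi_1(s)=+\infty$ there). Preemptive SRPT: at every time the server works on a customer with the smallest remaining service time among those present, interrupting (and later resuming without loss) the customer in service if needed; ties are broken in order of arrival. The sojourn time of a customer is the time between arrival and service completion. *)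

(* Defs.v *)
From HB Require Import structures.
From mathcomp Require Import all_boot all_order all_algebra.
From mathcomp Require Import lra.
From mathcomp Require Import all_classical all_reals all_analysis.

Set Implicit Arguments.
Unset Strict Implicit.
Unset Printing Implicit Defensive.

Import Order.TTheory GRing.Theory Num.Theory.
Import numFieldNormedType.Exports.
Local Open Scope classical_set_scope.
Local Open Scope ring_scope.

Section srpt_path.
Variable R : realType.
Implicit Types (r : nat -> R) (a b : nat -> R) (i j k m n : nat) (t d : R).

(* j has priority over i when r gives the remaining service times; customers
   are numbered in order of arrival. *)
Definition before r j i : bool :=
  (r j < r i) || ((r j == r i) && (j < i)%N).

Definition work_before k r i : R := \sum_(j < k | before r j i) r j.

(* Remaining service times after the server has worked for a time d, without
   any arrival, on the customers 0, ..., k-1: customer i first gets service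
   when the customers with priority over it have been completed, i.e. after
   work_before k r i.  Customers i >= k have not arrived yet. *)
Definition serve k r d i : R :=
  if (i < k)%N then Num.max 0 (r i - Num.max 0 (d - work_before k r i))
  else r i.

(* a k is the time between the arrivals of customers k and k+1; customer 0
   arrives at time 0 in an empty system. *)
Definition arrival a n : R := \sum_(k < n) a k.

Fixpoint remaining_at_arrival a b m : nat -> R :=
  if m is m'.+1 then serve m (remaining_at_arrival a b m') (a m') else b.

(* Remaining service time of customer i at time t of the m-th inter-arrival
   interval, during which customers 0, ..., m have arrived. *)
Definition remaining a b m t i : R :=
  serve m.+1 (remaining_at_arrival a b m) (t - arrival a m) i.

Definition sojourn a b n : \bar R :=
  ereal_inf [set t%:E | t in [set t | 0 <= t /\
    exists m, arrival a m <= arrival a n + t < arrival a m.+1 /\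
              remaining a b m (arrival a n + t) n = 0]].

Definition in_service m r i : bool :=
  [&& (i <= m)%N, 0 < r i &
      [forall j : 'I_m.+1, (0 < r j) ==>
         ((r i < r j) || ((r i == r j) && (i <= j)%N))]].

Lemma max0_case (x : R) :
  (x <= 0 /\ Num.max 0 x = 0) \/ (0 <= x /\ Num.max 0 x = x).
Proof. by rewrite /Num.max; case: ltP => h; [right|left]; split=> //; exact: ltW. Qed.

Ltac max0_lra := repeat match goal with |- context [@Order.max _ _ _ ?x] =>
    lazymatch x with
    | context [Order.max] => fail
    | _ => case: (max0_case x) => -[? ->]
    end end; lra.

Lemma before_irr r i : before r i i = false.
Proof. by rewrite /before ltxx ltnn andbF. Qed.

Lemma before_trans r j i k : before r i j -> before r j k -> before r i k.
Proof.
rewrite /before => /orP[h1|/andP[/eqP h1 l1]] /orP[h2|/andP[/eqP h2 l2]].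
- by rewrite (lt_trans h1 h2).
- by rewrite -h2 h1.
- by rewrite h1 h2.
- by rewrite h1 h2 eqxx (ltn_trans l1 l2) orbT.
Qed.

Lemma before_total r i j : i != j -> before r i j || before r j i.
Proof.
move=> ij; rewrite /before (eq_sym (r j)).
by case: (ltgtP (r i) (r j)) => //= _; rewrite -neq_ltn.
Qed.

Lemma before_asym r i j : before r i j -> before r j i = false.
Proof. by move=> h; apply/negP => /(before_trans h); rewrite before_irr. Qed.

Lemma serve_ge0 k r d i : (forall j, 0 <= r j) -> 0 <= serve k r d i.
Proof. by move=> r0; rewrite /serve; case: ifP => _ //; rewrite le_max lexx. Qed.

Lemma serve_le k r d i : (forall j, 0 <= r j) -> serve k r d i <= r i.
Proof.
move=> r0; rewrite /serve; case: ifP => _ //.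
by rewrite ge_max r0 gerBl le_max lexx.
Qed.

Lemma sum_serve k r d (D : {set 'I_k}) :
  (forall j, 0 <= r j) -> 0 <= d ->
  (forall i j : 'I_k, i \in D -> before r j i -> j \in D) ->
  \sum_(j in D) serve k r d j = Num.max 0 (\sum_(j in D) r j - d).
Proof.
move=> r0 d0; move En : #|D| => n.
elim: n D En => [|n IH] D En Dcl.
  by move/eqP: En; rewrite cards_eq0 => /eqP ->; rewrite !big_set0 sub0r max_l // oppr_le0.
have [M MD Mmax] : exists2 M, M \in D & forall j : 'I_k, j \in D -> j != M -> before r j M.
  have /card_gt0P[x xD] : (0 < #|D|)%N by rewrite En.
  have [M MD Mmin] := @arg_maxnP _ x (mem D) (fun i : 'I_k => #|[set j : 'I_k | before r j i]%SET|) xD.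
  exists M => // j jD jM.
  have /orP[//|Mj] : before r j M || before r M j by apply: before_total.
  have := Mmin j jD; rewrite /= leqNgt => /negP[]; apply: proper_card.
  apply/properP; split.
    by apply/fintype.subsetP => l; rewrite !inE => /before_trans; apply.
  by exists M; rewrite ?inE // before_irr.
have wM : work_before k r M = \sum_(j in D :\ M) r j.
  apply: eq_bigl => j; rewrite !inE; apply/idP/andP.
    move=> h; split; last exact: (Dcl M j MD h).
    by apply: contraTneq h => ->; rewrite before_irr.
  by move=> [jM jD]; exact: Mmax.
rewrite (big_setD1 M MD) /= [in RHS](big_setD1 M MD) /= IH.
- rewrite /serve ltn_ord wM; set S := \sum_(j in D :\ M) r j.
  have S0 : 0 <= S by apply: sumr_ge0.
  have rM := r0 M.
  by clearbody S; max0_lra.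
- by move: En; rewrite (cardsD1 M) MD => -[].
- move=> i j; rewrite !inE => /andP[iM iD] h; rewrite (Dcl i j iD h) andbT.
  apply: contraTneq h => ->.
  by rewrite (before_asym (Mmax i iD iM)).
Qed.

Lemma work_before_serve k r d i : (forall j, 0 <= r j) -> 0 <= d ->
  (i < k)%N -> 0 < serve k r d i ->
  work_before k (serve k r d) i = Num.max 0 (work_before k r i - d).
Proof.
move=> r0 d0 ik pos.
pose D := [set j : 'I_k | before r j i]%SET.
have Dcl (l j : 'I_k) : l \in D -> before r j l -> j \in D.
  by rewrite !inE => h1 h2; exact: before_trans h2 h1.
have sD s : \sum_(j in D) s (nat_of_ord j) = \sum_(j < k | before r j i) s j :> R.
  by apply: eq_bigl => j; rewrite inE.
rewrite -[in RHS]/(work_before k r i).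
have <- : \sum_(j in D) serve k r d j = Num.max 0 (work_before k r i - d).
  by rewrite sum_serve // sD.
rewrite sD /work_before big_mkcond [RHS]big_mkcond /=; apply: eq_bigr => j _.
have [z|nz] := eqVneq (serve k r d j) 0; first by rewrite z !if_same.
suff -> : before (serve k r d) j i = before r j i by [].
have jpos : 0 < serve k r d j by rewrite lt_def nz serve_ge0.
have key x y : (x < k)%N -> (y < k)%N -> 0 < serve k r d x -> 0 < serve k r d y ->
    before r x y -> before (serve k r d) x y.
  move=> xk yk xp yp bxy.
  have wxy : work_before k r x + r x <= work_before k r y.
    rewrite /work_before [leRHS](bigD1 (Ordinal xk) bxy) /= addrC lerD2r.
    rewrite [leLHS]big_mkcond [leRHS]big_mkcond; apply: ler_sum => l _.
    case: ifP => [lx|_]; last by case: ifP.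
    rewrite (before_trans lx bxy) /=; case: eqP => [e|//].
    by move: lx; rewrite e before_irr.
  have sy : serve k r d y = r y.
    have rx := r0 x; have ry := r0 y.
    by move: xp; rewrite /serve xk yk; max0_lra.
  have sx := serve_le k d x r0.
  move: bxy; rewrite /before sy; have [-> -> //|ne] := eqVneq (serve k r d x) (r x).
  have lt : serve k r d x < r x by rewrite lt_neqAle ne sx.
  by case/orP => [h|/andP[/eqP h _]]; rewrite ?(lt_trans lt h) // -h lt.
have [ji|ji] := eqVneq (j : nat) i; first by rewrite ji !before_irr.
have [h|h] := boolP (before r j i); first exact: key.
have : before r i j by move: (before_total r ji); rewrite (negPf h).
by move/key => /(_ ik (ltn_ord j) pos jpos)/before_asym.
Qed.

Lemma serveD k r d1 d2 i : (forall j, 0 <= r j) -> 0 <= d1 -> 0 <= d2 ->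
  serve k r (d1 + d2) i = serve k (serve k r d1) d2 i.
Proof.
move=> r0 d10 d20; have [ik|ik] := boolP (i < k)%N; last by rewrite /serve (negPf ik).
have [z|nz] := eqVneq (serve k r d1 i) 0.
  rewrite [RHS]/serve ik z; move: z; rewrite /serve ik.
  have ri := r0 i.
  set w := work_before k _ i; clearbody w.
  by set w' := work_before k _ i; clearbody w'; max0_lra.
have pos : 0 < serve k r d1 i by rewrite lt_def nz serve_ge0.
rewrite [RHS]/serve ik work_before_serve //; move: pos; rewrite /serve ik.
set w := work_before k r i; clearbody w; have ri := r0 i.
have /orP[wd|dw] := le_total w d1.
  rewrite (max_l (y := w - d1)) ?subr_le0 // subr0.
  rewrite (max_r (y := d1 - w)) ?subr_ge0 // lt_max ltxx /= => pos.
  rewrite (max_r (ltW pos)) (max_r d20) (max_r (y := d1 + d2 - w)); last lra.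
  by congr (Num.max 0 _); lra.
rewrite (max_r (y := w - d1)) ?subr_ge0 //.
rewrite (max_l (y := d1 - w)) ?subr_le0 // subr0 (max_r ri) => _.
by congr (Num.max 0 (_ - Num.max 0 _)); lra.
Qed.

Lemma remaining_at_arrival_ge0 a b m i :
  (forall j, 0 <= b j) -> 0 <= remaining_at_arrival a b m i.
Proof.
move=> b0; elim: m i => [//|m IH] i /=; exact: serve_ge0.
Qed.

(* serve obeys the discipline: at every time, the customer with the smallest
   positive remaining service time among those present (the earliest one in
   case of a tie), and no other, is served at unit rate. *)
Lemma remaining_SRPT a b m t i : (forall j, 0 <= b j) -> arrival a m <= t ->
  exists2 e, 0 < e & forall d, 0 <= d <= e ->
    remaining a b m (t + d) i =
    remaining a b m t i - (if in_service m (remaining a b m t) i then d else 0).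
Proof.
move=> b0 mt.
pose s := remaining a b m t.
have s0 j : 0 <= s j by apply: serve_ge0 => l; exact: remaining_at_arrival_ge0.
have step d : 0 <= d -> remaining a b m (t + d) i = serve m.+1 s d i.
  move=> d0; rewrite /remaining addrAC serveD ?subr_ge0 // => j.
  exact: remaining_at_arrival_ge0.
pose e := \big[Num.min/1]_(j < m.+1 | 0 < s j) s j.
have e0 : 0 < e by rewrite /e; elim/big_ind: _ => // x y x0 y0; rewrite lt_min x0.
have ele (j : 'I_m.+1) : 0 < s j -> e <= s j by move=> sj; exact: bigmin_le_cond.
exists e => // d /andP[d0 de]; rewrite step // -/s.
have [im|im] := boolP (i < m.+1)%N; last first.
  by rewrite /in_service -ltnS (negPf im) /= /serve (negPf im) subr0.
have w0 : 0 <= work_before m.+1 s i by apply: sumr_ge0.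
rewrite /serve im.
case: ifPn => [/and3P[_ si /forallP sj]|].
  have -> : work_before m.+1 s i = 0.
    apply: big1 => j bj; apply/eqP; rewrite eq_le s0 andbT leNgt; apply/negP => jp.
    have := sj j; rewrite jp /=; move: bj; rewrite /before.
    case: (ltgtP (s j) (s i)) => //= _.
    by move=> ji; rewrite leqNgt ji.
  have := ele (Ordinal im) si => /= es.
  by rewrite subr0 (max_r d0) max_r // subr_ge0 (le_trans de).
rewrite subr0 /in_service -ltnS im /=.
have [si|si _] := ltP 0 (s i); last first.
  have -> : s i = 0 by apply/eqP; rewrite eq_le si s0.
  by rewrite sub0r max_l // oppr_le0 le_max lexx.
move=> /= /forallPn[j]; rewrite negb_imply => /andP[sj nj].
have bj : before s j i.
  move: nj; rewrite /before; case: (ltgtP (s j) (s i)) => //= _.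
  by rewrite -ltnNge.
have : s j <= work_before m.+1 s i.
  by rewrite /work_before (bigD1 j bj) /= lerDl; exact: sumr_ge0.
have := ele j sj => ej wj.
by rewrite max_r; rewrite max_l ?subr0 ?s0 // subr_le0 (le_trans de) // (le_trans ej).
Qed.

End srpt_path.

Section probability_notions.
Local Open Scope ereal_scope.
Context d (T : measurableType d) (R : realType) (P : probability T R).

Definition mutually_independent (I : eqType) (X : I -> T -> R) : Prop :=
  forall (s : seq I) (E : I -> set R), uniq s -> (forall i, measurable (E i)) ->
    P (\bigcap_(i in [set` s]) X i @^-1` E i) =
    \big[*%E/1]_(i <- s) P (X i @^-1` E i).

Definition identically_distributed (X : nat -> T -> R) : Prop :=
  forall n (E : set R), measurable E -> P (X n @^-1` E) = P (X 0%N @^-1` E).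

(* All the variables A_0, A_1, ..., B_0, B_1, ... as a single family. *)
Definition joint_family (A B : nat -> T -> R) (i : nat + nat) : T -> R :=
  match i with inl n => A n | inr n => B n end.

(* V has the limiting distribution of the sojourn time of the n-th customer:
   convergence in distribution, i.e. at all continuity points of the law
   of V. *)
Definition steady_state_sojourn (A B : nat -> T -> R)
    d' (T' : measurableType d') (Q : probability T' R) (V : T' -> R) : Prop :=
  forall x : R, Q [set w | V w = x] = 0 ->
    P [set w | x%:E < sojourn (A ^~ w) (B ^~ w) n] @[n --> \oo] -->
    Q [set w | (x < V w)%R].

End probability_notions.

Section rates.
Local Open Scope ereal_scope.
Context d (T : measurableType d) (R : realType) (P : probability T R).
Variables A B : {RV P >-> R}.

Definition right_endpoint : \bar R :=
  ereal_sup [set x%:E | x in [set x : R | 0 < P [set w | (x < B w)%R]]].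

Definition below_endpoint : set R := [set x : R | x%:E < right_endpoint].

Lemma measurable_below_endpoint : measurable below_endpoint.
Proof.
rewrite /below_endpoint; case: right_endpoint => [r||].
- suff -> : [set x : R | x%:E < r%:E] = `]-oo, r[%classic by exact: measurable_itv.
  by apply/seteqP; split=> x /=; rewrite in_itv /= lte_fin.
- suff -> : [set x : R | x%:E < +oo] = setT by exact: measurableT.
  by apply/seteqP; split=> x //= _; exact: ltry.
- suff -> : [set x : R | x%:E < -oo] = set0 by exact: measurable0.
  by apply/seteqP; split=> x.
Qed.

Definition p_below : \bar R := P [set w | (B w)%:E < right_endpoint].

(* The law of B given B < x_B; its value is irrelevant when
   p_below = 0, in which case it is the law of B. *)
Definition law_B1 :=
  mnormalize (mrestr (distribution P B) measurable_below_endpoint)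
             (distribution P B).

Definition Phi_B1 (s : R) : \bar R := \int[law_B1]_x (expR (s * x))%:E.

(* Only used for s <= 0 and p_below > 0, where all the terms are finite and
   the denominator is positive. *)
Definition Phi_A1 (s : R) : \bar R :=
  (p_below * 'M_P A s) / (1 - (1 - p_below) * 'M_P A s).

(* Inverse of the restriction of Phi_A1 to ]-oo, 0], where it is strictly
   increasing: the set below has at most one element.  For 0 <= u <= 1 not in
   the range it is empty and its supremum is -oo. *)
Definition Phi_A1_inv (u : \bar R) : \bar R :=
  ereal_sup [set t%:E | t in [set t : R | (t <= 0)%R /\ Phi_A1 t = u]].

(* The inverse on \bar R satisfies +oo^-1 = 0. *)
Definition Psi1 (s : R) : \bar R :=
  if p_below == 0 then 0 else - Phi_A1_inv (Phi_B1 s)^-1.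

Definition gamma_w : \bar R :=
  ereal_sup [set s%:E | s in [set s : R | 'M_P A (- s)%R * 'M_P B s <= 1]].

Definition gamma_v : \bar R :=
  ereal_sup [set s%:E - Psi1 s | s in [set s : R | (0 <= s)%R /\ s%:E <= gamma_w]].

End rates.

(* Main.v *)
(* Let beta be the right endpoint and B' = B * 1{B < beta}.  A customer has lower
   priority than everything present on its arrival and, at worst (B = beta), than
   all later customers of size < beta; so, with W the workload found on arrival and
   T_m the time until the m-th later arrival, its sojourn time exceeds x essentially
   when W + B'_1 + ... + B'_m > x for the m with T_m <= x < T_(m+1).

   Clearing denominators in the definition of Psi_1 shows that Psi_1(s) = u means
   E[e^(s B')] E[e^(-u A)] = 1.  Upper bound: for such s < gamma_w and u, writing W
   as a maximum of partial sums, the exponential Markov inequality and a union bound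
   over both indices give two convergent geometric series.

   Lower bound: if kap > gamma_v, then E[e^(s (B' - A) + kap A)] > 1 for every s in
   [0, gamma_w].  After discretizing, the n-th power of this expectation is a sum
   over polynomially many levels (y, t) of (sum of B' - A, sum of A), so for each s
   some level of some block has probability > e^(-s y - kap t).  The s for which y
   can be taken >= 0, respectively <= 0, form two open sets covering [0, gamma_w]:
   either 0 is in the first, or gamma_w is in the second, or some s is in both and
   two blocks can be combined into one with y = 0.  Repeating such a block, after
   an initial workload built from similar blocks for s slightly above gamma_w,
   keeps the tagged customer waiting, at the exponential rate kap. *)
Require Import Defs.
From mathcomp Require Import all_boot all_order all_algebra.
From mathcomp Require Import lra ring zify.
From mathcomp Require Import all_classical all_reals all_analysis measurable_realfun.

Set Implicit Arguments.
Unset Strict Implicit.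
Unset Printing Implicit Defensive.

Import Order.TTheory GRing.Theory Num.Theory.
Import numFieldNormedType.Exports.
Local Open Scope classical_set_scope.
Local Open Scope ring_scope.

(** * Sample paths *)

(** The steady state enters only as a limit law. The tail of the n-th customer is therefore bounded
    above for every n and below for all n past some n0 depending on x, with constants free of n and
    x; the limit is then taken at continuity points of the law of V, one of which lies within
    distance 1 on either side of any x.

    The atom at beta costs only a constant factor: the tagged customer has size beta with a
    probability that does not depend on x. Later customers of size beta lose every tie against it,
    being later in order of arrival, which is why B' and not B governs the time after its arrival.

    The moment generating function of A may be infinite at the positive arguments kap - s, and no
    derivative at a minimizer is available. Exponential tilting is therefore replaced by truncation,
    discretization and the counting of levels, which use only continuity in s and the supremum that
    defines gamma_v.

    A balanced block may still lose some work h. That loss is paid in advance by the initial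
    workload, at a rate barely above gamma_w per unit of work. *)

Section paths.
Variable R : realType.
Variables (a b : nat -> R) (beta : R).
Hypotheses (a0 : forall n, 0 <= a n) (b0 : forall n, 0 <= b n)
  (b_le : forall n, b n <= beta).
Local Notation rem := (remaining_at_arrival a b).

Let rem_ge0 m i : 0 <= rem m i.
Proof. exact: remaining_at_arrival_ge0. Qed.

Lemma remaining_at_arrival_new m i : (m <= i)%N -> rem m i = b i.
Proof.
elim: m => [//|m IH] mi /=; rewrite /serve ltnNge mi /=.
exact: IH (ltnW mi).
Qed.

Lemma remaining_at_arrival_le m i : rem m i <= b i.
Proof.
by elim: m => [//|m IH] /=; apply: le_trans IH; exact: serve_le.
Qed.

Lemma arrivalS n : arrival a n.+1 = arrival a n + a n.
Proof. by rewrite /arrival big_ord_recr. Qed.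

Lemma arrival_homo m n : (m <= n)%N -> arrival a m <= arrival a n.
Proof.
elim: n => [|n IH]; first by rewrite leqn0 => /eqP->.
rewrite leq_eqVlt => /orP[/eqP->//|/IH h].
by rewrite arrivalS (le_trans h) // lerDl.
Qed.

Fixpoint lindley n : R :=
  if n is m.+1 then Num.max 0 (lindley m + b m - a m) else 0.

(** The set of all customers is trivially closed under priority, so [sum_serve] applies: the total
    workload does not depend on the discipline. *)
Lemma sum_remaining_at_arrival n : \sum_(i < n) rem n i = lindley n.
Proof.
elim: n => [|n IH]; first by rewrite big_ord0.
have := @sum_serve R n.+1 (rem n) (a n) [set: 'I_n.+1]%SET (rem_ge0 n) (a0 n).
rewrite (eq_bigl xpredT) => [->|i]; last by rewrite inE.
  rewrite (eq_bigl xpredT) => [|i]; last by rewrite inE.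
  by rewrite big_ord_recr /= IH remaining_at_arrival_new.
by move=> i j _ _; rewrite inE.
Qed.

Lemma lindley_ge k n : (k <= n)%N ->
  \sum_(k <= j < n) (b j - a j) <= lindley n.
Proof.
elim: n => [|n IH]; first by rewrite leqn0 => /eqP->; rewrite big_geq.
rewrite leq_eqVlt => /orP[/eqP->|kn]; first by rewrite big_geq //= le_max lexx.
rewrite big_nat_recr //= le_max; apply/orP; right.
by rewrite -addrA lerD2r IH.
Qed.

(** With [lindley_ge], the workload is the maximum of the partial sums. The upper bound uses that
    the maximum is attained, the lower bound only that it dominates one chosen sum. *)
Lemma lindley_attained n :
  exists2 k, (k <= n)%N & lindley n = \sum_(k <= j < n) (b j - a j).
Proof.
elim: n => [|n [k kn IH]]; first by exists 0%N => //; rewrite big_geq.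
rewrite /= /Num.max; case: ltP => h.
  by exists k; rewrite ?(leqW kn) // big_nat_recr //= -IH addrA.
by exists n.+1 => //; rewrite big_geq.
Qed.

(* The customers of the class [prio th], namely those numbered before th and
   those with service time less than beta, have priority over all the others
   as long as none of the others has been served. *)
Definition prio th i := (i < th)%N || (b i < beta).

Definition untouched th (r : nat -> R) m :=
  forall i, (i <= m)%N -> ~~ prio th i -> r i = b i.

Definition prio_work th (r : nat -> R) m : R := \sum_(i < m.+1 | prio th i) r i.

(** An untouched customer outside the class still has [beta], the largest possible value. It can
    precede a class member only through a tie, which forces that member to have full size [beta],
    hence a number below [th], hence an earlier arrival. *)
Lemma prio_closed th r m i j : (forall i, r i <= b i) -> untouched th r m ->
  (j <= m)%N -> prio th i -> before r j i -> prio th j.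
Proof.
move=> rb un jm pi bji; apply/negPn/negP => pj.
have rj := un _ jm pj; move: pj pi bji; rewrite /prio /before negb_or -leqNgt -leNgt.
move=> /andP[thj bj] pi; have rib := rb i.
have ribeta := le_trans rib (b_le i).
rewrite rj => /orP[h|/andP[/eqP h ji]].
  by have := le_lt_trans bj h; rewrite ltNge ribeta.
case/orP: pi => [ith|bi]; first by have := leq_trans (ltn_trans ji ith) thj; rewrite ltnn.
by have := le_lt_trans rib bi; rewrite -h ltNge bj.
Qed.

Lemma prio_work_serve th r m d : (forall i, 0 <= r i) -> (forall i, r i <= b i) ->
  untouched th r m -> 0 <= d ->
  prio_work th (serve m.+1 r d) m = Num.max 0 (prio_work th r m - d).
Proof.
move=> r0 rb un d0.
pose D := [set i : 'I_m.+1 | prio th i]%SET.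
have sD s : prio_work th s m = \sum_(i in D) s i.
  by apply: eq_bigl => i; rewrite inE.
rewrite !sD sum_serve // => i j; rewrite !inE => pi bji.
by apply: (prio_closed rb un _ pi bji); rewrite -ltnS.
Qed.

(** Every class member precedes a customer outside the class, so the latter waits at least for the
    whole class work. *)
Lemma serve_untouched th r m d : (forall i, 0 <= r i) -> (forall i, r i <= b i) ->
  untouched th r m -> d <= prio_work th r m -> untouched th (serve m.+1 r d) m.
Proof.
move=> r0 rb un dw i im pi; rewrite -(un i im pi) /serve ltnS im.
suff h : prio_work th r m <= work_before m.+1 r i.
  by rewrite (max_l (y := d - _)) ?subr0 ?max_r // subr_le0 (le_trans dw).
rewrite /prio_work /work_before big_mkcond [leRHS]big_mkcond; apply: ler_sum => j _.
case: ifP => pj; last by case: ifP.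
have ji : (j : nat) != i by apply: contraNneq pi => <-.
have [//|nji] := boolP (before r j i).
have bij : before r i j by have := before_total r ji; rewrite (negPf nji).
by have := prio_closed rb un im pj bij; rewrite (negPf pi).
Qed.

Definition below i : R := if b i < beta then b i else 0.

(** The invariant along a path, read at the arrival of customer m, who is already counted. *)
Definition prio_state th m u :=
  untouched th (rem m) m /\ prio_work th (rem m) m = u.

Lemma prio_stateS th m u : (th <= m.+1)%N -> prio_state th m u -> a m <= u ->
  prio_state th m.+1 (u - a m + below m.+1).
Proof.
move=> thm [un wu] au.
have un' := serve_untouched (rem_ge0 m) (remaining_at_arrival_le m) un
  (d := a m) ltac:(by rewrite wu).
split=> [i|].
  rewrite leq_eqVlt => /orP[/eqP->|im]; last exact: un'.
  by rewrite remaining_at_arrival_new.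
rewrite /prio_work big_mkcond big_ord_recr /= -big_mkcond /=.
have -> : \sum_(i < m.+1 | prio th i) serve m.+1 (rem m) (a m) i = u - a m.
  rewrite -[LHS]/(prio_work th (serve m.+1 (rem m) (a m)) m).
  rewrite prio_work_serve ?wu //; last exact: remaining_at_arrival_le.
  by rewrite max_r // subr_ge0.
by rewrite /prio ltnNge thm /= /below -/(rem m.+1) remaining_at_arrival_new.
Qed.

Lemma prio_state_run th n l u : (th <= n.+1)%N -> prio_state th n u ->
  (forall i, (i < l)%N ->
     arrival a (n + i.+1) - arrival a n <= u + \sum_(j < i) below (n + j.+1)) ->
  prio_state th (n + l)
    (u + \sum_(j < l) below (n + j.+1) - (arrival a (n + l) - arrival a n)).
Proof.
move=> thn st; elim: l => [|l IH] h.
  by rewrite addn0 big_ord0 subrr subr0 addr0.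
have {}IH := IH (fun i il => h i (leqW il)).
have {h} := h l (ltnSn l); rewrite addnS arrivalS => h.
rewrite big_ord_recr /= addnS.
set S := bigop _ _ _ in IH h *; set t := arrival a (n + l) in IH h *.
have -> : u + (S + below (n + l).+1) - (t + a (n + l) - arrival a n) =
  u + S - (t - arrival a n) - a (n + l) + below (n + l).+1 by ring.
by apply: (prio_stateS _ IH); [rewrite (leq_trans thn) // ltnS leq_addr | lra].
Qed.

(** Two thresholds serve the two bounds: [n.+1] puts the tagged customer n into the class (upper
    bound), while [n] leaves it outside when its size is [beta] (lower bound, next lemma). *)
Lemma prio_state_arrival n : prio_state n.+1 n (lindley n + b n).
Proof.
split=> [i im|]; first by rewrite /prio ltnS im.
rewrite /prio_work (eq_bigl xpredT) => [|i]; last by rewrite /prio ltn_ord.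
by rewrite big_ord_recr /= sum_remaining_at_arrival remaining_at_arrival_new.
Qed.

Lemma prio_state_arrival_large n : b n = beta -> prio_state n n (lindley n).
Proof.
move=> bn; split=> [i|].
  rewrite leq_eqVlt => /orP[/eqP-> _|im]; first by rewrite remaining_at_arrival_new.
  by rewrite /prio im.
rewrite /prio_work big_mkcond big_ord_recr /= /prio ltnn bn ltxx /= addr0.
rewrite (eq_bigr (fun i : 'I_n => rem n i)) => [|i _]; last by rewrite ltn_ord.
exact: sum_remaining_at_arrival.
Qed.

Lemma sojourn_le_of_gt n m x : (x%:E < sojourn a b n)%E -> 0 <= x ->
  arrival a m <= arrival a n + x < arrival a m.+1 ->
  0 < remaining a b m (arrival a n + x) n.
Proof.
move=> xs x0 mx; rewrite lt_def; apply/andP; split; last exact: serve_ge0.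
apply/eqP => r0; move: xs; rewrite ltNge => /negP; apply.
by apply: ereal_inf_lbound; exists x => //; split => //; exists m.
Qed.

(** While the tagged customer, a class member, has work left, the class has not emptied; this gives
    the condition of [prio_stateS] at each step. *)
Lemma prio_state_active n l : 0 < rem (n + l) n ->
  prio_state n.+1 (n + l) (lindley n + b n + \sum_(j < l) below (n + j.+1)
    - (arrival a (n + l) - arrival a n)).
Proof.
elim: l => [|l IH].
  by rewrite addn0 big_ord0 subrr subr0 addr0 => _; exact: prio_state_arrival.
rewrite addnS => pos.
have {}IH := IH (lt_le_trans pos (serve_le _ _ _ (rem_ge0 _))).
have [un wu] := IH.
rewrite big_ord_recr /= addnS ?arrivalS.
set S := bigop _ _ _ in wu IH *; set t := arrival a (n + l) in wu IH *.
have -> : lindley n + b n + (S + below (n + l).+1) - (t + a (n + l) - arrival a n) =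
  lindley n + b n + S - (t - arrival a n) - a (n + l) + below (n + l).+1 by ring.
apply: (prio_stateS _ IH); first by rewrite ltnS leq_addr.
have := prio_work_serve (rem_ge0 _) (remaining_at_arrival_le _) un (a0 (n + l)).
have : serve (n + l).+1 (rem (n + l)) (a (n + l)) n <=
    prio_work n.+1 (serve (n + l).+1 (rem (n + l)) (a (n + l))) (n + l).
  have nl : (n < (n + l).+1)%N by rewrite ltnS leq_addr.
  rewrite /prio_work (bigD1 (Ordinal nl)) /=; last by rewrite /prio ltnSn.
  by rewrite lerDl; apply: sumr_ge0 => i _; exact: serve_ge0.
move=> h1 h2; have := lt_le_trans pos h1; rewrite h2 wu lt_max ltxx /=.
by rewrite subr_gt0 => /ltW.
Qed.

(** At time x after its arrival the tagged customer still has work left, so the class containing it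
    has more work than the server could have done. *)
Lemma sojourn_gt_work n x : (x%:E < sojourn a b n)%E -> 0 <= x -> forall l,
  arrival a (n + l) <= arrival a n + x < arrival a (n + l).+1 ->
  x < lindley n + beta + \sum_(j < l) below (n + j.+1).
Proof.
move=> xs x0 l lx; have pos := sojourn_le_of_gt xs x0 lx.
move/andP: lx => [lx _].
have [un wu] := prio_state_active (lt_le_trans pos (serve_le _ _ _ (rem_ge0 _))).
have dx : 0 <= arrival a n + x - arrival a (n + l) by rewrite subr_ge0.
have := prio_work_serve (rem_ge0 _) (remaining_at_arrival_le _) un dx.
have nl : (n < (n + l).+1)%N by rewrite ltnS leq_addr.
have : remaining a b (n + l) (arrival a n + x) n <= prio_work n.+1
    (serve (n + l).+1 (rem (n + l)) (arrival a n + x - arrival a (n + l))) (n + l).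
  rewrite /prio_work (bigD1 (Ordinal nl)) /=; last by rewrite /prio ltnSn.
  by rewrite lerDl; apply: sumr_ge0 => i _; exact: serve_ge0.
move=> h1 h2; have := lt_le_trans pos h1; rewrite h2 wu lt_max ltxx /=.
by have := b_le n; lra.
Qed.

Lemma sojourn_gt n M x : 0 < beta -> b n = beta ->
  (forall i, (i < M)%N ->
     arrival a (n + i.+1) - arrival a n <= lindley n + \sum_(j < i) below (n + j.+1)) ->
  x + 1 < arrival a (n + M) - arrival a n ->
  (x%:E < sojourn a b n)%E.
Proof.
move=> beta0 bn h xM.
(* The sojourn time is an infimum, for which only a non-strict lower bound is available; the spare
   unit makes the inequality strict. *)
apply: (@lt_le_trans _ _ (x + 1)%:E); first by rewrite lte_fin ltrDl.
apply: le_ereal_inf_tmp => _ [t [t0 [m [/andP[mt tm] rm]]] <-].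
rewrite lee_fin leNgt; apply/negP => tx.
have nm : (n <= m)%N.
  rewrite leqNgt; apply/negP => /arrival_homo.
  by have := tm; lra.
have mM : (m < n + M)%N.
  rewrite ltnNge; apply/negP => /arrival_homo.
  by have := mt; lra.
move: rm; rewrite -(subnKC nm) in mt tm mM *; set l := (m - n)%N in mt tm mM *.
rewrite ltn_add2l in mM.
have [|un wu] := @prio_state_run n n l _ (leqnSn n) (prio_state_arrival_large bn).
  by move=> i il; apply: h; exact: ltn_trans il mM.
rewrite /remaining.
have := serve_untouched (rem_ge0 _) (remaining_at_arrival_le _) un
  (d := arrival a n + t - arrival a (n + l)); rewrite wu => H.
rewrite H; first by rewrite bn; move: beta0 => /[swap]->; rewrite ltxx.
- by have := h l mM; move: tm; rewrite addnS; lra.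
- by rewrite leq_addr.
- by rewrite /prio ltnn bn ltxx.
Qed.

End paths.

Lemma sum_geometric_le (R : realType) (r : R) n : 0 <= r < 1 ->
  \sum_(i < n) r ^+ i <= (1 - r)^-1.
Proof.
move=> /andP[r0 r1]; have r1' : 0 < 1 - r by rewrite subr_gt0.
rewrite -[leRHS]mul1r ler_pdivlMr // mulrC.
have := subrXX 1 r n; rewrite expr1n; under eq_bigr do rewrite expr1n mul1r.
by move=> <-; rewrite lerBlDr lerDl exprn_ge0.
Qed.

Lemma sum_nat_shift (R : realType) (f : nat -> R) k n :
  \sum_(k <= j < n) f j = \sum_(i < n - k) f (k + i)%N.
Proof.
rewrite -{1}[k]add0n big_addn big_mkord.
by apply: eq_bigr => i _; rewrite addnC.
Qed.

Lemma sum_shift_recl (R : realType) (f : nat -> R) m i :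
  \sum_(k < i.+1) f (m + k)%N = f m + \sum_(k < i) f (m.+1 + k)%N.
Proof.
rewrite big_ord_recl /= addn0; congr (_ + _); apply: eq_bigr => k _.
by rewrite /bump /= add1n addSnnS.
Qed.

Lemma arrival_increment (R : realType) (a : nat -> R) n m :
  arrival a (n + m) - arrival a n = \sum_(i < m) a (n + i)%N.
Proof.
elim: m => [|m IH]; first by rewrite addn0 subrr big_ord0.
by rewrite big_ord_recr /= -IH addnS arrivalS; ring.
Qed.

(** * Measurability of the sojourn time *)

Section sojourn_measurability.
Context d (T : measurableType d) (R : realType).
Implicit Types r : nat -> T -> R.

Lemma measurable_fun_before r i j : (forall i, measurable_fun setT (r i)) ->
  measurable_fun setT (fun w => before (r ^~ w) i j).
Proof.
move=> mr; apply: measurable_or; first exact: measurable_fun_ltr.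
by apply: measurable_and; [exact: measurable_fun_eqr | exact: measurable_cst].
Qed.

Lemma measurable_fun_serve k r (x : T -> R) i :
  (forall i, measurable_fun setT (r i)) -> measurable_fun setT x ->
  measurable_fun setT (fun w => serve k (r ^~ w) (x w) i).
Proof.
move=> mr mx; rewrite /serve; case: (i < k)%N => //.
apply: measurable_maxr; first exact: measurable_cst.
apply: measurable_funB => //.
apply: measurable_maxr; first exact: measurable_cst.
apply: measurable_funB => //.
rewrite (_ : (fun w => _) =
    (fun w => \sum_(j < k) if before (r ^~ w) j i then r j w else 0)); last first.
  by apply/funext => w; rewrite /work_before big_mkcond.
apply: measurable_sum => j; apply: measurable_fun_ifT => //.
exact: measurable_fun_before.
Qed.

Variables A B : nat -> T -> R.
Hypotheses (mA : forall n, measurable_fun setT (A n))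
  (mB : forall n, measurable_fun setT (B n)).

Lemma measurable_fun_arrival n : measurable_fun setT (fun w => arrival (A ^~ w) n).
Proof. by apply: measurable_sum => j. Qed.

Lemma measurable_fun_remaining_at_arrival m i :
  measurable_fun setT (fun w => remaining_at_arrival (A ^~ w) (B ^~ w) m i).
Proof.
elim: m i => [//|m IH] i /=.
exact: (@measurable_fun_serve _ (fun i w => remaining_at_arrival (A ^~ w) (B ^~ w) m i)).
Qed.

Lemma measurable_fun_remaining m (x : T -> R) i : measurable_fun setT x ->
  measurable_fun setT (fun w => remaining (A ^~ w) (B ^~ w) m (x w) i).
Proof.
move=> mx.
apply: (@measurable_fun_serve _ (fun i w => remaining_at_arrival (A ^~ w) (B ^~ w) m i)).
  exact: measurable_fun_remaining_at_arrival.
by apply: measurable_funB => //; exact: measurable_fun_arrival.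
Qed.

Hypotheses (A0 : forall n w, 0 <= A n w) (B0 : forall n w, 0 <= B n w).

Let done n (t : R) := [set w | 0 <= t /\ exists m,
  arrival (A ^~ w) m <= arrival (A ^~ w) n + t < arrival (A ^~ w) m.+1 /\
  remaining (A ^~ w) (B ^~ w) m (arrival (A ^~ w) n + t) n = 0].

Let measurable_done n t : measurable (done n t).
Proof.
have [t0|t0] := leP 0 t; last first.
  rewrite (_ : done n t = set0) //; apply/seteqP; split=> w //= [] /le_lt_trans.
  by move=> /(_ _ t0); rewrite ltxx.
pose f m w := [&& arrival (A ^~ w) m <= arrival (A ^~ w) n + t,
  arrival (A ^~ w) n + t < arrival (A ^~ w) m.+1 &
  remaining (A ^~ w) (B ^~ w) m (arrival (A ^~ w) n + t) n == 0].
rewrite (_ : done n t = \bigcup_m [set w | f m w]).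
  apply: bigcupT_measurable => m.
  rewrite [X in measurable X](_ : _ = f m @^-1` [set true]); last first.
    by apply/seteqP; split=> w /=; rewrite /f => /= ->.
  rewrite -[X in measurable X]setTI.
  have mt : measurable_fun setT (fun w => arrival (A ^~ w) n + t).
    by apply: measurable_funD => //; exact: measurable_fun_arrival.
  suff : measurable_fun setT (f m) by move=> /(_ measurableT); apply.
  apply: measurable_and.
    by apply: measurable_fun_ler => //; exact: measurable_fun_arrival.
  apply: measurable_and.
    by apply: measurable_fun_ltr => //; exact: measurable_fun_arrival.
  by apply: measurable_fun_eqr => //; exact: measurable_fun_remaining.
apply/seteqP; split=> w /=.
  by move=> [_ [m [/andP[h1 h2] h3]]]; exists m => //=; rewrite /f h1 h2 h3 eqxx.
move=> [m _ /and3P[h1 h2 /eqP h3]]; split=> //; exists m; split=> //.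
by rewrite h1.
Qed.

(** A completed customer stays completed until the next arrival, so a rational instant between its
    completion and both [y] and that arrival is also a witness. This reduces the infimum to
    countably many events. *)
Let sojourn_lt n w (y : R) : (sojourn (A ^~ w) (B ^~ w) n < y%:E)%E <->
  exists q : rat, ratr q < y /\ done n (ratr q) w.
Proof.
split=> [/ereal_inf_lt[_ [t [t0 [m [/andP[h1 h2] h3]]] <-]]|[q [qy dq]]]; last first.
  rewrite -lte_fin in qy; apply: le_lt_trans qy; apply: ereal_inf_lbound.
  by exists (ratr q).
rewrite lte_fin => ty.
have : t < Num.min y (arrival (A ^~ w) m.+1 - arrival (A ^~ w) n).
  by rewrite lt_min ty ltrBrDl.
move=> /rat_in_itvoo[q]; rewrite in_itv /= lt_min ltrBrDl => /and3P[tq qy qm].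
exists q; split=> //; split; first by rewrite (le_trans t0) ?ltW.
exists m; split; first by rewrite qm andbT (le_trans h1) // lerD2l ltW.
apply/eqP; rewrite eq_le; apply/andP; split; last first.
  by apply: serve_ge0 => j; exact: remaining_at_arrival_ge0.
rewrite -h3 /remaining /serve; case: ifP => // _.
by apply: le_max2 => //; apply: lerB => //; apply: le_max2 => //; lra.
Qed.

Lemma measurable_sojourn_gt n (x : R) :
  measurable [set w | (x%:E < sojourn (A ^~ w) (B ^~ w) n)%E].
Proof.
rewrite (_ : mkset _ = ~` \bigcap_k \bigcup_(q : rat)
    (if ratr q < x + k.+1%:R^-1 then done n (ratr q) else set0)); last first.
  apply/seteqP; split=> w /=.
    rewrite ltNge => /negP xs h; apply: xs; apply/lee_addgt0Pr => e e0.
    have [k ke] : exists k, k.+1%:R^-1 < e :> R.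
      exists (Num.truncn e^-1); rewrite -[ltRHS]invrK ltf_pV2 ?posrE ?invr_gt0 //.
      exact: truncnS_gt.
    have [q _] := h k I; case: ifP => // qk dq.
    rewrite -EFinD; apply/ltW/sojourn_lt; exists q; split=> //; apply: lt_trans qk _.
    by rewrite ltrD2l.
  move=> h; rewrite ltNge; apply/negP => sx; apply: h => k _.
  have : (sojourn (A ^~ w) (B ^~ w) n < (x + k.+1%:R^-1)%:E)%E.
    by apply: le_lt_trans sx _; rewrite lte_fin ltrDl invr_gt0.
  by move=> /sojourn_lt[q [qk dq]]; exists q => //; rewrite qk.
apply: measurableC; apply: bigcapT_measurable => k.
by apply: bigcupT_measurable_rat => q; case: ifP => _; [exact: measurable_done|].
Qed.

End sojourn_measurability.

(** * Expectations and independence *)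

Section expectation.
Context d (T : measurableType d) (R : realType) (P : probability T R).

Lemma expectation_cst1 : (\int[P]_w (1 : R)%:E = 1)%E.
Proof.
transitivity (\int[P]_w cst 1 w)%E; first by [].
by rewrite integral_cst //= mul1e; exact: probability_setT.
Qed.

Lemma measurable_ltr_set (f g : T -> R) : measurable_fun setT f ->
  measurable_fun setT g -> measurable [set w | f w < g w].
Proof.
move=> mf mg; rewrite (_ : mkset _ = (fun w => g w - f w) @^-1` `]0, +oo[).
  by rewrite -[X in measurable X]setTI; exact: measurable_funB.
by apply/seteqP; split=> w /=; rewrite in_itv /= andbT subr_gt0.
Qed.

Lemma le_integral_cst1 (f : T -> R) : measurable_fun setT f ->
  (forall w, 0 <= f w <= 1) -> (\int[P]_w (f w)%:E <= 1)%E.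
Proof.
move=> mf f01; rewrite -expectation_cst1; apply: ge0_le_integral => //.
- by move=> w _; rewrite lee_fin; case/andP: (f01 w).
- exact/measurable_EFinP.
- by move=> w _; rewrite lee_fin; case/andP: (f01 w).
Qed.

Lemma eq_integral_fine_bounded (D : set T) (f : T -> R) (M : R) : measurable D ->
  measurable_fun D f -> (forall w, D w -> 0 <= f w <= M) ->
  (\int[P]_(w in D) (f w)%:E = (fine (\int[P]_(w in D) (f w)%:E))%:E)%E.
Proof.
move=> mD mf fM; rewrite fineK // ge0_fin_numE; last first.
  by apply: integral_ge0 => w /fM /andP[]; rewrite lee_fin.
apply: (@le_lt_trans _ _ (\int[P]_(w in D) (cst M%:E) w)%E).
  apply: ge0_le_integral => //.
  - by move=> w /fM /andP[]; rewrite lee_fin.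
  - exact/measurable_EFinP.
  - by move=> w /fM /andP[_]; rewrite lee_fin.
have Pf : (P D \is a fin_num)%E by exact: fin_num_measure.
have -> : (\int[P]_(w in D) cst M%:E w = M%:E * P D)%E by exact: integral_cst.
by rewrite -(fineK Pf) -EFinM ltry.
Qed.

End expectation.

Section independence.
Local Open Scope ereal_scope.
Context d (T : measurableType d) (R : realType) (P : probability T R).

Import HBNNSimple.

Lemma integral_setI_indic (D E : set T) (F : T -> \bar R) : measurable D ->
  \int[P]_(w in D) (F w * (\1_E w)%:E) = \int[P]_(w in D `&` E) F w.
Proof.
move=> mD; rewrite integral_mkcondr; apply: eq_integral => w _.
by rewrite epatch_indic.
Qed.

(** The hypothesis on [E] says that [G] on [D], of total mass [c], is independent of [X]. It is the
    claim for indicators; linearity extends it to simple functions and monotone convergence to all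
    [f]. *)
Lemma ge0_integral_independent (D : set T) (X G : T -> R) (c : R) (f : R -> R) :
  measurable D -> measurable_fun setT X -> measurable_fun setT G ->
  (forall w, 0 <= G w)%R -> (0 <= c)%R ->
  (forall E, measurable E ->
     \int[P]_(w in D `&` X @^-1` E) (G w)%:E = c%:E * P (X @^-1` E)) ->
  measurable_fun setT f -> (forall x, 0 <= f x)%R ->
  \int[P]_(w in D) (G w * f (X w))%:E = c%:E * \int[P]_w (f (X w))%:E.
Proof.
move=> mD mX mG G0 c0 DX mf f0.
have mXp E : measurable E -> measurable (X @^-1` E).
  by move=> mE; rewrite -[X @^-1` E]setTI; exact: mX.
have mGe : measurable_fun D (EFin \o G).
  by apply/measurable_EFinP; exact: measurable_funTS.
have simple (k : R) E : (0 <= k)%R -> measurable E ->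
    \int[P]_(w in D) ((G w)%:E * (k * \1_E (X w))%:E) =
    c%:E * \int[P]_w (k * \1_E (X w))%:E.
  move=> k0 mE.
  transitivity (k%:E * \int[P]_(w in D) ((G w)%:E * (\1_(X @^-1` E) w)%:E)).
    rewrite -ge0_integralZl//; last 2 first.
    - apply: emeasurable_funM => //; apply/measurable_EFinP/measurable_funTS.
      exact: measurable_indic (mXp _ mE).
    - by move=> w _; rewrite -EFinM lee_fin mulr_ge0.
    by apply: eq_integral => w _; rewrite EFinM muleCA.
  rewrite integral_setI_indic// DX//.
  under eq_integral do rewrite EFinM.
  rewrite ge0_integralZl//; last first.
    by apply/measurable_EFinP; exact: measurable_indic (mXp _ mE).
  rewrite muleCA; congr (_ * (_ * _)).
  transitivity (\int[P]_w (\1_(X @^-1` E) w)%:E); last by [].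
  by rewrite integral_indic ?setIT //; exact: mXp.
have mfe : measurable_fun setT (EFin \o f) by exact/measurable_EFinP.
have fe0 x : setT x -> 0 <= (EFin \o f) x by move=> _; rewrite lee_fin.
pose f_ := nnsfun_approx measurableT mfe.
have mfX n : measurable_fun setT (fun w => f_ n (X w)) by exact: measurableT_comp.
have step n : \int[P]_(w in D) ((G w)%:E * (f_ n (X w))%:E) =
    c%:E * \int[P]_w (f_ n (X w))%:E.
  have mk (D' : set T) k : measurable_fun D'
      (fun w => (k * \1_(f_ n @^-1` [set k]) (X w))%:E).
    apply/measurable_EFinP/measurable_funTS/measurable_funM => //.
    by apply: (measurableT_comp _ mX); exact: measurable_indic.
  have k0 (k : R) w : (0 <= k * \1_(f_ n @^-1` [set k]) (X w))%R.
    have [k0|k0] := leP 0%R k; first by rewrite mulr_ge0.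
    by rewrite preimage_nnfun0// indic0 mulr0.
  transitivity (\sum_(k \in range (f_ n)) \int[P]_(w in D)
      ((G w)%:E * (k * \1_(f_ n @^-1` [set k]) (X w))%:E)).
    rewrite -ge0_integral_fsum//; last 2 first.
    - by move=> k; apply: emeasurable_funM.
    - by move=> k w _; rewrite -EFinM lee_fin mulr_ge0.
    apply: eq_integral => w _; rewrite fimfunE -fsumEFin// ge0_mule_fsumr//.
    by move=> k; rewrite lee_fin.
  transitivity (\sum_(k \in range (f_ n))
      c%:E * \int[P]_w (k * \1_(f_ n @^-1` [set k]) (X w))%:E).
    apply: eq_fsbigr => k /[!inE] -[x _ <-]; exact: simple.
  rewrite -ge0_mule_fsumr//; last first.
    by move=> k; apply: integral_ge0 => w _; rewrite lee_fin.
  congr (_ * _); rewrite -ge0_integral_fsum//; last first.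
    by move=> k w _; rewrite lee_fin.
  by apply: eq_integral => w _; rewrite fsumEFin// -fimfunE.
have nd x : {homo (fun n => f_ n x) : m n / (m <= n)%N >-> (m <= n)%R}.
  by move=> m n mn; exact/lefP/nd_nnsfun_approx.
have L : \int[P]_(w in D) ((G w)%:E * (f_ n (X w))%:E) @[n --> \oo] -->
    \int[P]_(w in D) (G w * f (X w))%:E.
  rewrite [X in _ --> X](_ : _ =
      \int[P]_(w in D) limn (fun n => (G w)%:E * (f_ n (X w))%:E)).
    apply: cvg_monotone_convergence => //.
    - by move=> n; apply: emeasurable_funM => //; apply/measurable_EFinP/measurable_funTS.
    - by move=> n w _; rewrite -EFinM lee_fin mulr_ge0.
    - by move=> w _ m n mn; rewrite -!EFinM lee_fin ler_wpM2l// nd.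
  apply: eq_integral => w _; apply/esym/cvg_lim => //.
  by rewrite EFinM; apply: cvgeZl => //; exact: cvg_nnsfun_approx.
have L' : c%:E * \int[P]_w (f_ n (X w))%:E @[n --> \oo] -->
    c%:E * \int[P]_w (f (X w))%:E.
  apply: cvgeZl => //.
  rewrite [X in _ --> X](_ : _ = \int[P]_w limn (fun n => (f_ n (X w))%:E)).
    apply: cvg_monotone_convergence => //.
    - by move=> n; apply/measurable_EFinP.
    - by move=> n w _; rewrite lee_fin.
    - by move=> w _ m n mn; rewrite lee_fin nd.
  apply: eq_integral => w _; apply/esym/cvg_lim => //.
  exact: cvg_nnsfun_approx.
have {}L := cvg_lim (@ereal_hausdorff R) L.
have {}L' := cvg_lim (@ereal_hausdorff R) L'.
by rewrite -L -L'; congr (limn _); apply/funext => n; exact: step.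
Qed.

Context (I : eqType) (X : I -> T -> R).
Hypotheses (mX : forall i, measurable_fun setT (X i))
  (indep : mutually_independent P X).

Definition rectangle (s : seq I) (E : I -> set R) : set T :=
  \bigcap_(i in [set` s]) X i @^-1` E i.

Lemma measurable_rectangle s E : (forall i, measurable (E i)) ->
  measurable (rectangle s E).
Proof.
move=> mE; rewrite /rectangle; apply: fin_bigcap_measurable => // i _.
by rewrite -[X i @^-1` _]setTI; exact: mX.
Qed.

(* Models a nonnegative variable G, of expectation g, that is independent of the
   family of the X i with i in J. *)
Definition weight_indep (J : pred I) (G : T -> R) (g : R) :=
  [/\ measurable_fun setT G, forall w, (0 <= G w)%R, (0 <= g)%R &
   forall s E, uniq s -> all J s -> (forall i, measurable (E i)) ->
     \int[P]_(w in rectangle s E) (G w)%:E = g%:E * P (rectangle s E)].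

Lemma weight_indep1 J : weight_indep J (fun=> 1%R) 1%R.
Proof.
split=> // s E us _ mE.
by rewrite integral_cst ?mul1e//; exact: measurable_rectangle.
Qed.

Lemma weight_indep_expectation J G g :
  weight_indep J G g -> \int[P]_w (G w)%:E = g%:E.
Proof.
move=> [_ _ _ /(_ [::] (fun=> setT) isT isT (fun=> measurableT))].
by rewrite /rectangle set_nil bigcap_set0 probability_setT mule1.
Qed.

Lemma weight_indepM (J : pred I) G g i (f : R -> R) (e : R) : J i ->
  measurable_fun setT f -> (forall x, 0 <= f x)%R ->
  \int[P]_w (f (X i w))%:E = e%:E -> weight_indep J G g ->
  weight_indep (fun j => (j != i) && J j) (fun w => G w * f (X i w))%R (g * e)%R.
Proof.
move=> Ji mf f0 fe [mG G0 g0 H]; split.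
- by apply: measurable_funM => //; exact: measurableT_comp.
- by move=> w; rewrite mulr_ge0.
- by rewrite mulr_ge0// -lee_fin -fe integral_ge0// => w _; rewrite lee_fin.
move=> s E us /allP Js mE.
have is' : i \notin s by apply/negP => /Js; rewrite eqxx.
have mD := measurable_rectangle s mE.
have Pfin : P (rectangle s E) \is a fin_num by exact: fin_num_measure.
rewrite (@ge0_integral_independent _ (X i) _ (g * fine (P (rectangle s E)))%R)//.
- by rewrite fe EFinM fineK// EFinM -!muleA; congr (_ * _); rewrite muleC.
- by rewrite mulr_ge0// fine_ge0.
move=> F mF.
pose E' j := if j == i then F else E j.
have mE' j : measurable (E' j) by rewrite /E'; case: ifP.
have rE : rectangle s E `&` X i @^-1` F = rectangle (i :: s) E'.
  apply/seteqP; split=> w /=.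
    move=> [h hi] j /=; rewrite inE /E'; case: eqP => [->//|_ /= js].
    exact: h.
  move=> h; split=> [j /= js|]; last first.
    by have := h i; rewrite /= mem_head /E' eqxx; apply.
  have := h j; rewrite /= inE js orbT /E'; case: eqP => [ji|_]; last exact.
  by rewrite -ji js in is'.
rewrite rE H//; last 2 first.
- by rewrite /= is'.
- by rewrite /= Ji; apply/allP => j /Js /andP[].
rewrite EFinM fineK// -muleA; congr (_ * _).
rewrite /rectangle !indep//; last by rewrite /= is'.
rewrite big_cons /E' eqxx muleC; congr (_ * _).
by apply: eq_big_seq => j js; case: eqP => // ji; rewrite -ji js in is'.
Qed.

Lemma weight_indepS (J J' : pred I) G g : (forall i, J' i -> J i) ->
  weight_indep J G g -> weight_indep J' G g.
Proof.
move=> JJ [mG G0 g0 H]; split=> // s E us /allP Js mE; apply: H => //.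
by apply/allP => i /Js /JJ.
Qed.

Lemma weight_indep_sum (J : pred I) (K : finType) (G : K -> T -> R) (g : K -> R) :
  (forall k, weight_indep J (G k) (g k)) ->
  weight_indep J (fun w => \sum_k G k w)%R (\sum_k g k)%R.
Proof.
move=> H; split.
- by apply: measurable_sum => k; have [] := H k.
- by move=> w; apply: sumr_ge0 => k _; have [_ ->] := H k.
- by apply: sumr_ge0 => k _; have [_ _ ->] := H k.
move=> s E us Js mE; have mD := measurable_rectangle s mE.
under eq_integral do rewrite -sumEFin.
rewrite ge0_integral_sum//; last 2 first.
- by move=> k; have [mG _ _ _] := H k; apply/measurable_EFinP/measurable_funTS.
- by move=> k w _; have [_ G0 _ _] := H k; rewrite lee_fin.
rewrite -sumEFin ge0_sume_distrl; last first.
  by move=> k _; have [_ _ g0 _] := H k; rewrite lee_fin.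
by apply: eq_bigr => k _; have [_ _ _ ->] := H k.
Qed.

End independence.

Lemma identically_distributed_integral d (T : measurableType d) (R : realType)
    (P : probability T R) (Z : nat -> {RV P >-> R}) n (f : R -> R) :
  identically_distributed P Z -> measurable_fun setT f -> (forall x, 0 <= f x) ->
  (\int[P]_w (f (Z n w))%:E = \int[P]_w (f (Z 0%N w))%:E)%E.
Proof.
move=> Zid mf f0.
have E k : (\int[P]_w (f (Z k w))%:E =
    \int[distribution P (Z k)]_x (f x)%:E)%E.
  rewrite ge0_integral_pushforward //; first exact/measurable_EFinP.
  by move=> x _; rewrite lee_fin.
rewrite !E; apply: eq_measure_integral => D mD _.
exact: Zid.
Qed.

(** * Weighted words over a finite alphabet *)

Section words.
Variables (R : realType) (I : finType) (p : I -> R).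
Hypothesis p0 : forall c, 0 <= p c.

(** Integral of [f] against the l-fold product of the weights [p], which later form a
    sub-probability. Recursion on the first letter follows the order of the customers. *)
Fixpoint wsum l (f : seq I -> R) : R :=
  if l is l'.+1 then \sum_c p c * wsum l' (fun s => f (c :: s)) else f [::].

Definition wpr l (Q : pred (seq I)) : R := wsum l (fun s => (Q s)%:R).

Lemma le_wsum l f g : (forall s, size s = l -> f s <= g s) -> wsum l f <= wsum l g.
Proof.
elim: l f g => [|l IH] f g fg /=; first exact: fg.
apply: ler_sum => c _; rewrite ler_wpM2l //; apply: IH => s sl.
by apply: fg; rewrite /= sl.
Qed.

Lemma eq_wsum l f g : (forall s, size s = l -> f s = g s) -> wsum l f = wsum l g.
Proof.
by move=> fg; apply/eqP; rewrite eq_le !le_wsum // => s sl; rewrite fg.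
Qed.

Lemma wsumZ l k f : wsum l (fun s => k * f s) = k * wsum l f.
Proof.
elim: l f => [//|l IH] f /=; rewrite mulr_sumr; apply: eq_bigr => c _.
by rewrite IH mulrCA.
Qed.

Lemma wsum_sum l (J : finType) (f : J -> seq I -> R) :
  wsum l (fun s => \sum_j f j s) = \sum_j wsum l (f j).
Proof.
elim: l f => [//|l IH] f /=; rewrite exchange_big /=.
by apply: eq_bigr => c _; rewrite IH mulr_sumr.
Qed.

Lemma wsum_ge0 l f : (forall s, 0 <= f s) -> 0 <= wsum l f.
Proof.
elim: l f => [|l IH] f f0 /=; first exact: f0.
by apply: sumr_ge0 => c _; rewrite mulr_ge0 ?IH.
Qed.

Lemma wpr_ge0 l Q : 0 <= wpr l Q.
Proof. exact: wsum_ge0. Qed.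

Lemma wsum_prod l (q : I -> R) :
  wsum l (fun s => \prod_(c <- s) q c) = (\sum_c p c * q c) ^+ l.
Proof.
elim: l => [|l IH] /=; first by rewrite big_nil expr0.
rewrite exprS mulr_suml; apply: eq_bigr => c _; rewrite -IH -mulrA -[in RHS]wsumZ.
by congr (_ * _); apply: eq_wsum => s _; rewrite big_cons.
Qed.

Lemma wsum_cat l1 l2 f g h : (forall s1 s2, size s1 = l1 -> size s2 = l2 ->
    f s1 * g s2 <= h (s1 ++ s2)) ->
  wsum l1 f * wsum l2 g <= wsum (l1 + l2) h.
Proof.
elim: l1 f h => [|l1 IH] f h fgh /=.
  by rewrite -wsumZ; apply: le_wsum => s sl; exact: (fgh [::]).
rewrite mulr_suml; apply: ler_sum => c _; rewrite -mulrA ler_wpM2l //.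
by apply: IH => s1 s2 z1 z2; apply: (fgh (c :: s1)); rewrite //= z1.
Qed.

Lemma wpr_cat l1 l2 (P Q S : pred (seq I)) :
  (forall s1 s2, size s1 = l1 -> size s2 = l2 -> P s1 -> Q s2 -> S (s1 ++ s2)) ->
  wpr l1 P * wpr l2 Q <= wpr (l1 + l2) S.
Proof.
move=> PQS; apply: wsum_cat => s1 s2 z1 z2.
case Ps: (P s1); last by rewrite mul0r.
case Qs: (Q s2); last by rewrite mulr0.
by rewrite PQS ?mulr1.
Qed.

Lemma wpr_le l (P Q : pred (seq I)) :
  (forall s, size s = l -> P s -> Q s) -> wpr l P <= wpr l Q.
Proof.
move=> PQ; apply: le_wsum => s sl; have := PQ s sl.
by case: (P s) => [->//|_]; case: (Q s).
Qed.

Variables (u v : I -> nat) (m : nat).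
Hypotheses (um : forall c, (u c <= m)%N) (vm : forall c, (v c <= m)%N).

(* Think of u c and v c as the integer parts of a service time and of an
   inter-arrival time, so that u c - v c - 1 bounds their difference from below. *)
Definition level l (U V : nat) :=
  wpr l (fun s => (sumn (map u s) == U) && (sumn (map v s) == V)).

Lemma level_add l1 l2 U1 V1 U2 V2 :
  level l1 U1 V1 * level l2 U2 V2 <= level (l1 + l2) (U1 + U2) (V1 + V2).
Proof.
apply: wpr_cat => s1 s2 _ _ /andP[/eqP<- /eqP<-] /andP[/eqP<- /eqP<-].
by rewrite !map_cat !sumn_cat !eqxx.
Qed.

Lemma level_pow n l U V :
  level l U V ^+ n <= level (n * l) (n * U) (n * V).
Proof.
elim: n => [|n IH]; first by rewrite !mul0n /level /wpr.
rewrite exprS !mulSn; apply: le_trans (level_add _ _ _ _ _ _).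
by rewrite ler_wpM2l // wpr_ge0.
Qed.

Lemma sumn_map_le (g : I -> nat) s : (forall c, (g c <= m)%N) ->
  (sumn (map g s) <= m * size s)%N.
Proof.
by move=> gm; elim: s => [//|c s IH] /=; rewrite mulnS leq_add.
Qed.

Lemma climbing_blocks l c n :
  wpr l (fun w => sumn (map v w) + l + c <= sumn (map u w))%N ^+ n <=
  wpr (n * l) (fun w => sumn (map v w) + n * l + n * c <= sumn (map u w))%N.
Proof.
elim: n => [|n IH]; first by rewrite !mul0n /wpr.
rewrite exprS mulSn; apply: le_trans (_ : _ <= _ * _) _.
  by apply: ler_wpM2l IH; exact: wpr_ge0.
apply: wpr_cat => s1 s2 _ _ h1 h2.
by rewrite !map_cat !sumn_cat; lia.
Qed.

(** Each completed block loses at most [h]. Inside an unfinished block each letter lowers the sum by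
    at most [m + 1], since [v] is at most [m] and rounding costs 1; hence the extra [l * m.+1], paid
    once and not once per block. *)
Lemma balanced_blocks l h t n :
  wpr l (fun w => (sumn (map v w) + l <= sumn (map u w) + h)%N &&
                  (t <= sumn (map v w))%N) ^+ n <=
  wpr (n * l) (fun w => (n * t <= sumn (map v w))%N &&
    all (fun i => (sumn (map v (take i w)) + i <=
                   sumn (map u (take i w)) + (n * h + l * m.+1))%N)
      (iota 0 (n * l).+1)).
Proof.
elim: n => [|n IH]; first by rewrite !mul0n /wpr.
rewrite exprS mulSn; apply: le_trans (_ : _ <= _ * _) _.
  by apply: ler_wpM2l IH; exact: wpr_ge0.
apply: wpr_cat => s1 s2 z1 z2 /andP[h1 t1] /andP[t2 /allP h2].
apply/andP; split; first by rewrite map_cat sumn_cat; lia.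
apply/allP => i; rewrite mem_iota add0n ltnS => /= il.
rewrite take_cat z1; case: ltnP => li.
  have := sumn_map_le (take i s1) vm; rewrite size_take z1 li => hv.
  nia.
have {h2} := h2 (i - l)%N; rewrite mem_iota /= add0n => /(_ ltac:(lia)).
by rewrite !map_cat !sumn_cat; lia.
Qed.

Hypothesis p1 : \sum_c p c <= 1.

Lemma wpr_le1 l Q : wpr l Q <= 1.
Proof.
rewrite /wpr; elim: l Q => [|l IH] Q /=; first by case: (Q _).
apply: le_trans p1; apply: ler_sum => c _.
by rewrite -[leRHS]mulr1 ler_wpM2l //; exact: (IH (fun s => Q (c :: s))).
Qed.

(** Along [l = 3 j], Bernoulli's inequality for [rho ^ j], cubed, yields growth of order [j ^ 3],
    against order [j ^ 2] on the left. *)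
Lemma exp_beats_square (k : nat) (rho : R) : 1 < rho ->
  exists l : nat, ((k * l).+1 * (k * l).+1)%:R < rho ^+ l.
Proof.
move=> rho1; pose x := rho - 1; have x0 : 0 < x by rewrite subr_gt0.
pose K : R := ((3 * k).+1 * (3 * k).+1)%:R.
have [j Kj] : exists j : nat, K / x ^+ 3 < j%:R.
  exists (Num.truncn (K / x ^+ 3)).+1; exact: truncnS_gt.
have j0 : (0 < j)%N.
  rewrite -(ltr0n R); apply: le_lt_trans Kj.
  by rewrite divr_ge0 // exprn_ge0 // ltW.
exists (j * 3)%N.
apply: (@le_lt_trans _ _ (K * j%:R ^+ 2)).
  rewrite /K -natrX -natrM ler_nat; nia.
have : (x * j%:R) ^+ 3 <= rho ^+ (j * 3).
  rewrite exprM lerXn2r ?nnegrE ?mulr_ge0 ?exprn_ge0 ?ler0n //; try by apply: ltW; lra.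
  have -> : rho = 1 + x by rewrite /x; ring.
  rewrite -[leLHS]add0r mulr_natr.
  have H : 1 + x *+ j <= (1 + x) ^+ j.
    elim: (j) => [|i IH]; first by rewrite mulr0n addr0 expr0.
    rewrite exprSr mulrSr.
    have : (1 + x *+ i) * (1 + x) <= (1 + x) ^+ i * (1 + x).
      by rewrite ler_wpM2r //; lra.
    have : 0 <= x *+ i * x by rewrite mulr_ge0 ?mulrn_wge0 // ltW.
    lra.
  by apply: le_trans H; lra.
apply: lt_le_trans; rewrite exprMn (exprS j%:R 2) mulrA ltr_pM2r ?exprn_gt0 ?ltr0n //.
by rewrite mulrC -ltr_pdivrMr ?exprn_gt0.
Qed.

(* The words of length l only reach polynomially many levels, so one of them
   carries an exponential proportion of the l-th power of the sum. *)
Lemma level_exists (x z r : R) :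
  1 < \sum_c p c * expR (x * (u c)%:R + z * (v c)%:R + r) ->
  exists l U V, 1 < level l U V * expR (x * U%:R + z * V%:R + r * l%:R).
Proof.
move=> /(exp_beats_square m)[l]; set M := (m * l).+1 => Ml.
apply/not_existsP => H; move: Ml; apply/negP; rewrite -leNgt.
pose e (j : 'I_M * 'I_M) : R := expR (x * j.1%:R + z * j.2%:R + r * l%:R).
rewrite -wsum_prod.
have -> : wsum l (fun s => \prod_(c <- s) expR (x * (u c)%:R + z * (v c)%:R + r)) =
    \sum_(j : 'I_M * 'I_M) level l j.1 j.2 * e j.
  transitivity (wsum l (fun s => \sum_(j : 'I_M * 'I_M)
      e j * ((sumn (map u s) == j.1) && (sumn (map v s) == j.2))%:R)).
    apply: eq_wsum => s sl.
    have Us : (sumn (map u s) < M)%N by rewrite ltnS -sl sumn_map_le.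
    have Vs : (sumn (map v s) < M)%N by rewrite ltnS -sl sumn_map_le.
    (* A word lies on exactly one level, and the product of its exponentials depends only on that
       level. *)
    rewrite (bigD1 (Ordinal Us, Ordinal Vs)) //= !eqxx mulr1 [X in _ + X]big1 => [|[i j]].
      rewrite addr0 -expR_sum /e /=; congr expR; rewrite -sl.
      elim: s {sl Us Vs} => [|c s IH]; first by rewrite big_nil /=; ring.
      rewrite big_cons IH /= !natrD -addn1 natrD; ring.
    rewrite xpair_eqE negb_and => /orP[] /negPf ij.
      by rewrite [_ == _](_ : _ = false) ?mulr0 // eq_sym; exact: ij.
    by rewrite andbC [_ == _](_ : _ = false) ?mulr0 // eq_sym; exact: ij.
  rewrite wsum_sum; apply: eq_bigr => j _; rewrite wsumZ; exact: mulrC.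
apply: le_trans (ler_sum _ (G := fun=> 1) _) _ => [j _|].
  by rewrite leNgt; apply/negP => h; apply: (H l); exists j.1, j.2.
by rewrite sumr_const card_prod card_ord.
Qed.

(** A level found by [level_exists] has weight at most 1, so its exponent must be positive: its net
    gain [U - (V + l)] is positive and serves as [c]. *)
Lemma climbing_block (s : R) : 0 < s ->
  1 < \sum_c p c * expR (s * ((u c)%:R - (v c)%:R - 1)) ->
  exists l c : nat, (0 < c)%N /\
    1 < wpr l (fun w => sumn (map v w) + l + c <= sumn (map u w))%N
        * expR (s * c%:R).
Proof.
move=> s0 h; have [|l [U [V lUV]]] := level_exists (x := s) (z := - s) (r := - s).
  apply: lt_le_trans h _; apply: ler_sum => c _; rewrite ler_wpM2l // ler_expR.
  by rewrite le_eqVlt; apply/orP; left; apply/eqP; ring.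
have cUV : (V + l < U)%N.
  rewrite ltnNge; apply/negP => UVl; move: lUV; apply/negP; rewrite -leNgt.
  rewrite -[leRHS]mulr1 ler_pM ?wpr_ge0 ?expR_ge0 ?wpr_le1 // -[leRHS]expR0 ler_expR.
  move: UVl; rewrite -(ler_nat R) natrD => UVl.
  rewrite (_ : _ + _ = - (s * (V%:R + l%:R - U%:R))); last by ring.
  by rewrite oppr_le0 mulr_ge0 ?(ltW s0) // subr_ge0.
exists l, (U - (V + l))%N; split; first by rewrite subn_gt0.
apply: lt_le_trans lUV _; apply: ler_pM; rewrite ?wpr_ge0 ?expR_ge0 //.
  by apply: wpr_le => w wl /andP[/eqP-> /eqP->]; lia.
rewrite ler_expR natrB ?(ltnW cUV) // natrD.
by rewrite le_eqVlt; apply/orP; left; apply/eqP; ring.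
Qed.

(** * Combining ascending and descending blocks *)

Section crossing.
Variables (gam kap : R).
Hypotheses (gam0 : 0 <= gam)
  (gt1 : forall s, 0 <= s <= gam ->
    1 < \sum_c p c * expR (s * ((u c)%:R - (v c)%:R - 1) + kap * (v c)%:R)).

Let descending s := exists l U V, (U <= V + l)%N /\
  1 < level l U V * expR (s * (U%:R - V%:R - l%:R) + kap * V%:R).
Let ascending s := exists l U V, (V + l <= U)%N /\
  1 < level l U V * expR (s * (U%:R - V%:R - l%:R) + kap * V%:R).

Let asc_or_desc s : 0 <= s <= gam -> ascending s \/ descending s.
Proof.
move=> /gt1 h; have [|l [U [V lUV]]] := level_exists (x := s) (z := kap - s) (r := - s).
  apply: lt_le_trans h _; apply: ler_sum => c _; rewrite ler_wpM2l // ler_expR.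
  by rewrite le_eqVlt; apply/orP; left; apply/eqP; ring.
have e : 1 < level l U V * expR (s * (U%:R - V%:R - l%:R) + kap * V%:R).
  rewrite (_ : _ + _ = s * U%:R + (kap - s) * V%:R + - s * l%:R) //; ring.
by case/orP: (leq_total U (V + l)) => ?; [right|left]; exists l, U, V.
Qed.

Let open_block (L d k s : R) : 0 <= L -> 1 < L * expR (s * d + k) ->
  exists2 e, 0 < e & forall s', `|s' - s| < e -> 1 < L * expR (s' * d + k).
Proof.
move=> L0 h; have L1 : 0 < L.
  by rewrite lt_def L0 andbT; apply: contraTneq h => ->; rewrite mul0r -leNgt.
have {h} h : 0 < ln L + (s * d + k).
  by rewrite -[X in _ + X]expRK -lnM ?posrE ?expR_gt0 // ln_gt0.
(* After taking logarithms the condition is affine in [s] with slope [d]; the added 1 covers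
   [d = 0]. *)
exists ((ln L + (s * d + k)) / (`|d| + 1)).
  by rewrite divr_gt0 // ltr_wpDl.
move=> s'; rewrite ltr_pdivlMr; last by rewrite ltr_wpDl.
move=> ss; rewrite -(lnK (x := L)) ?posrE // -expRD expR_gt1.
have : - (`|s' - s| * `|d|) <= (s' - s) * d by rewrite -normrM lerNl -normrN ler_norm.
have : 0 <= `|s' - s| by [].
lra.
Qed.

(** The block lasts at least [t] and loses at most [h] of work. Its own cost is below
    [kap t - gam h]; the missing [gam h] is the price of the initial workload that will cover the
    loss. *)
Lemma balanced_block : exists l h t : nat,
  1 < wpr l (fun w => (sumn (map v w) + l <= sumn (map u w) + h)%N &&
                      (t <= sumn (map v w))%N)
      * expR (kap * t%:R - gam * h%:R).
Proof.
have done0 l U V : (V + l <= U)%N -> 1 < level l U V * expR (kap * V%:R) ->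
    exists l h t : nat, 1 < wpr l (fun w =>
      (sumn (map v w) + l <= sumn (map u w) + h)%N && (t <= sumn (map v w))%N)
      * expR (kap * t%:R - gam * h%:R).
  move=> UV h; exists l, 0%N, V; rewrite mulr0 subr0; apply: lt_le_trans h _.
  rewrite ler_wpM2r ?expR_ge0 //; apply: wpr_le => w _ /andP[/eqP-> /eqP->].
  by rewrite addn0 UV leqnn.
have cross s : ascending s -> descending s -> exists l U V, (V + l <= U)%N /\
    1 < level l U V * expR (kap * V%:R).
  move=> [l2 [U2 [V2 [c2 h2]]]] [l1 [U1 [V1 [c1 h1]]]].
  have [e1|n1] := eqVneq (V1 + l1)%N U1.
    exists l1, U1, V1; rewrite e1; split=> //; move: h1; rewrite -e1 natrD.
    by rewrite (_ : _ + _ - _ - _ = 0 :> R) ?mulr0 ?add0r //; ring.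
  have [e2|n2] := eqVneq (V2 + l2)%N U2.
    exists l2, U2, V2; rewrite e2; split=> //; move: h2; rewrite -e2 natrD.
    by rewrite (_ : _ + _ - _ - _ = 0 :> R) ?mulr0 ?add0r //; ring.
  have {n1} d1 : (0 < V1 + l1 - U1)%N by lia.
  have {n2} d2 : (0 < U2 - (V2 + l2))%N by lia.
  move E1 : (V1 + l1 - U1)%N d1 => d1 d1p.
  move E2 : (U2 - (V2 + l2))%N d2 => d2 d2p.
  have f1 : U1%:R - V1%:R - l1%:R = - d1%:R :> R.
    by rewrite -E1 natrB // natrD; ring.
  have f2 : U2%:R - V2%:R - l2%:R = d2%:R :> R.
    by rewrite -E2 natrB // natrD; ring.
  (* Repeating the block of drift [- d1] exactly [d2] times and the block of drift [d2] exactly [d1]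
     times cancels the drift, and with it the dependence on [s]. *)
  exists (d2 * l1 + d1 * l2)%N, (d2 * U1 + d1 * U2)%N, (d2 * V1 + d1 * V2)%N.
  split; first by nia.
  rewrite f1 in h1; rewrite f2 in h2.
  have g1 : 1 < (level l1 U1 V1 * expR (s * - d1%:R + kap * V1%:R)) ^+ d2.
    by rewrite exprn_egt1 // -lt0n.
  have g2 : 1 < (level l2 U2 V2 * expR (s * d2%:R + kap * V2%:R)) ^+ d1.
    by rewrite exprn_egt1 // -lt0n.
  apply: (lt_le_trans (mulr_egt1 g1 g2)); rewrite !exprMn mulrACA.
  rewrite -!expRM_natr -expRD.
  rewrite (_ : _ + _ = kap * (d2 * V1 + d1 * V2)%:R); last first.
    by rewrite natrD !natrM; ring.
  rewrite ler_wpM2r ?expR_ge0 //; apply: le_trans (level_add _ _ _ _ _ _).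
  by rewrite ler_pM ?exprn_ge0 ?wpr_ge0 // level_pow.
have [[l [U [V [c h]]]]|nasc0] := pselect (ascending 0).
  by apply: done0 c _; rewrite mul0r add0r in h.
have [[l [U [V [c h]]]]|ndesc] := pselect (descending gam).
  exists l, (V + l - U)%N, V; apply: lt_le_trans h _.
  rewrite natrB // natrD (_ : _ - gam * _ =
     gam * (U%:R - V%:R - l%:R) + kap * V%:R); last by ring.
  rewrite ler_wpM2r ?expR_ge0 //; apply: wpr_le => w _ /andP[/eqP-> /eqP->].
  by rewrite leqnn andbT; lia.
suff [s [a d]] : exists s, ascending s /\ descending s.
  by have [l [U [V [c h]]]] := cross _ a d; exact: done0 c h.
(* At the supremum of the descending points, a descending block would remain one slightly to the
   right. So an ascending block exists there, and by openness it also works at a nearby descending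
   point. *)
pose S := [set s | 0 <= s <= gam /\ descending s].
have S0 : S 0.
  by split; [rewrite lexx | have [] := @asc_or_desc 0; rewrite ?lexx].
have Sub : ubound S gam by move=> s [/andP[_]].
have supS : has_sup S by split; [exists 0 | exists gam].
have sI : 0 <= sup S <= gam.
  by rewrite (ub_le_sup (proj2 supS) S0) ge_sup //; exists 0.
case/andP: (sI) => s0 sg.
have [dS|] := pselect (descending (sup S)).
  have sg' : sup S < gam.
    by rewrite lt_neqAle sg andbT; apply/eqP => e; apply: ndesc; rewrite -e.
  move: dS => [l [U [V [c h]]]].
  have [e e0 he] := open_block (wpr_ge0 _ _) h.
  pose s' := sup S + Num.min (e / 2) (gam - sup S).
  have m0 : 0 < Num.min (e / 2) (gam - sup S) by rewrite lt_min divr_gt0 ?subr_gt0.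
  have me : Num.min (e / 2) (gam - sup S) <= e / 2 by rewrite ge_min lexx.
  have mg : Num.min (e / 2) (gam - sup S) <= gam - sup S by rewrite ge_min lexx orbT.
  have : S s'.
    split; first by rewrite /s'; apply/andP; split; lra.
    exists l, U, V; split=> //; apply: he.
    by rewrite /s' addrAC subrr add0r gtr0_norm //; lra.
  by move=> /(ub_le_sup (proj2 supS)); rewrite /s'; lra.
move=> ndS; have [[l [U [V [c h]]]]|//] := asc_or_desc sI.
have [e e0 he] := open_block (wpr_ge0 _ _) h.
have [s [sI' ds] ss] := sup_adherent e0 supS.
exists s; split=> //; exists l, U, V; split=> //; apply: he.
have := ub_le_sup (proj2 supS) (conj sI' ds : S s) => sle.
by rewrite ler0_norm ?subr_le0 //; lra.
Qed.

End crossing.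

End words.

(** * Discretization of moment generating functions *)

Section discretization.
Context d (T : measurableType d) (R : realType) (P : probability T R).

Lemma measurable_expR_lin (Y : T -> R) (v : R) (D : set T) :
  measurable_fun setT Y -> measurable_fun D (fun w => expR (v * Y w)).
Proof.
move=> mY; apply: measurable_funTS; apply: measurableT_comp => //.
exact: measurable_funM.
Qed.

Lemma measurable_expR_linE (Y : T -> R) (v : R) (D : set T) :
  measurable_fun setT Y -> measurable_fun D (fun w => (expR (v * Y w))%:E).
Proof. by move=> mY; apply/measurable_EFinP; exact: measurable_expR_lin. Qed.

(** Truncation keeps the expectation finite for every [v]; for inter-arrival times the full one may
    be infinite when [v > 0]. *)
Definition mgf_trunc (Y : T -> R) (v K : R) : R :=
  fine (\int[P]_(w in [set w | (Y w < K)%R]) (expR (v * Y w))%:E)%E.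

Lemma measurable_lt_cst (Y : T -> R) (K : R) : measurable_fun setT Y ->
  measurable [set w | Y w < K].
Proof. by move=> mY; exact: measurable_ltr_set. Qed.

Section nonneg.
Variable Y : T -> R.
Hypotheses (mY : measurable_fun setT Y) (Y0 : forall w, 0 <= Y w).

Lemma mgf_truncE v K : (\int[P]_(w in [set w | (Y w < K)%R]) (expR (v * Y w))%:E =
  (mgf_trunc Y v K)%:E)%E.
Proof.
apply: (@eq_integral_fine_bounded _ _ _ _ _ _ (expR (`|v| * `|K|))).
- exact: measurable_lt_cst.
- exact: measurable_expR_lin.
move=> w /= YK; rewrite expR_ge0 ler_expR /=.
apply: le_trans (ler_norm _) _; rewrite normrM ler_wpM2l //.
by rewrite (ger0_norm (Y0 w)) (le_trans (ltW YK)) // ler_norm.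
Qed.

Lemma mgf_trunc_ge0 v K : 0 <= mgf_trunc Y v K.
Proof. by rewrite fine_ge0 // integral_ge0 // => w _; rewrite lee_fin expR_ge0. Qed.

Lemma mgf_trunc_homo v K K' : K <= K' -> mgf_trunc Y v K <= mgf_trunc Y v K'.
Proof.
move=> KK; rewrite -lee_fin -!mgf_truncE; apply: ge0_subset_integral.
- exact: measurable_lt_cst.
- exact: measurable_lt_cst.
- exact: measurable_expR_linE.
- by move=> w _; rewrite lee_fin expR_ge0.
- by move=> w /= /lt_le_trans; apply.
Qed.

Lemma mgf_trunc_gt v (a : R) : (a%:E < \int[P]_w (expR (v * Y w))%:E)%E ->
  exists K, a < mgf_trunc Y v K.
Proof.
move=> h; apply/not_existsP => H; move: h; apply/negP; rewrite -leNgt.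
pose F (n : nat) := [set w | Y w < n%:R].
have : (\int[P]_(w in F n) (expR (v * Y w))%:E @[n --> \oo] -->
    \int[P]_(w in \bigcup_n F n) (expR (v * Y w))%:E)%E.
  apply: ge0_nondecreasing_set_cvg_integral.
  - move=> m n mn; rewrite subsetEset => w /= /lt_le_trans; apply.
    by rewrite ler_nat.
  - by move=> n; exact: measurable_lt_cst.
  - by move=> n; exact: measurable_expR_linE.
  - by move=> n w _; rewrite lee_fin expR_ge0.
have -> : \bigcup_n F n = setT.
  apply/seteqP; split=> // w _; exists (Num.truncn (Y w)).+1 => //=.
  exact: truncnS_gt.
move=> /[dup] /cvgP c /(cvg_lim (@ereal_hausdorff R)) <-.
apply: lime_le => //; apply: nearW => n; rewrite mgf_truncE lee_fin leNgt.
by apply/negP; exact: H.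
Qed.

Lemma mgf_trunc_perturb v v' K :
  expR (- (`|v' - v| * K)) * mgf_trunc Y v K <= mgf_trunc Y v' K.
Proof.
rewrite -lee_fin EFinM -!mgf_truncE -ge0_integralZl //; last 2 first.
- exact: measurable_lt_cst.
- exact: measurable_expR_linE.
apply: ge0_le_integral.
- exact: measurable_lt_cst.
- by move=> w _; rewrite -EFinM lee_fin mulr_ge0 ?expR_ge0.
- apply/measurable_EFinP; apply: measurable_funM => //; exact: measurable_expR_lin.
- exact: measurable_expR_linE.
move=> w /= YK; rewrite -EFinM lee_fin -expRD ler_expR.
have : - (`|v' - v| * Y w) <= (v' - v) * Y w.
  by rewrite -{1}(ger0_norm (Y0 w)) -normrM lerNl -normrN ler_norm.
have : `|v' - v| * Y w <= `|v' - v| * K by rewrite ler_wpM2l // ltW.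
lra.
Qed.

Definition cell (dl : R) (j : nat) (y : R) : R :=
  if j%:R * dl <= y < j.+1%:R * dl then 1 else 0.

Definition cell_prob (dl : R) (j : nat) : R := fine (\int[P]_w (cell dl j (Y w))%:E)%E.

Lemma cell_ge0 dl j y : 0 <= cell dl j y.
Proof. by rewrite /cell; case: ifP. Qed.

Lemma measurable_cell dl j : measurable_fun setT (cell dl j).
Proof.
apply: measurable_fun_ifT => //.
by apply: measurable_and; [exact: measurable_fun_ler | exact: measurable_fun_ltr].
Qed.

Lemma measurable_cellY dl j : measurable_fun setT (fun w => cell dl j (Y w)).
Proof. by apply: measurableT_comp => //; exact: measurable_cell. Qed.

Lemma cell_probE dl j : (\int[P]_w (cell dl j (Y w))%:E = (cell_prob dl j)%:E)%E.
Proof.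
apply: (@eq_integral_fine_bounded _ _ _ _ _ _ 1) => //; first exact: measurable_cellY.
by move=> w _; rewrite cell_ge0 /cell; case: ifP => _; rewrite ?ler01 ?lexx.
Qed.

Lemma cell_prob_ge0 dl j : 0 <= cell_prob dl j.
Proof. by rewrite fine_ge0 // integral_ge0 // => w _; rewrite lee_fin cell_ge0. Qed.

Lemma sum_cell_le1 dl k y : 0 < dl -> \sum_(j < k) cell dl j y <= 1.
Proof.
move=> dl0; have [y0|y0] := ltP y 0.
  rewrite big1 // => j _; rewrite /cell ifF //; apply/negbTE; rewrite negb_and.
  by rewrite -ltNge (lt_le_trans y0) // mulr_ge0 // ltW.
have cE j : cell dl j y = if Num.truncn (y / dl) == j then 1 else 0.
  rewrite /cell truncn_eq; last by rewrite divr_ge0 // ltW.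
  by rewrite ler_pdivlMr // ltr_pdivrMr.
under eq_bigr do rewrite cE.
have [h|h] := ltnP (Num.truncn (y / dl)) k.
  rewrite (bigD1 (Ordinal h)) //= eqxx big1 ?addr0 // => j jn.
  by rewrite ifF //; apply: contraNF jn => /eqP e; apply/eqP/val_inj.
rewrite big1 // => j _; rewrite ifF //; apply/negbTE/eqP => e.
by have := ltn_ord j; rewrite -e ltnNge h.
Qed.

Lemma sum_cell_prob_mul dl k (c : nat -> R) : (forall j, 0 <= c j) ->
  ((\sum_(j < k) cell_prob dl j * c j)%:E =
   \int[P]_w (\sum_(j < k) cell dl j (Y w) * c j)%:E)%E.
Proof.
move=> c0; under eq_integral do rewrite -sumEFin.
rewrite ge0_integral_sum //.
- rewrite -sumEFin; apply: eq_bigr => j _.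
  under [RHS]eq_integral do rewrite EFinM muleC.
  rewrite ge0_integralZl_EFin //.
  - by rewrite cell_probE EFinM muleC.
  - by move=> w _; rewrite lee_fin cell_ge0.
  - by apply/measurable_EFinP; exact: measurable_cellY.
- move=> j; apply/measurable_EFinP; apply: measurable_funM => //.
  exact: measurable_cellY.
- by move=> j w _; rewrite lee_fin mulr_ge0 ?cell_ge0.
Qed.

Lemma measurable_sum_cell dl k (c : nat -> R) :
  measurable_fun setT (fun w => (\sum_(j < k) cell dl j (Y w) * c j)%:E).
Proof.
apply/measurable_EFinP; apply: measurable_sum => j; apply: measurable_funM => //.
exact: measurable_cellY.
Qed.

Lemma sum_cell_prob_le1 dl k : 0 < dl -> \sum_(j < k) cell_prob dl j <= 1.
Proof.
move=> dl0; rewrite -lee_fin.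
have := @sum_cell_prob_mul dl k (fun=> 1) (fun=> ler01).
under eq_bigr do rewrite mulr1; move=> ->.
apply: le_integral_cst1.
  by apply/measurable_EFinP; exact: (@measurable_sum_cell dl k (fun=> 1)).
move=> w; under eq_bigr do rewrite mulr1; rewrite sum_cell_le1 // andbT.
by apply: sumr_ge0 => j _; exact: cell_ge0.
Qed.

(** Moving [Y] to the left end of its cell changes the exponent by at most [|v| dl], whatever the
    sign of [v]. *)
Lemma sum_cell_prob_ge dl k (v : R) : 0 < dl ->
  expR (- (`|v| * dl)) * mgf_trunc Y v (k%:R * dl) <=
  \sum_(j < k) cell_prob dl j * expR (v * (dl * j%:R)).
Proof.
move=> dl0; rewrite -lee_fin (sum_cell_prob_mul _ _ (c := fun j => expR (v * (dl * j%:R))));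
  last first.
  by move=> j; exact: expR_ge0.
rewrite EFinM -mgf_truncE -ge0_integralZl //; last 2 first.
- exact: measurable_lt_cst.
- exact: measurable_expR_linE.
have s0 w : 0 <= \sum_(j < k) cell dl j (Y w) * expR (v * (dl * j%:R)).
  by rewrite sumr_ge0 // => j _; rewrite mulr_ge0 ?cell_ge0 ?expR_ge0.
have ms := @measurable_sum_cell dl k (fun j => expR (v * (dl * j%:R))).
apply: (@le_trans _ _ (\int[P]_(w in [set w | (Y w < k%:R * dl)%R])
    (\sum_(j < k) cell dl j (Y w) * expR (v * (dl * j%:R)))%:E)%E); last first.
  apply: ge0_subset_integral => //; first exact: measurable_lt_cst.
  by move=> w _; rewrite lee_fin.
apply: ge0_le_integral.
- exact: measurable_lt_cst.
- by move=> w _; rewrite -EFinM lee_fin mulr_ge0 ?expR_ge0.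
- apply/measurable_EFinP; apply: measurable_funM => //; exact: measurable_expR_lin.
- exact: measurable_funTS.
move=> w /= Yk; rewrite -EFinM lee_fin -expRD.
have y0 : 0 <= Y w / dl by rewrite divr_ge0 // ltW.
have jk : (Num.truncn (Y w / dl) < k)%N.
  by rewrite truncn_lt_nat // ltr_pdivrMr.
rewrite (bigD1 (Ordinal jk)) //=.
apply: le_trans (_ : _ <= cell dl (Num.truncn (Y w / dl)) (Y w) *
    expR (v * (dl * (Num.truncn (Y w / dl))%:R))) _; last first.
  by rewrite lerDl sumr_ge0 // => j _; rewrite mulr_ge0 ?cell_ge0 ?expR_ge0.
have := truncn_itv y0; rewrite ler_pdivlMr // ltr_pdivrMr // => jy.
rewrite /cell jy mul1r ler_expR.
case/andP: jy; rewrite -natr1 mulrDl mul1r; set j := _%:R => h1 h2.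
have : v * (Y w - dl * j) <= `|v| * dl.
  apply: le_trans (ler_norm _) _; rewrite normrM ler_wpM2l // ger0_norm; lra.
lra.
Qed.

End nonneg.

Lemma mgf_trunc_prod_gt1 (Y Z : T -> R) (v s : R) :
  measurable_fun setT Y -> (forall w, 0 <= Y w) ->
  measurable_fun setT Z -> (forall w, 0 <= Z w) ->
  (\int[P]_w (expR (s * Z w))%:E < +oo)%E ->
  (1 < (\int[P]_w (expR (v * Y w))%:E) * (\int[P]_w (expR (s * Z w))%:E))%E ->
  exists2 K, 0 <= K & 1 < mgf_trunc Y v K * mgf_trunc Z s K.
Proof.
move=> mY Y0 mZ Z0 fin h.
have : (0 <= \int[P]_w (expR (s * Z w))%:E)%E.
  by apply: integral_ge0 => w _; rewrite lee_fin expR_ge0.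
move: fin h; case e2E: (\int[P]_w (expR (s * Z w))%:E)%E => [e2||] // _ h.
rewrite lee_fin le_eqVlt => /orP[/eqP e0|e0].
  by move: h; rewrite -e0 mule0 lte_fin ltNge ler01.
(* The expectation of [Y] may be infinite, so [Y] is truncated first, against the finite value [e2];
   [Z] is then truncated against the real number so obtained. *)
have [K1 h1] : exists K, e2^-1 < mgf_trunc Y v K.
  apply: mgf_trunc_gt => //; move: h; rewrite muleC -lte_pdivrMl //.
  by rewrite mule1.
have t0 : 0 < mgf_trunc Y v K1 by apply: lt_trans h1; rewrite invr_gt0.
have [K2 h2] : exists K, (mgf_trunc Y v K1)^-1 < mgf_trunc Z s K.
  apply: mgf_trunc_gt => //; rewrite e2E lte_fin.
  by rewrite -(invrK e2) ltf_pV2 ?posrE ?invr_gt0.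
exists (Num.max 0 (Num.max K1 K2)); first by rewrite le_max lexx.
set K := Num.max 0 _.
have k1 : K1 <= K by rewrite !le_max lexx orbT.
have k2 : K2 <= K by rewrite !le_max lexx !orbT.
rewrite -(mulfV (lt0r_neq0 t0)).
apply: lt_le_trans (_ : mgf_trunc Y v K1 * mgf_trunc Z s K2 <= _).
  by rewrite ltr_pM2l.
by rewrite ler_pM ?mgf_trunc_ge0 // mgf_trunc_homo.
Qed.

Section two.
Variables Y Z : T -> R.
Hypotheses (mY : measurable_fun setT Y) (Y0 : forall w, 0 <= Y w)
  (mZ : measurable_fun setT Z) (Z0 : forall w, 0 <= Z w).

(** With [(n+1) ^ 2] cells of this width the grid covers [0, n+1), so one index governs both
    refinement and truncation. *)
Definition mesh (n : nat) : R := n.+1%:R^-1.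
Definition cells (n : nat) := (n.+1 * n.+1)%N.

(* In a letter c, c.1 and c.2 are the cells of Y and of Z. *)
Definition letter_prob n (c : 'I_(cells n) * 'I_(cells n)) : R :=
  cell_prob Y (mesh n) c.1 * cell_prob Z (mesh n) c.2.

Lemma mesh_gt0 n : 0 < mesh n. Proof. by rewrite invr_gt0. Qed.

Lemma letter_prob_ge0 n c : 0 <= letter_prob (n := n) c.
Proof. by rewrite mulr_ge0 ?cell_prob_ge0. Qed.

Lemma sum_letter_prob_le1 n : \sum_c letter_prob (n := n) c <= 1.
Proof.
rewrite /letter_prob -(pair_bigA _ (fun i j : 'I_(cells n) =>
  cell_prob Y (mesh n) i * cell_prob Z (mesh n) j)) /=.
under eq_bigr do rewrite -mulr_sumr; rewrite -mulr_suml.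
rewrite -[leRHS]mulr1 ler_pM ?sumr_ge0 ?sum_cell_prob_le1 ?mesh_gt0 // => i _;
  exact: cell_prob_ge0.
Qed.

(** Discrete form of the expectation of e^(s (Z - Y) + kap Y). The [- 1] pays for rounding [Z] down
    while [Y] is replaced by the upper end of its cell. *)
Definition discrete_mgf n (s kap : R) : R := \sum_c letter_prob (n := n) c *
  expR (s * mesh n * ((c.2 : nat)%:R - (c.1 : nat)%:R - 1) +
        kap * mesh n * (c.1 : nat)%:R).

Lemma discrete_mgf_ge n s kap :
  expR (- (mesh n * (`|s| + `|kap - s| + s))) *
    (mgf_trunc Y (kap - s) n.+1%:R * mgf_trunc Z s n.+1%:R) <=
  discrete_mgf n s kap.
Proof.
rewrite /discrete_mgf (_ : \sum_c _ = expR (- (s * mesh n)) *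
  ((\sum_(i < cells n) cell_prob Y (mesh n) i * expR ((kap - s) * (mesh n * i%:R))) *
   (\sum_(j < cells n) cell_prob Z (mesh n) j * expR (s * (mesh n * j%:R))))); last first.
  rewrite big_distrlr /= pair_bigA /= mulr_sumr; apply: eq_bigr => -[i j] _ /=.
  rewrite /letter_prob /= mulrACA -expRD mulrCA -expRD; congr (_ * expR _); ring.
have e : (cells n)%:R * mesh n = n.+1%:R by rewrite /cells natrM /mesh mulfK.
have := @sum_cell_prob_ge Y mY Y0 _ (cells n) (kap - s) (mesh_gt0 n).
have := @sum_cell_prob_ge Z mZ Z0 _ (cells n) s (mesh_gt0 n).
rewrite e => h2 h1.
rewrite (_ : - (_ * _) = - (s * mesh n) +
  (- (`|kap - s| * mesh n) + - (`|s| * mesh n))); last by ring.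
rewrite !expRD -!mulrA ler_wpM2l ?expR_ge0 //.
rewrite [X in X <= _](_ : _ =
  (expR (- (`|kap - s| * mesh n)) * mgf_trunc Y (kap - s) n.+1%:R) *
  (expR (- (`|s| * mesh n)) * mgf_trunc Z s n.+1%:R)); last by ring.
by rewrite ler_pM ?mulr_ge0 ?expR_ge0 ?mgf_trunc_ge0.
Qed.

Lemma discrete_mgf_gt1_near (S s0 kap : R) : 0 <= s0 <= S -> 0 <= kap ->
  (\int[P]_w (expR (s0 * Z w))%:E < +oo)%E ->
  (1 < (\int[P]_w (expR ((kap - s0) * Y w))%:E) * (\int[P]_w (expR (s0 * Z w))%:E))%E ->
  exists2 eta, 0 < eta & exists N : nat, forall n s, (N <= n)%N -> 0 <= s <= S ->
    `|s - s0| < eta -> 1 < discrete_mgf n s kap.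
Proof.
move=> /andP[s00 sS] k0 fin /(mgf_trunc_prod_gt1 mY Y0 mZ Z0 fin)[K K0].
set m := _ * _ => m1.
(* [C] bounds the factor [|s| + |kap - s| + s] of [discrete_mgf_ge] on [0, S]. Of the available
   [ln m], discretization spends less than half and the two changes of exponent together at most
   half. *)
pose C := 3 * S + kap + 1 : R.
have C0 : 0 < C by rewrite /C; lra.
have lm : 0 < ln m by rewrite ln_gt0.
exists (ln m / (4 * (K + 1))); first by rewrite divr_gt0 // mulr_gt0; lra.
exists (Num.truncn (Num.max K (2 * C / ln m))) => n s Nn /andP[s_0 sS'] ss.
have nK : K <= n.+1%:R.
  have := truncnS_gt (Num.max K (2 * C / ln m)).
  rewrite gt_max => /andP[/ltW h _]; apply: le_trans h _.
  by rewrite ler_nat ltnS.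
have nC : mesh n * C < ln m / 2.
  have := truncnS_gt (Num.max K (2 * C / ln m)).
  rewrite gt_max => /andP[_ h].
  have {h} h : 2 * C / ln m < n.+1%:R by apply: lt_le_trans h _; rewrite ler_nat ltnS.
  rewrite /mesh mulrC ltr_pdivrMr //.
  by move: h; rewrite ltr_pdivrMr //; lra.
apply: lt_le_trans (discrete_mgf_ge n s kap).
apply: lt_le_trans (_ : expR (- (mesh n * C)) *
  ((expR (- (`|s - s0| * K)) * mgf_trunc Y (kap - s0) K) *
  (expR (- (`|s - s0| * K)) * mgf_trunc Z s0 K)) <= _).
  rewrite mulrACA -/m -(lnK (x := m)) ?posrE; last by apply: lt_trans m1.
  rewrite -!expRD expR_gt1.
  have : `|s - s0| * K <= ln m / 4.
    move: ss; rewrite ltr_pdivlMr; last by lra.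
    have : 0 <= `|s - s0| by [].
    lra.
  lra.
apply: ler_pM; rewrite ?expR_ge0 ?mulr_ge0 ?expR_ge0 ?mgf_trunc_ge0 //.
  rewrite ler_expR lerN2 ler_wpM2l ?(ltW (mesh_gt0 n)) // /C (ger0_norm s_0).
  have : `|kap - s| <= kap + S by rewrite ler_norml; lra.
  lra.
apply: ler_pM; rewrite ?mulr_ge0 ?expR_ge0 ?mgf_trunc_ge0 //.
  apply: le_trans (mgf_trunc_homo _ _ _ nK) => //.
  apply: le_trans (mgf_trunc_perturb _ _ (kap - s0) _ _) => //.
  by rewrite (_ : kap - s - (kap - s0) = - (s - s0)) ?normrN //; ring.
apply: le_trans (mgf_trunc_homo _ _ _ nK) => //.
exact: mgf_trunc_perturb.
Qed.

(** Near each [s0] all fine meshes work; compactness of [0, S] gives one mesh for all [s]. *)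
Lemma discrete_mgf_gt1 (S kap : R) : 0 <= S -> 0 <= kap ->
  (forall s, 0 <= s <= S -> (\int[P]_w (expR (s * Z w))%:E < +oo)%E) ->
  (forall s, 0 <= s <= S ->
    (1 < (\int[P]_w (expR ((kap - s) * Y w))%:E) * (\int[P]_w (expR (s * Z w))%:E))%E) ->
  exists n, forall s, 0 <= s <= S -> 1 < discrete_mgf n s kap.
Proof.
move=> S0 k0 fin gt1.
have /compact_near_coveringP cov := @segment_compact R 0 S.
have : \forall n \near \oo, `[0, S] `<=`
    [set s | 0 <= s <= S -> 1 < discrete_mgf n s kap].
  apply: cov => s0 /=; rewrite in_itv /= => s0S.
  have [eta eta0 [N H]] := discrete_mgf_gt1_near s0S k0 (fin _ s0S) (gt1 _ s0S).
  exists ([set s | `|s - s0| < eta], [set n | (N <= n)%N]) => /=.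
    split; last by exists N.
    exists eta => //= s; rewrite /ball /= distrC; exact.
  by move=> [s n] /= [ss nN] sS; exact: H.
move=> [N _ /(_ N (leqnn N)) h]; exists N => s sS.
by apply: (h s) => //=; rewrite in_itv.
Qed.

End two.
End discretization.

(** * Bounds on the tail of the sojourn time *)

Section queue.
Context d (T : measurableType d) (R : realType) (P : probability T R).
Variables A B : nat -> {RV P >-> R}.
Hypotheses (A_ge0 : forall n w, 0 <= A n w) (B_ge0 : forall n w, 0 <= B n w)
  (AB_indep : mutually_independent P (joint_family A B))
  (A_id : identically_distributed P A) (B_id : identically_distributed P B).
Variable beta : R.
Hypothesis B_le : P [set w | beta < B 0%N w] = 0%E.

Let X := joint_family A B.

Let mX i : measurable_fun setT (X i).
Proof. by case: i => n /=. Qed.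

Lemma above_beta_null : P (\bigcup_n [set w | beta < B n w]) = 0%E.
Proof.
have mS n : measurable [set w | beta < B n w] by exact: measurable_ltr_set.
apply/negligibleP; first exact: bigcupT_measurable.
apply: negligible_bigcup => n; apply/negligibleP => //.
rewrite -B_le.
have pre k : [set w | beta < B k w] = B k @^-1` `]beta, +oo[.
  by apply/seteqP; split=> w /=; rewrite in_itv /= andbT.
by rewrite !pre; exact: B_id.
Qed.

Lemma measurable_above_beta : measurable (\bigcup_n [set w | beta < B n w]).
Proof. by apply: bigcupT_measurable => n; exact: measurable_ltr_set. Qed.

(** The path lemmas need all service times to be at most [beta], which holds only almost surely; the
    exceptional null set is discarded here once and for all. *)
Lemma probability_le_integral (S : set T) (F : T -> R) : measurable S ->
  measurable_fun setT F -> (forall w, 0 <= F w) ->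
  (forall w, (forall n, B n w <= beta) -> S w -> 1 <= F w) ->
  (P S <= \int[P]_w (F w)%:E)%E.
Proof.
move=> mS mF F0 SF; set N := \bigcup_n [set w | beta < B n w].
have mSN : measurable (S `\` N) by apply: measurableD => //; exact: measurable_above_beta.
have -> : P S = P (S `\` N).
  apply/eqP; rewrite eq_le; apply/andP; split.
    rewrite -[leRHS]adde0 -above_beta_null -/N.
    apply: le_trans (measureU2 _ mSN measurable_above_beta).
    apply: le_measure; rewrite ?inE //.
      by apply: measurableU => //; exact: measurable_above_beta.
    by move=> w Sw; have [Nw|Nw] := pselect (N w); [right|left].
  by apply: le_measure; rewrite ?inE // => w [].
rewrite -[S `\` N]setIT -integral_indic //.
apply: ge0_le_integral => //.
- by apply/measurable_EFinP; exact: measurable_indic.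
- exact/measurable_EFinP.
move=> w _; rewrite lee_fin indicE; case: (boolP (w \in _)) => // /set_mem[Sw Nw].
apply: SF => // n; rewrite leNgt; apply/negP => h; apply: Nw.
by exists n.
Qed.

Lemma integral_le_probability (S : set T) (G : T -> R) : measurable S ->
  measurable_fun setT G -> (forall w, 0 <= G w <= 1) ->
  (forall w, (forall n, B n w <= beta) -> 0 < G w -> S w) ->
  (\int[P]_w (G w)%:E <= P S)%E.
Proof.
move=> mS mG G01 GS; set N := \bigcup_n [set w | beta < B n w].
have mSN : measurable (S `|` N) by apply: measurableU => //; exact: measurable_above_beta.
apply: (@le_trans _ _ (P (S `|` N))).
  rewrite -[S `|` N]setIT -integral_indic //.
  apply: ge0_le_integral => //.
  - by move=> w _; rewrite lee_fin; case/andP: (G01 w).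
  - exact/measurable_EFinP.
  - by apply/measurable_EFinP; exact: measurable_indic.
  move=> w _; rewrite lee_fin indicE; case/andP: (G01 w) => G0 G1.
  case: (boolP (w \in _)) => // /negP Sw; rewrite leNgt; apply/negP => Gw; apply: Sw.
  apply/mem_set; have [Nw|Nw] := pselect (N w); [by right|left; apply: GS => // n].
  by rewrite leNgt; apply/negP => h; apply: Nw; exists n.
rewrite -[leRHS]adde0 -above_beta_null.
exact: (measureU2 _ mS measurable_above_beta).
Qed.

(** The variables not yet consumed. Two indices are needed because, after the tagged customer n,
    [A (n + i)] is paired with [B (n.+1 + i)]. *)
Definition avail (a b : nat) : pred (nat + nat) := fun i =>
  match i with inl n => (a <= n)%N | inr n => (b <= n)%N end.

Lemma weight_indep_step a b G g (f h : R -> R) (e1 e2 : R) :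
  measurable_fun setT f -> (forall x, 0 <= f x) ->
  measurable_fun setT h -> (forall x, 0 <= h x) ->
  (\int[P]_w (f (A 0%N w))%:E = e1%:E)%E -> (\int[P]_w (h (B 0%N w))%:E = e2%:E)%E ->
  weight_indep P X (avail a b) G g ->
  weight_indep P X (avail a.+1 b.+1)
    (fun w => G w * (f (A a w) * h (B b w))) (g * (e1 * e2)).
Proof.
move=> mf f0 mh h0 fe he W.
have W1 := @weight_indepM _ _ _ _ _ X mX AB_indep _ _ _ (inl a) f e1 _ mf f0 _ W.
have {}W1 := W1 (leqnn a) _.
have {}W1 := W1 ltac:(by rewrite /X /= (identically_distributed_integral _ A_id)).
have W2 := @weight_indepM _ _ _ _ _ X mX AB_indep _ _ _ (inr b) h e2 _ mh h0 _ W1.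
have {}W2 := W2 (leqnn b) _.
have {}W2 := W2 ltac:(by rewrite /X /= (identically_distributed_integral _ B_id)).
rewrite mulrA (_ : (fun w => _) = (fun w => G w * f (A a w) * h (B b w))); last first.
  by apply/funext => w; rewrite mulrA.
apply: weight_indepS W2 => -[n|n] /= h1.
  by rewrite (ltnW h1) andbT; apply: contraTneq h1 => -[->]; rewrite ltnn.
by rewrite (ltnW h1) andbT; apply: contraTneq h1 => -[->]; rewrite ltnn.
Qed.

Lemma weight_indep_prod a b l G g (f h : R -> R) (e1 e2 : R) :
  measurable_fun setT f -> (forall x, 0 <= f x) ->
  measurable_fun setT h -> (forall x, 0 <= h x) ->
  (\int[P]_w (f (A 0%N w))%:E = e1%:E)%E -> (\int[P]_w (h (B 0%N w))%:E = e2%:E)%E ->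
  weight_indep P X (avail a b) G g ->
  weight_indep P X (avail (a + l) (b + l))
    (fun w => G w * \prod_(i < l) (f (A (a + i)%N w) * h (B (b + i)%N w)))
    (g * (e1 * e2) ^+ l).
Proof.
move=> mf f0 mh h0 fe he W; elim: l => [|l IH].
  rewrite !addn0 expr0 mulr1; rewrite (_ : (fun w => _) = G) //.
  by apply/funext => w; rewrite big_ord0 mulr1.
rewrite !addnS exprSr mulrA (_ : (fun w => _) = (fun w =>
  G w * \prod_(i < l) (f (A (a + i)%N w) * h (B (b + i)%N w)) *
  (f (A (a + l)%N w) * h (B (b + l)%N w)))).
  exact: weight_indep_step mf f0 mh h0 fe he IH.
by apply/funext => w; rewrite big_ord_recr /= mulrA.
Qed.

Definition below_service (x : R) : R := if x < beta then x else 0.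

Lemma measurable_below_service : measurable_fun setT below_service.
Proof. by apply: measurable_fun_ifT => //; exact: measurable_fun_ltr. Qed.

Lemma below_service_ge0 x : 0 <= x -> 0 <= below_service x.
Proof. by rewrite /below_service; case: ifP. Qed.

Lemma sojourn_tail_upper (s u eA eB eA' eB' : R) : 0 <= s -> 0 <= u ->
  (\int[P]_w (expR (- s * A 0%N w))%:E = eA%:E)%E ->
  (\int[P]_w (expR (s * B 0%N w))%:E = eB%:E)%E -> eA * eB < 1 ->
  (\int[P]_w (expR (- u * A 0%N w))%:E = eA'%:E)%E ->
  (\int[P]_w (expR (s * below_service (B 0%N w)))%:E = eB'%:E)%E -> eA' * eB' < 1 ->
  exists C : R, forall n x, 0 <= x ->
    (P [set w | x%:E < sojourn (A ^~ w) (B ^~ w) n] <= (C * expR (- (s - u) * x))%:E)%E.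
Proof.
move=> s0 u0 hA hB lt1 hA' hB' lt1'.
have eA0 : 0 <= eA.
  by rewrite -lee_fin -hA; apply: integral_ge0 => w _; rewrite lee_fin expR_ge0.
have eB0 : 0 <= eB.
  by rewrite -lee_fin -hB; apply: integral_ge0 => w _; rewrite lee_fin expR_ge0.
have eA0' : 0 <= eA'.
  by rewrite -lee_fin -hA'; apply: integral_ge0 => w _; rewrite lee_fin expR_ge0.
have mE (v : R) : measurable_fun setT (fun x : R => expR (v * x)).
  by apply: measurableT_comp => //; exact: measurable_funM.
have mEb : measurable_fun setT (fun x : R => expR (s * below_service x)).
  apply: measurableT_comp => //; apply: measurable_funM => //.
  exact: measurable_below_service.
have eB1' : 1 <= eB'.
  rewrite -lee_fin -hB' -(expectation_cst1 P).
  apply: ge0_le_integral => //.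
  - by apply/measurable_EFinP; exact: (measurableT_comp mEb).
  - move=> w _; rewrite lee_fin -expR0 ler_expR mulr_ge0 // below_service_ge0 //.
have eA1' : eA' < 1 by apply: le_lt_trans lt1'; rewrite ler_peMr.
pose th := eA * eB; pose mu := eA' * eB'.
have th01 : 0 <= th < 1 by rewrite lt1 andbT mulr_ge0.
have mu01 : 0 <= mu < 1 by rewrite lt1' andbT mulr_ge0 // (le_trans ler01).
exists (expR (s * beta) * ((1 - th)^-1 * (1 - mu)^-1)) => n x x0.
set S := [set w | _].
have mS : measurable S by exact: measurable_sojourn_gt.
pose past k w := \prod_(i < n - k)
  (expR (- s * A (k + i)%N w) * expR (s * B (k + i)%N w)).
pose fut m w := \prod_(i < m) (expR (- u * A (n + i)%N w) *
  expR (s * below_service (B (n.+1 + i)%N w))).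
pose K := expR (s * beta) * expR (- (s - u) * x).
have K0 : 0 <= K by rewrite mulr_ge0 ?expR_ge0.
(* The number of arrivals up to time x is unbounded. This weight controls the event that it reaches
   [M]; its contribution vanishes as [M] grows since [eA' < 1]. *)
pose M_last M w := \prod_(i < M) (expR (- u * A (n + i)%N w) * 1).
have one : (\int[P]_w (cst 1 (B 0%N w))%:E = 1%:E)%E by exact: expectation_cst1.
have m1 : measurable_fun setT (fun _ : R => 1 : R) by exact: measurable_cst.
have Wpf k m : (k <= n)%N ->
    weight_indep P X pred0 (fun w => past k w * fut m w) (th ^+ (n - k) * mu ^+ m).
  move=> kn.
  have W0 := @weight_indep1 _ T R P _ X mX (avail k k).
  have W1 := weight_indep_prod (n - k) (mE (- s)) (fun=> expR_ge0 _) (mE s)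
    (fun=> expR_ge0 _) hA hB W0.
  rewrite subnKC // in W1.
  (* The tagged service time [B n] is skipped: it is bounded by [beta], whence the factor
     [expR (s * beta)]. *)
  have {}W1 : weight_indep P X (avail n n.+1) (past k) (th ^+ (n - k)).
    rewrite mul1r in W1; rewrite (_ : past k = (fun w => 1 * past k w)); last first.
      by apply/funext => w; rewrite mul1r.
    by apply: weight_indepS W1 => -[i|i] //= /ltnW.
  have := weight_indep_prod m (mE (- u)) (fun=> expR_ge0 _) mEb
    (fun=> expR_ge0 _) hA' hB' W1.
  by apply: weight_indepS.
have WM M : weight_indep P X pred0 (M_last M) (eA' ^+ M).
  have := weight_indep_prod M (mE (- u)) (fun=> expR_ge0 _) m1
    (fun=> ler01) hA' one (@weight_indep1 _ T R P _ X mX (avail n n)).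
  rewrite mulr1 mul1r (_ : (fun w => 1 * _) = M_last M); first by apply: weight_indepS.
  by apply/funext => w; rewrite mul1r.
have bound M : (P S <= (K * ((1 - th)^-1 * (1 - mu)^-1) + expR (u * x) * eA' ^+ M)%:E)%E.
  pose F w := K * (\sum_(k < n.+1) \sum_(m < M) past k w * fut m w) +
    expR (u * x) * M_last M w.
  have mWpf (k : 'I_n.+1) m : measurable_fun setT (fun w => past k w * fut m w).
    by have [] := Wpf k m (ltn_ord k).
  have Wpf0 (k : 'I_n.+1) m w : 0 <= past k w * fut m w.
    by have [_ ->] := Wpf k m (ltn_ord k).
  have mL : measurable_fun setT (M_last M) by have [] := WM M.
  have L0 w : 0 <= M_last M w by have [_ ->] := WM M.
  have mSS : measurable_fun setT (fun w =>
      \sum_(k < n.+1) \sum_(m < M) past k w * fut m w).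
    by apply: measurable_sum => k; apply: measurable_sum => m.
  have SS0 w : 0 <= \sum_(k < n.+1) \sum_(m < M) past k w * fut m w.
    by apply: sumr_ge0 => k _; apply: sumr_ge0.
  apply: (@le_trans _ _ (\int[P]_w (F w)%:E)%E).
    apply: probability_le_integral => //.
    - by apply: measurable_funD; apply: measurable_funM.
    - by move=> w; rewrite addr_ge0 // mulr_ge0 ?expR_ge0.
    move=> w Bw Sw; rewrite /F.
    pose a := A ^~ w; pose b := B ^~ w.
    have a0 i : 0 <= a i by exact: A_ge0.
    have b0 i : 0 <= b i by exact: B_ge0.
    have [late|early] := leP (arrival a (n + M)) (arrival a n + x).
      apply: (@le_trans _ _ (expR (u * x) * M_last M w)); last first.
        by rewrite lerDr mulr_ge0.
      rewrite /M_last; under eq_bigr do rewrite mulr1.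
      rewrite -expR_sum -expRD -expR0 ler_expR -mulr_sumr mulNr -mulrBr mulr_ge0 //.
      by rewrite subr_ge0 -(arrival_increment a); lra.
    apply: (@le_trans _ _ (K *
      (\sum_(k < n.+1) \sum_(m < M) past k w * fut m w))); last first.
      by rewrite lerDl mulr_ge0 ?expR_ge0.
    have [m mM hm] : exists2 m, (m < M)%N &
        arrival a (n + m) <= arrival a n + x < arrival a (n + m).+1.
      have ex : exists m, arrival a n + x < arrival a (n + m) by exists M.
      case: (ex_minnP ex) => -[|m] hm min.
        by move: hm; rewrite addn0 ltNge lerDl x0.
      exists m; first exact: min.
      rewrite -addnS hm andbT leNgt; apply/negP => /min.
      by rewrite ltnn.
    have := sojourn_gt_work a0 b0 Bw Sw x0 hm.
    have [k kn ->] := lindley_attained a b n.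
    move=> work; have {}kn : (k < n.+1)%N by [].
    rewrite (bigD1 (Ordinal kn)) //= (bigD1 (Ordinal mM)) //=.
    apply: (@le_trans _ _ (K * (past k w * fut m w))); last first.
      rewrite ler_wpM2l // -addrA lerDl addr_ge0 ?sumr_ge0 // => i _.
        exact: (Wpf0 (Ordinal kn)).
      by apply: sumr_ge0.
    rewrite /past /fut.
    under eq_bigr do rewrite -expRD; rewrite -expR_sum.
    under [X in _ * (_ * X)]eq_bigr do rewrite -expRD.
    rewrite -expR_sum /K -!expRD -expR0 ler_expR.
    have E1 : \sum_(i < n - k) (- s * A (k + i)%N w + s * B (k + i)%N w) =
        s * \sum_(k <= j < n) (b j - a j).
      by rewrite sum_nat_shift mulr_sumr; apply: eq_bigr => i _; rewrite /a /b; ring.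
    have E2 : \sum_(i < m) (- u * A (n + i)%N w + s * below_service (B (n.+1 + i)%N w)) =
        - (u * (arrival a (n + m) - arrival a n)) +
        s * \sum_(j < m) below b beta (n + j.+1).
      rewrite big_split /= arrival_increment mulr_sumr mulr_sumr -sumrN.
      congr (_ + _); apply: eq_bigr => i _; first by rewrite mulNr.
      by rewrite addSnnS.
    rewrite E1 E2; set w1 := \sum_(_ <= _ < _) _ in work *.
    set w2 := \sum_(_ < _) _ in work *.
    (* The exponent is the sum of these two nonnegative terms: the work still exceeds x, and the
       m-th later arrival has occurred by time x. *)
    have h1 : 0 <= s * (w1 + beta + w2 - x) by rewrite mulr_ge0 // subr_ge0 ltW.
    have h2 : 0 <= u * (x - (arrival a (n + m) - arrival a n)).
      by rewrite mulr_ge0 //; case/andP: hm => hm _; lra.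
    lra.
  have IF : (\int[P]_w (F w)%:E =
      (K * (\sum_(k < n.+1) \sum_(m < M) th ^+ (n - k) * mu ^+ m) +
      expR (u * x) * eA' ^+ M)%:E)%E.
    have WS : weight_indep P X pred0
        (fun w => \sum_(k < n.+1) \sum_(m < M) past k w * fut m w)
        (\sum_(k < n.+1) \sum_(m < M) th ^+ (n - k) * mu ^+ m).
      apply: weight_indep_sum => // k; apply: weight_indep_sum => // m.
      exact: (Wpf k m (ltn_ord k)).
    under eq_integral do rewrite EFinD.
    rewrite ge0_integralD //; last 4 first.
    - by move=> w _; rewrite lee_fin mulr_ge0.
    - by apply/measurable_EFinP; exact: measurable_funM.
    - by move=> w _; rewrite lee_fin mulr_ge0 ?expR_ge0.
    - by apply/measurable_EFinP; exact: measurable_funM.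
    under eq_integral do rewrite EFinM.
    rewrite ge0_integralZl_EFin //; last 2 first.
    - by move=> w _; rewrite lee_fin.
    - exact/measurable_EFinP.
    under [X in (_ + X)%E]eq_integral do rewrite EFinM.
    rewrite ge0_integralZl_EFin ?expR_ge0 //; last 2 first.
    - by move=> w _; rewrite lee_fin.
    - exact/measurable_EFinP.
    rewrite (weight_indep_expectation WS) (weight_indep_expectation (WM M)).
    by rewrite EFinD !EFinM.
  rewrite IF lee_fin lerD2r ler_wpM2l //.
  under eq_bigr do rewrite -mulr_sumr; rewrite -mulr_suml.
  apply: ler_pM.
  - by apply: sumr_ge0 => k _; rewrite exprn_ge0 //; case/andP: th01.
  - by apply: sumr_ge0 => k _; rewrite exprn_ge0 //; case/andP: mu01.
  - rewrite (reindex_inj rev_ord_inj) /=.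
    under eq_bigr => k _ do rewrite subSS subKn ?leq_ord //.
    exact: sum_geometric_le.
  - exact: sum_geometric_le.
apply/lee_addgt0Pr => e e0.
have [M hM] : exists M, expR (u * x) * eA' ^+ M < e.
  have : expR (u * x) * eA' ^+ M @[M --> \oo] --> expR (u * x) * 0.
    by apply: cvgMr => //; apply: cvg_expr; rewrite ger0_norm.
  rewrite mulr0 => /cvgr_lt /(_ e e0) [M _ /(_ M (leqnn M))] h.
  by exists M.
apply: le_trans (bound M) _; rewrite -EFinD lee_fin.
by rewrite /K mulrAC lerD2l ltW.
Qed.

Local Notation "'up' s" := (sumn (map (fun c => nat_of_ord c.2) s))
  (at level 10, s at level 9).
Local Notation "'down' s" := (sumn (map (fun c => nat_of_ord c.1) s))
  (at level 10, s at level 9).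

(** * Words realized by consecutive customers *)

Section word_events.
Variables (N : nat) (g : R -> R).
Hypotheses (mg : measurable_fun setT g) (g0 : forall x, 0 <= x -> 0 <= g x).
Local Notation letter := ('I_(cells N) * 'I_(cells N))%type.
Local Notation dl := (mesh R N).
Local Notation prob := (letter_prob P (A 0%N) (g \o B 0%N) (n := N)).

Definition letter_weight (c : letter) m w : R :=
  cell dl c.1 (A m w) * cell dl c.2 (g (B m w)).

(** The random variable whose expectation is [wpr]. Each customer falls into at most one pair of
    cells, so at most one word contributes. *)
Fixpoint word_weight l m (Q : pred (seq letter)) w : R :=
  if l is l'.+1 then
    \sum_c letter_weight c m w * word_weight l' m.+1 (fun s => Q (c :: s)) w
  else (Q [::])%:R.

Lemma letter_weight_ge0 c m w : 0 <= letter_weight c m w.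
Proof. by rewrite mulr_ge0 ?cell_ge0. Qed.

Lemma word_weight01 l m Q w : 0 <= word_weight l m Q w <= 1.
Proof.
elim: l m Q => [|l IH] m Q /=; first by case: (Q _); rewrite ?lexx ?ler01.
apply/andP; split.
  apply: sumr_ge0 => c _; rewrite mulr_ge0 ?letter_weight_ge0 //.
  by have /andP[] := IH m.+1 (fun s => Q (c :: s)).
apply: (@le_trans _ _ (\sum_c letter_weight c m w)).
  apply: ler_sum => c _; rewrite ler_piMr ?letter_weight_ge0 //.
  by have /andP[] := IH m.+1 (fun s => Q (c :: s)).
rewrite /letter_weight -(pair_bigA _ (fun i j : 'I_(cells N) =>
  cell dl i (A m w) * cell dl j (g (B m w)))) /=.
under eq_bigr do rewrite -mulr_sumr; rewrite -mulr_suml -[leRHS]mulr1.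
by apply: ler_pM; rewrite ?sumr_ge0 ?sum_cell_le1 ?mesh_gt0 // => i _; exact: cell_ge0.
Qed.

Lemma weight_indep_word l m Q G e : weight_indep P X (avail m m) G e ->
  weight_indep P X (avail (m + l) (m + l))
    (fun w => G w * word_weight l m Q w) (e * wpr prob l Q).
Proof.
elim: l m Q G e => [|l IH] m Q G e W.
  rewrite addn0 /wpr /=; case: W => mG G0 e0 H; case: (Q _) => /=.
    rewrite mulr1 (_ : (fun w => _) = G) //.
    by apply/funext => w; rewrite mulr1.
  rewrite mulr0 (_ : (fun w => _) = (fun=> 0)); last first.
    by apply/funext => w; rewrite mulr0.
  by split=> // s E us Js mE; rewrite integral0_eq // mul0e.
have H c : weight_indep P X (avail (m.+1 + l) (m.+1 + l))
    (fun w => G w * letter_weight c m w * word_weight l m.+1 (fun s => Q (c :: s)) w)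
    (e * prob c * wpr prob l (fun s => Q (c :: s))).
  apply: IH; apply: (weight_indep_step (f := cell dl c.1)
    (h := fun x => cell dl c.2 (g x))) => //.
  - exact: measurable_cell.
  - by move=> x; exact: cell_ge0.
  - by apply: measurableT_comp => //; exact: measurable_cell.
  - by move=> x; exact: cell_ge0.
  - exact: cell_probE.
  - by apply: (cell_probE P (Y := g \o B 0%N)); exact: measurableT_comp.
have := weight_indep_sum mX H.
rewrite addSnnS (_ : (fun w => _) = (fun w => G w * word_weight l.+1 m Q w)).
  rewrite (_ : \sum_c _ = e * wpr prob l.+1 Q) //.
  by rewrite /wpr /= mulr_sumr; apply: eq_bigr => c _; rewrite mulrA.
by apply/funext => w /=; rewrite mulr_sumr; apply: eq_bigr => c _; rewrite mulrA.
Qed.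

(** Inter-arrival times are bounded below for the elapsed time and above for the drift; service
    times only below. *)
Fixpoint hits (s : seq letter) m w : Prop :=
  if s is c :: s' then
    ((c.1 : nat)%:R * dl <= A m w /\ A m w < (c.1 : nat).+1%:R * dl /\
     (c.2 : nat)%:R * dl <= g (B m w)) /\ hits s' m.+1 w
  else True.

Lemma word_weight_gt0 l m Q w : 0 < word_weight l m Q w ->
  exists s, [/\ size s = l, Q s & hits s m w].
Proof.
elim: l m Q => [|l IH] m Q /=.
  by case Qn : (Q [::]); rewrite ?ltxx // => _; exists [::].
move=> h; have [c hc] : exists c, 0 < letter_weight c m w *
    word_weight l m.+1 (fun s => Q (c :: s)) w.
  apply/not_existsP => H; move: h; rewrite ltNge => /negP; apply.
  by apply: sumr_le0 => c _; rewrite leNgt; apply/negP; exact: H.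
have lw : 0 < letter_weight c m w.
  rewrite lt_def letter_weight_ge0 andbT; apply: contraTneq hc => ->.
  by rewrite mul0r ltxx.
move: hc; rewrite pmulr_rgt0 // => /IH[s [sl Qs hs]].
exists (c :: s); rewrite /= sl; split=> //; split=> //.
have cellP j (y : R) : cell dl j y != 0 -> j%:R * dl <= y < j.+1%:R * dl.
  by rewrite /cell; case: ifP => //; rewrite eqxx.
move: (lt0r_neq0 lw); rewrite mulf_eq0 negb_or.
by move=> /andP[/cellP/andP[-> ->] /cellP/andP[-> _]].
Qed.

Lemma hits_time s m w i : hits s m w -> (i <= size s)%N ->
  dl * (down (take i s))%:R <= \sum_(k < i) A (m + k)%N w.
Proof.
elim: s m i => [|c s IH] m [|i] //=; rewrite ?big_ord0 ?mulr0 //.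
move=> [[h1 _] hs] is'.
rewrite (sum_shift_recl (fun k => A k w)) natrD mulrDr.
by rewrite lerD ?IH // mulrC.
Qed.

Lemma hits_drift s m w i : hits s m w -> (i <= size s)%N ->
  dl * ((up (take i s))%:R - (down (take i s))%:R - i%:R) <=
  \sum_(k < i) (g (B (m + k)%N w) - A (m + k)%N w).
Proof.
elim: s m i => [|c s IH] m [|i] //=; rewrite ?big_ord0 ?subrr ?subr0 ?mulr0 //.
move=> [[_ [h2 h3]] hs] is'.
rewrite (sum_shift_recl (fun k => g (B k w) - A k w)).
have := IH m.+1 i hs is'; rewrite !natrD -natr1; move: h2 h3; rewrite -natr1.
by set S := \sum_(_ < _) _; set D := dl; lra.
Qed.

End word_events.

(** The scenario: [N1] climbing blocks just before customer n, whose size is [beta] and whose next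
    inter-arrival time is below [K], then [N2] balanced blocks. The initial work must cover [K], the
    block losses and the worst dip inside a block. *)
Lemma sojourn_tail_blocks n1 n2 l1 c1 l2 h t N1 N2 (K x eK q : R) n :
  0 < beta ->
  (\int[P]_w (if A 0%N w < K then 1 else 0)%:E = eK%:E)%E ->
  (\int[P]_w (if B 0%N w == beta then 1 else 0)%:E = q%:E)%E ->
  K + mesh R n2 * (N2 * h + l2 * (cells n2).+1)%:R <= mesh R n1 * (N1 * c1)%:R ->
  x + 1 < mesh R n2 * (N2 * t)%:R -> (N1 * l1 <= n)%N ->
  ((wpr (letter_prob P (A 0%N) (B 0%N) (n := n1)) l1
      (fun w => down w + l1 + c1 <= up w)%N ^+ N1 * (eK * q) *
    wpr (letter_prob P (A 0%N) (below_service \o B 0%N) (n := n2)) l2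
      (fun w => (down w + l2 <= up w + h)%N && (t <= down w)%N) ^+ N2)%:E <=
   P [set w | x%:E < sojourn (A ^~ w) (B ^~ w) n])%E.
Proof.
move=> beta0 hK hq hdrift htime nN.
have eK0 : 0 <= eK.
  by rewrite -lee_fin -hK; apply: integral_ge0 => w _; rewrite lee_fin; case: ifP.
have q0 : 0 <= q.
  by rewrite -lee_fin -hq; apply: integral_ge0 => w _; rewrite lee_fin; case: ifP.
have mbB : measurable_fun setT (below_service \o B 0%N).
  by apply: measurableT_comp => //; exact: measurable_below_service.
have p1 c : 0 <= letter_prob P (A 0%N) (B 0%N) (n := n1) c by exact: letter_prob_ge0.
have p2 c : 0 <= letter_prob P (A 0%N) (below_service \o B 0%N) (n := n2) c.
  exact: letter_prob_ge0.
have v2 (c : 'I_(cells n2) * 'I_(cells n2)) : (nat_of_ord c.1 <= cells n2)%N.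
  exact: ltnW.
pose Q1 (s : seq ('I_(cells n1) * 'I_(cells n1))) :=
  (down s + N1 * l1 + N1 * c1 <= up s)%N.
pose Q2 (s : seq ('I_(cells n2) * 'I_(cells n2))) := (N2 * t <= down s)%N &&
  all (fun i => (down (take i s) + i <= up (take i s) + (N2 * h + l2 * (cells n2).+1))%N)
    (iota 0 (N2 * l2).+1).
(* Nothing is asked of customers before [p]: by [lindley_ge] they can only add work. *)
pose p := (n - N1 * l1)%N.
pose fA (y : R) : R := if y < K then 1 else 0.
pose fB (y : R) : R := if y == beta then 1 else 0.
pose G w := word_weight id (N1 * l1) p Q1 w * (fA (A n w) * fB (B n w)) *
  word_weight below_service (N2 * l2) n.+1 Q2 w.
have mfA : measurable_fun setT fA.
  by apply: measurable_fun_ifT => //; exact: measurable_fun_ltr.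
have mfB : measurable_fun setT fB.
  by apply: measurable_fun_ifT => //; exact: measurable_fun_eqr.
have fA01 y : 0 <= fA y <= 1 by rewrite /fA; case: ifP; rewrite ?lexx ?ler01.
have fB01 y : 0 <= fB y <= 1 by rewrite /fB; case: ifP; rewrite ?lexx ?ler01.
have W : weight_indep P X (avail (n.+1 + N2 * l2) (n.+1 + N2 * l2)) G
    (wpr (letter_prob P (A 0%N) (B 0%N) (n := n1)) (N1 * l1) Q1 * (eK * q) *
     wpr (letter_prob P (A 0%N) (below_service \o B 0%N) (n := n2)) (N2 * l2) Q2).
  apply: weight_indep_word => //; first exact: measurable_below_service.
  apply: (weight_indep_step) => //.
  - by move=> y; case/andP: (fA01 y).
  - by move=> y; case/andP: (fB01 y).
  have := @weight_indep_word n1 id (@measurable_id _ _ _) (N1 * l1) p Q1 _ _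
    (@weight_indep1 _ T R P _ X mX (avail p p)).
  rewrite subnK // mul1r (_ : (fun w => 1 * _) = word_weight id (N1 * l1) p Q1) //.
  by apply/funext => w; rewrite mul1r.
have [mG G0 _ _] := W.
apply: (@le_trans _ _ (\int[P]_w (G w)%:E)%E).
  rewrite (weight_indep_expectation W) lee_fin; apply: ler_pM.
  - by rewrite mulr_ge0 ?mulr_ge0 ?exprn_ge0 ?wpr_ge0.
  - by rewrite exprn_ge0 ?wpr_ge0.
  - rewrite ler_wpM2r ?mulr_ge0 //; exact: (climbing_blocks p1).
  - exact: (balanced_blocks p2 _ v2).
apply: (integral_le_probability) => //.
- exact: measurable_sojourn_gt.
- move=> w; rewrite G0 /=.
  have /andP[a0 a1] := word_weight01 id (N1 * l1) p Q1 w.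
  have /andP[b0 b1] := word_weight01 below_service (N2 * l2) n.+1 Q2 w.
  have /andP[c0 c1'] := fA01 (A n w); have /andP[d0 d1] := fB01 (B n w).
  by apply: mulr_ile1; rewrite ?mulr_ge0 //; apply: mulr_ile1; rewrite ?mulr_ge0 //;
    apply: mulr_ile1.
move=> w Bw Gw.
have /andP[a0 _] := word_weight01 id (N1 * l1) p Q1 w.
have /andP[b0 _] := word_weight01 below_service (N2 * l2) n.+1 Q2 w.
have [/word_weight_gt0[s1 [z1 q1 h1]] An Bn /word_weight_gt0[s2 [z2 q2 h2]]] :
    [/\ 0 < word_weight id (N1 * l1) p Q1 w, A n w < K, B n w = beta &
        0 < word_weight below_service (N2 * l2) n.+1 Q2 w].
  move: Gw; rewrite /G /fA /fB.
  case: ifP => // [AK|_]; last by rewrite mul0r mulr0 mul0r ltxx.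
  case: eqP => // [Be|_]; last by rewrite mulr0 mulr0 mul0r ltxx.
  rewrite !mulr1 => Gw; split=> //; rewrite lt_def ?a0 ?b0 andbT.
    by apply: contraTneq Gw => ->; rewrite mul0r ltxx.
  by apply: contraTneq Gw => ->; rewrite mulr0 ltxx.
pose a := A ^~ w; pose b := B ^~ w.
have a_ge0 i : 0 <= a i by exact: A_ge0.
have b_ge0 i : 0 <= b i by exact: B_ge0.
(* The extra inter-arrival time is [A n], which precedes the blocks and is charged to the initial
   workload through [K]. *)
apply: (@sojourn_gt _ a b beta a_ge0 b_ge0 Bw n (N2 * l2).+1 x beta0 Bn).
  move=> i iM; rewrite arrival_increment sum_shift_recl.
  have lind : mesh R n1 * (N1 * c1)%:R <= lindley a b n.
    have := lindley_ge a b (leq_subr (N1 * l1) n); rewrite -/p; apply: le_trans.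
    have := hits_drift h1 (leqnn (size s1)); rewrite take_size z1.
    have -> : \sum_(k < N1 * l1) (B (p + k)%N w - A (p + k)%N w) =
        \sum_(p <= j < n) (b j - a j).
      by rewrite sum_nat_shift subKn.
    apply: le_trans; rewrite ler_wpM2l ?(ltW (mesh_gt0 _ _)) //.
    move: q1; rewrite /Q1 -(ler_nat R) !natrD.
    by set u := (sumn _)%:R; set v := (sumn _)%:R; lra.
  have is2 : (i <= size s2)%N by rewrite z2 -ltnS.
  have := hits_drift h2 is2; rewrite sumrB.
  have -> : \sum_(k < i) below_service (B (n.+1 + k)%N w) =
      \sum_(j < i) below b beta (n + j.+1)%N.
    by apply: eq_bigr => k _; rewrite addSnnS.
  case/andP: q2 => _ /allP/(_ i); rewrite mem_iota add0n leq0n ltnS -ltnS iM.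
  move=> /(_ isT); rewrite -(ler_nat R) natrD [X in _ <= X]natrD => q2 dr.
  have : mesh R n2 * - (N2 * h + l2 * (cells n2).+1)%:R <=
    mesh R n2 * ((up (take i s2))%:R - (down (take i s2))%:R - i%:R).
    rewrite ler_wpM2l ?(ltW (mesh_gt0 _ _)) //; move: q2.
    by set u := (sumn _)%:R; set v := (sumn _)%:R; set z := (_ + _)%:R; lra.
  move: dr lind hdrift An; rewrite /a mulrN.
  set s_b := \sum_(_ < _) below _ _ _; set s_a := \sum_(_ < _) A _ _.
  set z := mesh R n2 * (_ + _)%:R; set y := mesh R n2 * (_ - _ - _).
  set y' := mesh R n1 * _; lra.
rewrite arrival_increment sum_shift_recl.
have := hits_time h2 (leqnn (size s2)); rewrite take_size z2.
case/andP: q2 => q2 _ ht.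
have : mesh R n2 * (N2 * t)%:R <= mesh R n2 * (down s2)%:R.
  by rewrite ler_wpM2l ?(ltW (mesh_gt0 _ _)) // ler_nat.
have := a_ge0 n; move: ht htime.
by set S := \sum_(_ < _) _; set z := mesh R n2 * _; set z' := mesh R n2 * _; lra.
Qed.

Lemma sojourn_tail_lower (gam kap q : R) : 0 <= gam -> 0 < kap -> 0 < beta -> 0 < q ->
  (\int[P]_w (if B 0%N w == beta then 1 else 0)%:E = q%:E)%E ->
  (forall s, 0 <= s -> (\int[P]_w (expR (s * B 0%N w))%:E < +oo)%E) ->
  (forall s, 0 <= s ->
    (\int[P]_w (expR (s * below_service (B 0%N w)))%:E < +oo)%E) ->
  (forall s, gam < s -> (1 < (\int[P]_w (expR (- s * A 0%N w))%:E) *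
                             (\int[P]_w (expR (s * B 0%N w))%:E))%E) ->
  (forall s, 0 <= s <= gam -> (1 < (\int[P]_w (expR ((kap - s) * A 0%N w))%:E) *
    (\int[P]_w (expR (s * below_service (B 0%N w)))%:E))%E) ->
  forall eta, 0 < eta -> exists2 c, 0 < c & forall x, 0 <= x ->
    exists n0, forall n, (n0 <= n)%N ->
      ((c * expR (- (kap + eta) * x))%:E <=
       P [set w | x%:E < sojourn (A ^~ w) (B ^~ w) n])%E.
Proof.
move=> gam0 kap0 beta0 q0 hq finB finB' gt1 gt1' eta eta0.
have mA0 := @measurable_funPT _ _ _ _ (A 0%N).
have mB0 := @measurable_funPT _ _ _ _ (B 0%N).
have mbB : measurable_fun setT (below_service \o B 0%N).
  by apply: measurableT_comp => //; exact: measurable_below_service.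
have bB0 w : 0 <= (below_service \o B 0%N) w by exact: below_service_ge0.
have ord_le k (i : 'I_k) : (i <= k)%N by exact: ltnW.
have [n2 hn2] := discrete_mgf_gt1 mA0 (A_ge0 0%N) mbB bB0 gam0 (ltW kap0)
  (fun s hs => finB' s (proj1 (andP hs))) gt1'.
set p2 := letter_prob P (A 0%N) (below_service \o B 0%N) (n := n2).
pose d2 := mesh R n2; have d20 : 0 < d2 := mesh_gt0 R n2.
have [l2 [h [t]]] : exists l h t : nat,
  1 < wpr p2 l (fun w => (sumn (map (fun c => nat_of_ord c.1) w) + l <=
                          sumn (map (fun c => nat_of_ord c.2) w) + h)%N &&
                      (t <= sumn (map (fun c => nat_of_ord c.1) w))%N)
      * expR (kap * d2 * t%:R - gam * d2 * h%:R).
  apply: (@balanced_block _ _ p2 _ (fun c => nat_of_ord c.2)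
    (fun c => nat_of_ord c.1) (cells n2) _ _ _ (gam * d2) (kap * d2)).
  - by move=> c; exact: letter_prob_ge0.
  - by move=> c; exact: ord_le.
  - by move=> c; exact: ord_le.
  - exact: sum_letter_prob_le1.
  - by rewrite mulr_ge0 // ltW.
  move=> s /andP[s0 sg]; have := hn2 (s / d2).
  rewrite divr_ge0 ?(ltW d20) //= ler_pdivrMr // sg => /(_ isT).
  by rewrite /discrete_mgf -/d2 divfK ?lt0r_neq0.
set pr2 := wpr _ _ _ => hpr2.
have pr20 : 0 <= pr2 by apply: wpr_ge0 => c; exact: letter_prob_ge0.
have pr21 : pr2 <= 1.
  by apply: wpr_le1; [move=> c; exact: letter_prob_ge0 | exact: sum_letter_prob_le1].
have ht : 0 < kap * d2 * t%:R - gam * d2 * h%:R.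
  rewrite -expR_gt1; apply: lt_le_trans hpr2 _.
  by rewrite ler_piMl ?expR_ge0.
have t0 : 0 < t%:R :> R.
  rewrite lt_def ler0n andbT; apply: contraTneq ht => ->.
  by rewrite mulr0 sub0r oppr_gt0 -leNgt mulr_ge0 // mulr_ge0 // ltW.
(* Building work at rate [gam + ep] costs an extra [ep h] per balanced block, at most [eta t]: an
   increase of the decay rate by at most [eta]. *)
pose ep := eta * t%:R / (h%:R + 1).
have ep0 : 0 < ep by rewrite divr_gt0 ?mulr_gt0 // ltr_wpDl.
have eph : ep * h%:R <= eta * t%:R.
  rewrite /ep -mulrAC ler_pdivrMr ?ltr_wpDl // ler_wpM2l ?mulr_ge0 ?(ltW eta0) //.
  lra.
pose g1 := gam + ep; have g10 : 0 < g1 by rewrite /g1; lra.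
(* With [kap = 0] the elapsed time carries no reward: the climb before the tagged arrival may take
   any time. *)
have [e1 e10 [n1 hn1]] := @discrete_mgf_gt1_near _ _ _ P _ _ mA0 (A_ge0 0%N) mB0
  (B_ge0 0%N) g1 g1 0 ltac:(by rewrite (ltW g10) lexx) (lexx 0) (finB g1 (ltW g10))
  ltac:(by rewrite sub0r; apply: gt1; rewrite /g1; lra).
have {}hn1 := hn1 n1 g1 (leqnn _) ltac:(by rewrite (ltW g10) lexx)
  ltac:(by rewrite subrr normr0).
set p1 := letter_prob P (A 0%N) (B 0%N) (n := n1) in hn1.
pose d1 := mesh R n1; have d10 : 0 < d1 := mesh_gt0 R n1.
have [l1 [c1 [c10]]] : exists l c : nat, (0 < c)%N /\
    1 < wpr p1 l (fun w => sumn (map (fun c => nat_of_ord c.1) w) + l + c <=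
                           sumn (map (fun c => nat_of_ord c.2) w))%N
        * expR (g1 * d1 * c%:R).
  apply: (@climbing_block _ _ p1 _ (fun c => nat_of_ord c.2)
    (fun c => nat_of_ord c.1) (cells n1) _ _ _ (g1 * d1)).
  - by move=> c; exact: letter_prob_ge0.
  - by move=> c; exact: ord_le.
  - by move=> c; exact: ord_le.
  - exact: sum_letter_prob_le1.
  - by rewrite mulr_gt0.
  move: hn1; rewrite /discrete_mgf -/d1; congr (_ < _).
  by apply: eq_bigr => c _; rewrite !mul0r addr0.
set pr1 := wpr _ _ _ => hpr1.
have pr10 : 0 <= pr1 by apply: wpr_ge0 => c; exact: letter_prob_ge0.
have [K hK] : exists K, 0 < mgf_trunc P (A 0%N) 0 K.
  apply: mgf_trunc_gt => //; under eq_integral do rewrite mul0r expR0.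
  by rewrite expectation_cst1 lte_fin.
have eKE : (\int[P]_w (if A 0%N w < K then 1 else 0)%:E = (mgf_trunc P (A 0%N) 0 K)%:E)%E.
  rewrite -mgf_truncE // [RHS]integral_mkcond; apply: eq_integral => w _.
  rewrite patchE mul0r expR0; case: ifP => AK.
    by rewrite ifT //; apply/mem_set.
  by rewrite ifF //; apply/negP => /set_mem /=; rewrite AK.
set eK := mgf_trunc _ _ _ _ in hK eKE.
pose K0 := K + d2 * (l2 * (cells n2).+1)%:R.
pose rate2 := kap * d2 * t%:R - gam * d2 * h%:R.
have d1c1 : 0 < d1 * c1%:R by rewrite mulr_gt0 ?ltr0n.
(* The factors free of x: the fixed part of the workload, the tagged customer, the rounding up of
   [N1] and [N2] to whole blocks, and the spare unit in [x + 1]. *)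
pose c := expR (- (g1 * (`|K0| + d1 * c1%:R))) * (eK * q) *
  expR (- (kap * d2 * t%:R + ep * d2 * h%:R + (kap + eta))).
exists c; first by rewrite /c !mulr_gt0 ?expR_gt0.
move=> x x0.
pose N2 := (Num.truncn ((x + 1) / (d2 * t%:R))).+1.
pose Z := `|K0| + d2 * h%:R * N2%:R.
pose N1 := (Num.truncn (Z / (d1 * c1%:R))).+1.
exists (N1 * l1)%N => n nn.
have d2t : 0 < d2 * t%:R by rewrite mulr_gt0.
have Z0 : 0 <= Z by rewrite addr_ge0 // mulr_ge0 // mulr_ge0 // ltW.
have hN2 : x + 1 < d2 * (N2 * t)%:R.
  rewrite natrM mulrCA mulrC -ltr_pdivrMl // mulrC; exact: truncnS_gt.
have hN2' : N2%:R <= (x + 1) / (d2 * t%:R) + 1.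
  by rewrite /N2 -natr1 lerD2r truncn_le divr_ge0 ?(ltW d2t) //; lra.
have hN1 : Z <= d1 * (N1 * c1)%:R.
  rewrite natrM mulrCA mulrC -ler_pdivrMl // mulrC; apply: ltW; exact: truncnS_gt.
have hN1' : N1%:R <= Z / (d1 * c1%:R) + 1.
  by rewrite /N1 -natr1 lerD2r truncn_le divr_ge0 ?(ltW d1c1).
have hdrift : K + d2 * (N2 * h + l2 * (cells n2).+1)%:R <= d1 * (N1 * c1)%:R.
  apply: le_trans hN1; rewrite /Z /K0 natrD [(N2 * h)%:R]natrM.
  have := ler_norm (K + d2 * (l2 * (cells n2).+1)%:R).
  by set z := `| _ |; lra.
have := sojourn_tail_blocks beta0 eKE hq hdrift hN2 nn.
apply: le_trans; rewrite lee_fin -/p1 -/p2 -/pr1 -/pr2.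
have b1 : expR (- (g1 * (Z + d1 * c1%:R))) <= pr1 ^+ N1.
  have : (expR (- (g1 * d1 * c1%:R))) ^+ N1 <= pr1 ^+ N1.
    rewrite lerXn2r ?nnegrE ?expR_ge0 // expRN -div1r ler_pdivrMr ?expR_gt0 //.
    exact: ltW.
  apply: le_trans; rewrite -expRM_natr ler_expR mulNr lerN2.
  have : d1 * c1%:R * N1%:R <= Z + d1 * c1%:R.
    have := ler_wpM2l (ltW d1c1) hN1'.
    by rewrite mulrDr mulr1 mulrCA mulfV ?mulr1 // lt0r_neq0.
  by move=> /(ler_wpM2l (ltW g10)); rewrite !mulrA.
have b2 : expR (- (rate2 * N2%:R)) <= pr2 ^+ N2.
  have : (expR (- rate2)) ^+ N2 <= pr2 ^+ N2.
    rewrite lerXn2r ?nnegrE ?expR_ge0 // expRN -div1r ler_pdivrMr ?expR_gt0 //.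
    exact: ltW.
  by apply: le_trans; rewrite -expRM_natr ler_expR mulNr.
apply: le_trans (_ : expR (- (g1 * (Z + d1 * c1%:R))) * (eK * q) *
   expR (- (rate2 * N2%:R)) <= _); last first.
  apply: ler_pM; rewrite ?mulr_ge0 ?expR_ge0 ?(ltW hK) ?(ltW q0) //.
  by apply: ler_pM; rewrite ?mulr_ge0 ?expR_ge0 ?(ltW hK) ?(ltW q0).
have swap (y y' : R) : expR y * (eK * q) * expR y' = eK * q * expR (y + y').
  by rewrite expRD; ring.
rewrite /c !swap -[X in X <= _]mulrA -expRD ler_wpM2l ?mulr_ge0 ?(ltW hK) ?(ltW q0) //.
rewrite ler_expR.
have e2 : g1 * (Z + d1 * c1%:R) + rate2 * N2%:R =
  g1 * (`|K0| + d1 * c1%:R) + (kap * d2 * t%:R + ep * d2 * h%:R) * N2%:R.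
  by rewrite /Z /rate2 /g1; ring.
have e3 : (kap * d2 * t%:R + ep * d2 * h%:R) * N2%:R <=
  (kap + eta) * (x + 1) + (kap * d2 * t%:R + ep * d2 * h%:R).
  have c0 : 0 <= kap * d2 * t%:R + ep * d2 * h%:R.
    by rewrite addr_ge0 // !mulr_ge0 // ltW.
  apply: le_trans (ler_wpM2l c0 hN2') _; rewrite mulrDr mulr1 lerD2r.
  rewrite mulrA ler_pdivrMr // [leRHS]mulrAC ler_wpM2r //; first by lra.
  have := ler_wpM2l (ltW d20) eph; lra.
lra.
Qed.

End queue.

(** * The rate function *)

Section strict_integral.
Context d (T : measurableType d) (R : realType) (P : probability T R).

(** A law has countably many atoms, while an interval has positive Lebesgue measure. *)
Lemma exists_no_atom (Z : {RV P >-> R}) (a b : R) : a < b ->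
  exists2 x, a < x < b & P [set w | Z w = x] = 0%E.
Proof.
move=> ab; apply/not_exists2P => H.
have : countable `]a, b[%classic.
  apply: sub_countable (pmf_gt0_countable Z); apply: subset_card_le => x /=.
  rewrite in_itv /= => xab; rewrite lt_def pmf_ge0 andbT; apply/eqP => e.
  case: (H x) => [nx|]; [by rewrite xab in nx | apply].
  have mZ : measurable (Z @^-1` [set x]) by exact: measurable_funPTI.
  by rewrite -[LHS]fineK ?fin_num_measure // -[fine _]/(pmf Z x) e.
move/countable_lebesgue_measure0; rewrite lebesgue_measure_itv /= lte_fin ab.
by rewrite -EFinD => -[/eqP]; rewrite subr_eq0 gt_eqF.
Qed.

Lemma ltr_integral (f g : T -> R) : measurable_fun setT f -> measurable_fun setT g ->
  (forall w, 0 <= f w <= g w) -> (\int[P]_w (f w)%:E < +oo)%E ->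
  (0 < P [set w | (f w < g w)%R])%E ->
  (\int[P]_w (f w)%:E < \int[P]_w (g w)%:E)%E.
Proof.
move=> mf mg fg fin fgP.
have f0 w : 0 <= f w by case/andP: (fg w).
have h0 w : 0 <= g w - f w by rewrite subr_ge0; case/andP: (fg w).
have mh : measurable_fun setT (fun w => g w - f w) by exact: measurable_funB.
have -> : (\int[P]_w (g w)%:E = \int[P]_w (f w)%:E + \int[P]_w (g w - f w)%:E)%E.
  rewrite -ge0_integralD //.
  - by apply: eq_integral => w _; rewrite -EFinD addrC subrK.
  - by move=> w _; rewrite lee_fin.
  - exact/measurable_EFinP.
  - by move=> w _; rewrite lee_fin.
  - exact/measurable_EFinP.
rewrite lteDl; last first.
  by rewrite ge0_fin_numE // integral_ge0 // => w _; rewrite lee_fin.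
rewrite lt_def integral_ge0 ?andbT; last by move=> w _; rewrite lee_fin.
apply/eqP => I0.
have [N [mN N0 sub]] : {ae P, forall w, setT w -> (g w - f w)%:E = 0%E}.
  apply/(ae_eq_integral_abs P measurableT); first exact/measurable_EFinP.
  by rewrite -[RHS]I0; apply: eq_integral => w _; rewrite abse_EFin ger0_norm.
move: fgP; rewrite ltNge => /negP; apply; rewrite -N0.
apply: le_measure; rewrite ?inE //; first exact: measurable_ltr_set.
by move=> w /= fgw; apply: sub => /= /(_ I) [] /eqP; rewrite subr_eq0 gt_eqF.
Qed.

End strict_integral.

Lemma mnormalize_gt0 d (T : measurableType d) (R : realType)
    (mu : {measure set T -> \bar R}) (P : probability T R) (e : R) D :
  0 < e -> mu setT = e%:E -> (mnormalize mu P D = mu D * (e^-1)%:E)%E.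
Proof. by move=> e0 muT; rewrite /mnormalize muT eqe gt_eqF. Qed.

(** * Service times below the right endpoint *)

Section service_distribution.
Context d (T : measurableType d) (R : realType) (P : probability T R).
Variable B : {RV P >-> R}.
Hypothesis B_ge0 : forall w, 0 <= B w.

Let measurable_B_gt x : measurable [set w | x < B w].
Proof.
rewrite (_ : mkset _ = B @^-1` `]x, +oo[); first exact: measurable_funPTI.
by apply/seteqP; split=> w /=; rewrite in_itv /= andbT.
Qed.

(** An atom of positive probability is attained at some sample point, and [B] takes real values. *)
Lemma right_endpoint_real : (0 < P [set w | (B w)%:E = right_endpoint B])%E ->
  exists2 beta, 0 <= beta & right_endpoint B = beta%:E.
Proof.
move=> h; have [w Bw] : exists w, (B w)%:E = right_endpoint B.
  apply/not_existsP => H; move: h; rewrite (_ : mkset _ = set0) ?measure0 ?ltxx //.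
  by apply/seteqP; split=> w //= /H.
by exists (B w).
Qed.

Variable beta : R.
Hypothesis xB : right_endpoint B = beta%:E.

Lemma above_right_endpoint : P [set w | beta < B w] = 0%E.
Proof.
have sub : [set w | beta < B w] `<=` \bigcup_n [set w | beta + n.+1%:R^-1 < B w].
  move=> w /= bw; exists (Num.truncn (B w - beta)^-1) => //=.
  rewrite -ltrBrDl -[ltRHS]invrK ltf_pV2 ?posrE ?invr_gt0 ?subr_gt0 //.
  exact: truncnS_gt.
apply/negligibleP => //; apply: negligibleS sub _.
apply: negligible_bigcup => n; apply/negligibleP => //.
apply/eqP; rewrite eq_le measure_ge0 andbT leNgt; apply/negP => h.
have : ((beta + n.+1%:R^-1)%:E <= right_endpoint B)%E.
  by apply: ereal_sup_ubound; exists (beta + n.+1%:R^-1).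
by rewrite xB lee_fin leNgt ltrDl invr_gt0 ltr0n.
Qed.

Lemma mgf_fin s : 0 <= s -> (\int[P]_w (expR (s * B w))%:E < +oo)%E.
Proof.
move=> s0; have mB := measurable_B_gt.
have h : ae_eq P setT (fun w => (expR (s * B w))%:E)
    (fun w => (expR (s * Num.min beta (B w)))%:E).
  exists [set w | beta < B w]; split=> //; first exact: above_right_endpoint.
  move=> w /= nw; rewrite ltNge; apply/negP => Bb; apply: nw => _.
  by rewrite min_r.
have mm : measurable_fun setT (fun w => expR (s * Num.min beta (B w))).
  apply: measurableT_comp => //; apply: measurable_funM => //.
  exact: measurable_minr.
rewrite (_ : \int[P]_w _ = \int[P]_w (expR (s * Num.min beta (B w)))%:E)%E.
  rewrite (@eq_integral_fine_bounded _ _ _ _ _ _ (expR (s * beta))) ?ltry //.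
  by move=> w _; rewrite expR_ge0 ler_expR ler_wpM2l // ge_min lexx.
apply: ge0_ae_eq_integral => //.
- by apply/measurable_EFinP; exact: measurable_expR_lin.
- exact/measurable_EFinP.
Qed.

Local Notation B' := (fun w => below_service beta (B w)).

Lemma measurable_below_B : measurable_fun setT B'.
Proof. by apply: measurableT_comp => //; exact: measurable_below_service. Qed.

Definition mgf_below s : R := fine (\int[P]_w (expR (s * B' w))%:E)%E.

Lemma mgf_belowE s : 0 <= s ->
  (\int[P]_w (expR (s * B' w))%:E = (mgf_below s)%:E)%E.
Proof.
move=> s0; apply: (@eq_integral_fine_bounded _ _ _ _ _ _ (expR (s * `|beta|))) => //.
  by apply: measurable_expR_lin; exact: measurable_below_B.
move=> w _; rewrite expR_ge0 ler_expR ler_wpM2l // /below_service.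
by case: ifP => // /ltW /le_trans; apply; exact: ler_norm.
Qed.

Lemma mgf_below_homo s s' : 0 <= s -> s <= s' -> mgf_below s <= mgf_below s'.
Proof.
move=> s0 ss; have s0' := le_trans s0 ss.
rewrite -lee_fin -!mgf_belowE //; apply: ge0_le_integral => //.
- by apply: measurable_expR_linE; exact: measurable_below_B.
- by apply: measurable_expR_linE; exact: measurable_below_B.
- by move=> w _; rewrite lee_fin ler_expR ler_wpM2r // below_service_ge0.
Qed.

Lemma mgf_below_ge1 s : 0 <= s -> 1 <= mgf_below s.
Proof.
move=> s0; apply: le_trans (mgf_below_homo (lexx 0) s0).
rewrite -lee_fin -mgf_belowE //; under eq_integral do rewrite mul0r expR0.
by rewrite expectation_cst1.
Qed.

Definition below_prob : R := fine (p_below B).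

Let mbelow : measurable [set w | B w < beta].
Proof. exact: measurable_lt_cst. Qed.

Lemma p_belowE : p_below B = below_prob%:E.
Proof.
rewrite /below_prob fineK // /p_below xB (_ : mkset _ = [set w | B w < beta]).
  exact: fin_num_measure.
by apply/seteqP; split=> w /=; rewrite lte_fin.
Qed.

Let below_probE : P [set w | B w < beta] = below_prob%:E.
Proof. by rewrite -p_belowE /p_below xB; congr (P _). Qed.

Lemma below_prob01 : 0 <= below_prob <= 1.
Proof.
rewrite -!lee_fin -below_probE measure_ge0 /=.
exact: probability_le1.
Qed.

Lemma mgf_below_split s : 0 <= s -> ((mgf_below s)%:E =
  \int[P]_(w in [set w | (B w < beta)%R]) (expR (s * B w))%:E + (1 - below_prob)%:E)%E.
Proof.
move=> s0; rewrite -mgf_belowE //.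
have mC := measurableC mbelow.
have mE : measurable_fun setT (fun w => (expR (s * B' w))%:E).
  by apply: measurable_expR_linE; exact: measurable_below_B.
rewrite -{1}(setUv [set w | (B w < beta)%R]) ge0_integral_setU //; last 2 first.
- by rewrite setUv.
- by rewrite disj_set2E setICr.
congr (_ + _)%E.
  by apply: eq_integral => w /set_mem /= Bw; rewrite /below_service Bw.
transitivity (\int[P]_(w in ~` [set w | (B w < beta)%R]) cst 1 w)%E.
  apply: eq_integral => w /set_mem /= /negP Bw.
  by rewrite /below_service (negPf Bw) mulr0 expR0.
rewrite integral_cst //= mul1e.
have -> : P (~` [set w | (B w < beta)%R]) = (1 - P [set w | (B w < beta)%R])%E.
  exact: probability_setC.
by rewrite below_probE.
Qed.

(** [law_B1] is the restricted law divided by its mass, and by [mgf_below_split] the restricted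
    integral is [mgf_below s] minus the mass of the atom, where B' is 0. *)
Lemma Phi_B1E s : 0 < below_prob -> 0 <= s ->
  Phi_B1 B s = ((mgf_below s - (1 - below_prob)) / below_prob)%:E.
Proof.
move=> p0 s0.
set S := below_endpoint B; have mS := measurable_below_endpoint B.
have SE : S = [set x | x < beta].
  by apply/seteqP; split=> x; rewrite /S /below_endpoint /= xB lte_fin.
set mu := mrestr (distribution P B) mS.
have muT : mu setT = below_prob%:E.
  rewrite /mu /mrestr setTI /distribution /pushforward -/S SE.
  exact: below_probE.
have mf : measurable_fun setT (fun x : R => (expR (s * x))%:E).
  by apply/measurable_EFinP; apply: measurableT_comp => //; exact: measurable_funM.
have f0 (x : R) : (0 <= (expR (s * x))%:E)%E by rewrite lee_fin expR_ge0.
have pV0 : 0 <= below_prob^-1 by rewrite invr_ge0 ltW.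
have scale : Phi_B1 B s = (below_prob^-1%:E * \int[mu]_x (expR (s * x))%:E)%E.
  have := ge0_integral_mscale mu measurableT (NngNum pV0) mf (fun x _ => f0 x).
  rewrite /= => <-; apply: eq_measure_integral => D mD _.
  change (mnormalize (mrestr (distribution P B) mS) (distribution P B) D =
    (below_prob^-1)%:E * mu D)%E.
  exact: etrans (mnormalize_gt0 _ D p0 muT) (muleC _ _).
have restr : (\int[mu]_x (expR (s * x))%:E =
    \int[P]_(w in [set w | (B w < beta)%R]) (expR (s * B w))%:E)%E.
  have mC := measurableC mS.
  rewrite -{1}(setUv S) ge0_integral_setU //; last 2 first.
  - by rewrite setUv.
  - by rewrite disj_set2E setICr.
  rewrite [X in (_ + X)%E]null_set_integral //; last 2 first.
  - exact: measurable_funTS.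
  - by rewrite /mu /= /mrestr -/S setICl measure0.
  rewrite adde0; transitivity (\int[distribution P B]_(x in S) (expR (s * x))%:E)%E.
    apply: eq_measure_integral => D mD DS.
    by rewrite /mu /= /mrestr -/S setIidl.
  rewrite ge0_integral_pushforward //; last exact: measurable_funTS.
  by rewrite SE.
rewrite scale restr; have := mgf_below_split s0; case: (\int[P]_(w in _) _)%E => //= r.
by rewrite -EFinD => -[->]; rewrite -EFinM addrK mulrC.
Qed.

End service_distribution.

Section rate_function.
Context d (T : measurableType d) (R : realType) (P : probability T R).
Variables A B : {RV P >-> R}.
Hypotheses (A_ge0 : forall w, 0 <= A w) (B_ge0 : forall w, 0 <= B w).

Definition laplace (v : R) : R := fine (\int[P]_w (expR (- v * A w))%:E)%E.

Lemma laplaceE v : 0 <= v ->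
  (\int[P]_w (expR (- v * A w))%:E = (laplace v)%:E)%E.
Proof.
move=> v0; apply: (@eq_integral_fine_bounded _ _ _ _ _ _ 1) => //.
  exact: measurable_expR_lin.
by move=> w _; rewrite expR_ge0 -expR0 ler_expR mulNr oppr_le0 mulr_ge0.
Qed.

Lemma laplace0 : laplace 0 = 1.
Proof.
rewrite /laplace; under eq_integral do rewrite oppr0 mul0r expR0.
by rewrite expectation_cst1.
Qed.

Lemma laplace_gt0 v : 0 <= v -> 0 < laplace v.
Proof.
move=> v0; rewrite -lte_fin -laplaceE //.
rewrite (_ : 0%:E = \int[P]_w (0 : R)%:E)%E; last by rewrite integral0.
apply: ltr_integral => //.
- exact: measurable_expR_lin.
- by move=> w; rewrite lexx expR_ge0.
- by rewrite integral0 ltry.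
- rewrite (_ : mkset _ = setT); first by rewrite probability_setT.
  by apply/seteqP; split=> w //= _; rewrite expR_gt0.
Qed.

Lemma laplace_le1 v : 0 <= v -> laplace v <= 1.
Proof.
move=> v0; rewrite -lee_fin -laplaceE //; apply: le_integral_cst1.
  exact: measurable_expR_lin.
by move=> w; rewrite expR_ge0 -expR0 ler_expR mulNr oppr_le0 mulr_ge0.
Qed.

Lemma laplace_lt v v' : (0 < P [set w | (0 < A w)%R])%E -> 0 <= v -> v < v' ->
  laplace v' < laplace v.
Proof.
move=> Apos v0 vv; have v0' : 0 <= v' by rewrite (le_trans v0) // ltW.
rewrite -lte_fin -!laplaceE //; apply: ltr_integral.
- exact: measurable_expR_lin.
- exact: measurable_expR_lin.
- by move=> w; rewrite expR_ge0 ler_expR !mulNr lerN2 ler_wpM2r // ltW.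
- by rewrite laplaceE // ltry.
- rewrite (_ : mkset _ = [set w | 0 < A w]) //; apply/seteqP; split=> w /=.
    rewrite ltr_expR !mulNr ltrN2 => h; rewrite lt_def A_ge0 andbT.
    by apply: contraTneq h => ->; rewrite !mulr0 ltxx.
  by move=> Aw; rewrite ltr_expR !mulNr ltrN2 ltr_pM2r.
Qed.

Lemma laplace_continuous (u : R) : {within `[0, u], continuous laplace}.
Proof.
(* The absolute value keeps the integrand below 1 on an open interval around [0, u], as dominated
   convergence requires. *)
pose f (v : R) w := expR (- `|v| * A w).
have mf v : measurable_fun setT (f v) by exact: measurable_expR_lin.
have f01 v w : 0 <= f v w <= 1.
  by rewrite expR_ge0 -expR0 ler_expR mulNr oppr_le0 mulr_ge0.
have g_int : P.-integrable setT (EFin \o (fun=> 1 : R)).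
  exact: finite_measure_integrable_cst.
have c : {in `](-1), (`|u| + 1)[%classic, continuous (fun v => (\int[P]_w f v w)%R)}.
  apply: (continuity_under_integral measurableT _ _ g_int) => //.
  - move=> v _; apply: le_integrable g_int => //; first exact/measurable_EFinP.
    move=> w _ /=; rewrite lee_fin normr1; case/andP: (f01 v w) => h0 h1.
    by rewrite ger0_norm.
  - apply: aeW => w _ v _; rewrite /f.
    apply: continuous_comp; last exact: continuous_expR.
    apply: cvgM; last exact: cvg_cst.
    by apply: cvgN; exact: norm_continuous.
  - move=> v _; apply: aeW => w _; case/andP: (f01 v w) => h0 h1.
    by rewrite ger0_norm.
have : {within `[0, u], continuous (fun v => (\int[P]_w f v w)%R)}.
  apply: continuous_in_subspaceT => v /set_mem /=; rewrite in_itv /= => /andP[v0 vu].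
  by apply: c; rewrite inE /= in_itv /=; have := ler_norm u; lra.
apply: subspace_eq_continuous => v /set_mem /=; rewrite in_itv /= => /andP[v0 vu].
rewrite /laplace /= /Rintegral; congr fine; apply: eq_integral => w _.
by rewrite /f ger0_norm.
Qed.

Lemma mgfE (Z : {RV P >-> R}) s : ('M_P Z s = \int[P]_w (expR (s * Z w))%:E)%E.
Proof.
rewrite /mmt_gen_fun unlock; apply: eq_integral => w _ /=.
by rewrite mulrC.
Qed.

Variable beta : R.
Hypothesis xB : right_endpoint B = beta%:E.
Local Notation p := (below_prob B).
Local Notation eB' := (mgf_below B beta).

Lemma Phi_A1E t : 0 < p -> t <= 0 -> 0 < 1 - (1 - p) * laplace (- t) /\
  Phi_A1 A B t = (p * laplace (- t) / (1 - (1 - p) * laplace (- t)))%:E.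
Proof.
move=> p0 t0; have t0' : 0 <= - t by rewrite oppr_ge0.
have l1 := laplace_le1 t0'; have l0 := laplace_gt0 t0'.
have /andP[_ p1] := below_prob01 xB.
have den : 0 < 1 - (1 - p) * laplace (- t).
  have : (1 - p) * laplace (- t) <= (1 - p) * 1 by rewrite ler_wpM2l // subr_ge0.
  lra.
have mA : 'M_P A t = (laplace (- t))%:E by rewrite mgfE -laplaceE // opprK.
split=> //; rewrite /Phi_A1 (p_belowE xB) mA.
have -> : (1 - p%:E = (1 - p)%:E)%E by [].
rewrite -!EFinM; have -> : (1 - ((1 - p) * laplace (- t))%:E =
  (1 - (1 - p) * laplace (- t))%:E)%E by [].
by rewrite inver gt_eqF.
Qed.

Let eB'_Phi s : 0 < p -> 0 <= s -> exists phi, [/\ 0 < phi, Phi_B1 B s = phi%:E &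
  eB' s = p * phi + (1 - p)].
Proof.
move=> p0 s0; exists ((eB' s - (1 - p)) / p); split.
- by rewrite divr_gt0 //; have := mgf_below_ge1 B_ge0 beta s0; lra.
- exact: Phi_B1E.
- by rewrite mulrC divfK ?gt_eqF // subrK.
Qed.

(** With a the Laplace transform at - t and phi the value of [Phi_B1], both sides amount to a (p phi
    + 1 - p) = 1. *)
Let Phi_A1_eq s t : 0 < p -> 0 <= s -> t <= 0 ->
  Phi_A1 A B t = ((Phi_B1 B s)^-1)%E <-> laplace (- t) * eB' s = 1.
Proof.
move=> p0 s0 t0; have [phi [phi0 -> ->]] := eB'_Phi p0 s0.
have [den ->] := Phi_A1E p0 t0; rewrite inver gt_eqF //.
set a := laplace _ in den *; split=> [[h]|h].
  have : p * a = phi^-1 * (1 - (1 - p) * a) by rewrite -h divfK ?gt_eqF.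
  move=> /(congr1 ( *%R phi)); rewrite mulrA mulrA mulfV ?gt_eqF //; lra.
congr EFin; apply: (mulfI (lt0r_neq0 phi0)); rewrite mulfV ?gt_eqF //.
rewrite mulrA (_ : phi * (p * a) = 1 - (1 - p) * a); last by lra.
by rewrite mulfV ?gt_eqF.
Qed.

Lemma Psi1_attained s k : 0 <= s -> (k%:E < s%:E - Psi1 A B s)%E ->
  exists2 u, 0 <= u & laplace u * eB' s = 1 /\ k < s - u.
Proof.
move=> s0; rewrite /Psi1 (p_belowE xB) eqe; case: eqP => [p0|/eqP p_neq0].
  (* For deterministic service times B' vanishes almost surely, so [mgf_below] is 1 and the
     convention that [Psi1] is 0 agrees with the equation at u = 0. *)
  rewrite sube0 lte_fin => ks; exists 0; rewrite // laplace0 mul1r subr0; split=> //.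
  apply: EFin_inj; rewrite mgf_below_split // p0 subr0.
  rewrite null_set_integral ?add0e //.
  - exact: measurable_lt_cst.
  - exact: measurable_expR_linE.
  have := p_belowE xB; rewrite p0 /p_below xB; exact.
have p0 : 0 < p by rewrite lt_def p_neq0; case/andP: (below_prob01 xB).
rewrite oppeK /Phi_A1_inv => h.
have : ((k - s)%:E < ereal_sup [set t%:E | t in [set t : R |
    (t <= 0)%R /\ Phi_A1 A B t = ((Phi_B1 B s)^-1)%E]])%E.
  by rewrite EFinB lteBlDl.
move=> /ereal_sup_gt[_ [t [t0 ht] <-]]; rewrite lte_fin => kt.
exists (- t); first by rewrite oppr_ge0.
by split; [apply/Phi_A1_eq | lra].
Qed.

Lemma Psi1_le s u : 0 <= s -> 0 <= u -> laplace u * eB' s = 1 ->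
  ((s - u)%:E <= s%:E - Psi1 A B s)%E.
Proof.
move=> s0 u0 hu; rewrite /Psi1 (p_belowE xB) eqe; case: eqP => [p0|/eqP p_neq0].
  by rewrite sube0 lee_fin; lra.
have p0 : 0 < p by rewrite lt_def p_neq0; case/andP: (below_prob01 xB).
rewrite oppeK EFinB leeD2l //; apply: ereal_sup_ubound; exists (- u) => //=.
by rewrite oppr_le0; split=> //; apply/Phi_A1_eq; rewrite ?oppr_le0 ?opprK.
Qed.

End rate_function.

(** * Exponential bounds in terms of gamma_v *)

Section decay_rate.
Context d (T : measurableType d) (R : realType) (P : probability T R).
Variables A B : nat -> {RV P >-> R}.
Hypotheses (A_ge0 : forall n w, 0 <= A n w) (B_ge0 : forall n w, 0 <= B n w)
  (AB_indep : mutually_independent P (joint_family A B))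
  (A_id : identically_distributed P A) (B_id : identically_distributed P B)
  (A_gt0 : (0 < P [set w | (0 < A 0%N w)%R])%E)
  (BA_gt0 : (0 < P [set w | (A 0%N w < B 0%N w)%R])%E).
Variables beta q : R.
Hypotheses (xB : right_endpoint (B 0%N) = beta%:E) (q0 : 0 < q)
  (hq : (\int[P]_w (if B 0%N w == beta then 1 else 0)%:E = q%:E)%E).

Local Notation A0 := (A 0%N).
Local Notation B0 := (B 0%N).
Local Notation lA := (laplace A0).
Local Notation eB' := (mgf_below B0 beta).

Let B_le : P [set w | beta < B0 w] = 0%E.
Proof. exact: above_right_endpoint. Qed.

Let X := joint_family A B.

Let mX i : measurable_fun setT (X i).
Proof. by case: i => n /=. Qed.

(** Since B is at most [beta] almost surely, A < B forces A < [beta], hence A < [beta] - 1/(n+1) for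
    some n, with positive probability. *)
Lemma exists_short_interarrival : exists2 K, K < beta & 0 < mgf_trunc P A0 0 K.
Proof.
apply/not_exists2P => H.
have sub : [set w | A0 w < B0 w] `<=`
    [set w | beta < B0 w] `|` \bigcup_n [set w | A0 w < beta - n.+1%:R^-1].
  move=> w /= AB; have [h|h] := ltP beta (B0 w); [by left | right].
  have Ab : A0 w < beta by apply: lt_le_trans AB h.
  exists (Num.truncn (beta - A0 w)^-1) => //=.
  rewrite ltrBrDr -ltrBrDl -[ltRHS]invrK ltf_pV2 ?posrE ?invr_gt0 ?subr_gt0 //.
  exact: truncnS_gt.
have mAB : measurable [set w | A0 w < B0 w] by exact: measurable_ltr_set.
move: BA_gt0; rewrite lt_def => /andP[/eqP + _]; apply.
apply/negligibleP => //; apply: negligibleS sub _; apply: negligibleU.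
  by apply/negligibleP => //; apply: measurable_ltr_set.
apply: negligible_bigcup => n.
have mA : measurable [set w | A0 w < beta - n.+1%:R^-1] by exact: measurable_lt_cst.
apply/negligibleP => //.
have PE : P [set w | A0 w < beta - n.+1%:R^-1] =
    (mgf_trunc P A0 0 (beta - n.+1%:R^-1))%:E.
  rewrite -mgf_truncE //; under [RHS]eq_integral do rewrite mul0r expR0.
  transitivity (\int[P]_(w in [set w | (A0 w < beta - n.+1%:R^-1)%R]) cst 1 w)%E;
    last by [].
  by rewrite integral_cst //= mul1e.
apply: (etrans PE); case: (H (beta - n.+1%:R^-1)).
  by rewrite ltrBlDr ltrDl invr_gt0 ltr0n.
move=> h; congr EFin; apply/eqP; rewrite eq_le mgf_trunc_ge0 // andbT leNgt.
exact/negP.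
Qed.

Let eB s := fine (\int[P]_w (expR (s * B0 w))%:E)%E.

Let eBE s : 0 <= s -> (\int[P]_w (expR (s * B0 w))%:E = (eB s)%:E)%E.
Proof.
move=> s0; rewrite fineK // ge0_fin_numE; first exact: (mgf_fin xB).
by apply: integral_ge0 => w _; rewrite lee_fin expR_ge0.
Qed.

Lemma mgf_ge_atom s : 0 <= s -> q * expR (s * beta) <= eB s.
Proof.
move=> s0; rewrite -lee_fin -eBE // EFinM -hq muleC -ge0_integralZl_EFin ?expR_ge0 //.
- apply: ge0_le_integral => //.
  + by move=> w _; rewrite -EFinM lee_fin mulr_ge0 ?expR_ge0 //; case: ifP.
  + apply/measurable_EFinP; apply: measurable_funM => //.
    by apply: measurable_fun_ifT => //; exact: measurable_fun_eqr.
  + exact: measurable_expR_linE.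
  + move=> w _; rewrite -EFinM lee_fin; case: eqP => [->|_]; first by rewrite mulr1.
    by rewrite mulr0 expR_ge0.
- by move=> w _; rewrite lee_fin; case: ifP.
- by apply/measurable_EFinP; apply: measurable_fun_ifT => //; exact: measurable_fun_eqr.
Qed.

Let mgf_prodE s : 0 <= s ->
  ('M_P A0 (- s) * 'M_P B0 s = (lA s * eB s)%:E)%E.
Proof. by move=> s0; rewrite !mgfE laplaceE // eBE. Qed.

Lemma gamma_w_real : exists gam, [/\ 0 <= gam, gamma_w A0 B0 = gam%:E,
  forall s, gam < s -> 1 < lA s * eB s &
  forall s, s < gam -> exists2 s', s < s' & ('M_P A0 (- s')%R * 'M_P B0 s' <= 1)%E].
Proof.
have in0 : ((0%R)%:E <= gamma_w A0 B0)%E.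
  apply: ereal_sup_ubound; exists 0%R => //=.
  rewrite mgf_prodE // laplace0 mul1r /eB.
  by under eq_integral do rewrite mul0r expR0; rewrite expectation_cst1.
have [K Kb aK] := exists_short_interarrival.
set a := mgf_trunc _ _ _ _ in aK.
have aq : 0 < a * q by rewrite mulr_gt0.
(* Keeping only the events A < K and B = beta gives exponential growth in [s], so [gamma_w] is
   finite; [M] below is where this lower bound equals 1. *)
have ub s : 0 <= s -> a * q * expR (s * (beta - K)) <= lA s * eB s.
  move=> s0; have -> : a * q * expR (s * (beta - K)) =
      (expR (- (s * K)) * a) * (q * expR (s * beta)).
    by rewrite mulrBr expRD; ring.
  apply: ler_pM; rewrite ?mulr_ge0 ?expR_ge0 ?(ltW aK) ?(ltW q0) //;
    last exact: mgf_ge_atom.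
  rewrite -lee_fin -laplaceE //.
  have := mgf_trunc_perturb P (measurable_funPT A0) (A_ge0 0%N) 0 (- s) K.
  rewrite subr0 normrN ger0_norm // -/a => h.
  apply: le_trans (_ : _ <= (mgf_trunc P A0 (- s) K)%:E)%E _; first by rewrite lee_fin.
  rewrite -mgf_truncE //; apply: ge0_subset_integral => //.
  - exact: measurable_lt_cst.
  - exact: measurable_expR_linE.
pose M := - ln (a * q) / (beta - K).
have bK : 0 < beta - K by rewrite subr_gt0.
have le_M s : ('M_P A0 (- s)%R * 'M_P B0 s <= 1)%E -> s <= Num.max 0 M.
  have [s0 _|s0] := ltP s 0; first by rewrite le_max (ltW s0).
  rewrite mgf_prodE // lee_fin => h.
  rewrite le_max; apply/orP; right; rewrite /M ler_pdivlMr //.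
  have := le_trans (ub s s0) h.
  rewrite -{1}(lnK (x := a * q)) ?posrE // -expRD -expR0 ler_expR; lra.
have fin : gamma_w A0 B0 \is a fin_num.
  rewrite fin_numElt; apply/andP; split; first by apply: lt_le_trans in0; exact: ltNyr.
  apply: (@le_lt_trans _ _ (Num.max 0 M)%:E); last exact: ltry.
  by apply: ge_ereal_sup => _ [s hs <-]; rewrite lee_fin; exact: le_M.
exists (fine (gamma_w A0 B0)); split.
- by rewrite -lee_fin fineK.
- by rewrite fineK.
- move=> s hs; have s0 : 0 <= s.
    by apply: le_trans (ltW hs); rewrite -lee_fin fineK.
  rewrite ltNge; apply/negP => h; move: hs; rewrite -lte_fin fineK // ltNge.
  move=> /negP; apply.
  by apply: ereal_sup_ubound; exists s => //=; rewrite mgf_prodE // lee_fin.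
- move=> s; rewrite -lte_fin fineK // => /ereal_sup_gt[_ [s' hs' <-]].
  by rewrite lte_fin => ss'; exists s'.
Qed.

(** The bound e^y >= 1 + y at y = (1 - l) z and y = - l z, multiplied by e^(l z) and averaged with
    weights l and 1 - l: the linear terms cancel. *)
Lemma expR_convex_le (l z : R) : 0 < l < 1 -> expR (l * z) <= l * expR z + (1 - l).
Proof.
move=> /andP[l0 l1].
have e : expR z = expR (l * z) * expR ((1 - l) * z).
  by rewrite -expRD; congr expR; ring.
have e1 : 1 = expR (l * z) * expR (- (l * z)) by rewrite -expRD subrr expR0.
have h1 := ler_wpM2l (ltW l0) (ler_wpM2l (expR_ge0 (l * z)) (expR_ge1Dx ((1 - l) * z))).
have l1' : 0 <= 1 - l by rewrite subr_ge0 ltW.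
have h2 := ler_wpM2l l1' (ler_wpM2l (expR_ge0 (l * z)) (expR_ge1Dx (- (l * z)))).
rewrite -e in h1; rewrite -e1 in h2; lra.
Qed.

Lemma expR_convex_lt (l z : R) : 0 < l < 1 -> z != 0 ->
  expR (l * z) < l * expR z + (1 - l).
Proof.
move=> /andP[l0 l1] z0.
have e : expR z = expR (l * z) * expR ((1 - l) * z).
  by rewrite -expRD; congr expR; ring.
have e1 : 1 = expR (l * z) * expR (- (l * z)) by rewrite -expRD subrr expR0.
have l1' : 0 < 1 - l by rewrite subr_gt0.
have nz : (1 - l) * z != 0 by rewrite mulf_neq0 // gt_eqF.
have h1 : l * (expR (l * z) * (1 + (1 - l) * z)) < l * expR z.
  by rewrite e !ltr_pM2l ?expR_gt0 //; exact: expR_gt1Dx.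
have h2 := ler_wpM2l (ltW l1') (ler_wpM2l (expR_ge0 (l * z)) (expR_ge1Dx (- (l * z)))).
rewrite -e1 in h2; lra.
Qed.

Let joint_mgf s : 0 <= s ->
  (\int[P]_w (expR (s * (B0 w - A0 w)))%:E = (lA s * eB s)%:E)%E.
Proof.
move=> s0; have mE (v : R) : measurable_fun setT (fun x : R => expR (v * x)).
  by apply: measurableT_comp => //; exact: measurable_funM.
have := weight_indep_step AB_indep A_id B_id (mE (- s)) (fun=> expR_ge0 _) (mE s)
  (fun=> expR_ge0 _) (laplaceE (A_ge0 0%N) s0) (eBE s0)
  (@weight_indep1 _ T R P _ X mX (avail 0 0)).
move=> /weight_indep_expectation; rewrite mul1r => <-.
by apply: eq_integral => w _; rewrite mul1r -expRD; congr (expR _)%:E; ring.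
Qed.

(** The expectation of e^(s (B - A)) is 1 at 0 and at most 1 at s'; strict convexity, due to B > A
    with positive probability, makes it less than 1 in between. *)
Lemma below_gamma_w_lt1 s s' : 0 < s -> s < s' ->
  ('M_P A0 (- s')%R * 'M_P B0 s' <= 1)%E -> lA s * eB s < 1.
Proof.
move=> s0 ss'; have s0' : 0 < s' by apply: lt_trans ss'.
rewrite mgf_prodE ?(ltW s0') // lee_fin => le1.
pose l := s / s'; have l01 : 0 < l < 1 by rewrite /l divr_gt0 //= ltr_pdivrMr ?mul1r.
case/andP: (l01) => l0 l1.
pose z w := s' * (B0 w - A0 w).
have sz w : s * (B0 w - A0 w) = l * z w by rewrite /z /l mulrA divfK ?gt_eqF.
have mz : measurable_fun setT z by apply: measurable_funM => //; exact: measurable_funB.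
have me : measurable_fun setT (fun w => expR (z w)) by exact: measurableT_comp.
rewrite -lte_fin -joint_mgf ?(ltW s0) //.
apply: (@lt_le_trans _ _ (\int[P]_w (l * expR (z w) + (1 - l))%:E)%E).
  apply: ltr_integral.
  - apply: measurableT_comp => //; apply: measurable_funM => //; exact: measurable_funB.
  - by apply: measurable_funD => //; exact: measurable_funM.
  - by move=> w; rewrite expR_ge0 /= sz expR_convex_le.
  - by rewrite joint_mgf ?(ltW s0) // ltry.
  apply: lt_le_trans BA_gt0 _; apply: le_measure; rewrite ?inE.
  - exact: measurable_ltr_set.
  - apply: measurable_ltr_set.
      apply: measurableT_comp => //; apply: measurable_funM => //.
      exact: measurable_funB.
    by apply: measurable_funD => //; exact: measurable_funM.
  move=> w /= AB; rewrite sz expR_convex_lt // /z mulf_neq0 ?gt_eqF //.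
  by rewrite subr_gt0.
under eq_integral do rewrite EFinD.
rewrite ge0_integralD //; last 3 first.
- by move=> w _; rewrite lee_fin mulr_ge0 ?expR_ge0 // ltW.
- by apply/measurable_EFinP; exact: measurable_funM.
- by move=> w _; rewrite lee_fin subr_ge0 ltW.
under eq_integral do rewrite EFinM.
rewrite ge0_integralZl_EFin ?(ltW l0) //; last exact/measurable_EFinP.
rewrite joint_mgf ?(ltW s0') //.
have -> : (\int[P]_w (1 - l)%:E = (1 - l)%:E)%E.
  transitivity (\int[P]_w cst (1 - l)%:E w)%E; first by [].
  rewrite integral_cst //=; have -> : P setT = 1%E by exact: probability_setT.
  by rewrite mule1.
rewrite -EFinM -EFinD lee_fin.
have := ler_wpM2l (ltW l0) le1; lra.
Qed.

Lemma gamma_v_real : exists2 gv, 0 <= gv & gamma_v A0 B0 = gv%:E.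
Proof.
have [gam [gam0 gE _ _]] := gamma_w_real.
have in0 : ((0%R)%:E <= gamma_v A0 B0)%E.
  apply: (@le_trans _ _ (0%:E - Psi1 A0 B0 0)%E).
    have := @Psi1_le _ _ _ _ A0 B0 (A_ge0 0%N) (B_ge0 0%N) beta xB 0 0 (lexx 0) (lexx 0).
    rewrite subr0; apply; rewrite laplace0 mul1r /mgf_below.
    by under eq_integral do rewrite mul0r expR0; rewrite expectation_cst1.
  by apply: ereal_sup_ubound; exists 0%R => //=; rewrite gE lee_fin.
have le_gam : (gamma_v A0 B0 <= gam%:E)%E.
  apply: ge_ereal_sup => _ [s /= [s0 sg] <-]; rewrite leNgt; apply/negP.
  move=> /(Psi1_attained (A_ge0 0%N) (B_ge0 0%N) xB s0)[u u0 [_ h]].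
  by move: sg; rewrite gE lee_fin; lra.
have fin : gamma_v A0 B0 \is a fin_num.
  rewrite fin_numElt; apply/andP; split; first by apply: lt_le_trans in0; exact: ltNyr.
  by apply: le_lt_trans le_gam _; exact: ltry.
by exists (fine (gamma_v A0 B0)); rewrite ?fineK // -lee_fin fineK.
Qed.

Lemma sojourn_le_rate (gv k : R) : gamma_v A0 B0 = gv%:E -> k < gv ->
  exists2 C, 0 < C & forall n x, 0 <= x ->
    (P [set w | (x%:E < sojourn (A ^~ w) (B ^~ w) n)%E] <= (C * expR (- k * x))%:E)%E.
Proof.
move=> gvE kg; have [k0|k0] := ltP k 0.
  exists 1 => // n x x0; apply: (@le_trans _ _ 1%E).
    apply: probability_le1; exact: measurable_sojourn_gt.
  by rewrite lee_fin mul1r -expR0 ler_expR mulNr oppr_ge0 mulr_le0_ge0 // ltW.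
have : (k%:E < gamma_v A0 B0)%E by rewrite gvE lte_fin.
move=> /ereal_sup_gt[_ [s /= [s0 sg] <-]].
move=> /(Psi1_attained (A_ge0 0%N) (B_ge0 0%N) xB s0)[u u0 [usE ks]].
have [gam [gam0 gE _ below]] := gamma_w_real.
(* Lowering [s] and raising [u] by [e] turns both conditions into strict inequalities and brings the
   rate [s - u] down to exactly [k]. *)
pose e := (s - u - k) / 2; have e0 : 0 < e by rewrite divr_gt0 // subr_gt0.
have s0' : 0 < s - e by rewrite /e; lra.
have [s' ss' le1] := below (s - e) ltac:(by move: sg; rewrite gE lee_fin; lra).
have lt1 := below_gamma_w_lt1 s0' ss' le1.
have u0' : 0 <= u + e by rewrite addr_ge0 // ltW.
have lt1' : lA (u + e) * eB' (s - e) < 1.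
  rewrite -usE; apply: (@lt_le_trans _ _ (lA u * eB' (s - e))).
    rewrite ltr_pM2r; last first.
      by apply: lt_le_trans ltr01 _; apply: mgf_below_ge1 => //; exact: ltW.
    by apply: laplace_lt => //; rewrite ltrDl.
  rewrite ler_wpM2l ?(ltW (laplace_gt0 _ u0)) //.
  by apply: mgf_below_homo => //; [exact: ltW | rewrite gerBl ltW].
have [C HC] := sojourn_tail_upper A_ge0 B_ge0 AB_indep A_id B_id B_le (ltW s0') u0'
  (laplaceE (A_ge0 0%N) (ltW s0')) (eBE (ltW s0')) lt1
  (laplaceE (A_ge0 0%N) u0') (mgf_belowE B0 beta (ltW s0')) lt1'.
exists (`|C| + 1); first by rewrite ltr_wpDl.
move=> n x x0; apply: le_trans (HC n x x0) _; rewrite lee_fin.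
rewrite (_ : - (s - e - (u + e)) = - k); last by rewrite /e; lra.
by rewrite ler_wpM2r ?expR_ge0 // (le_trans (ler_norm C)) // lerDl.
Qed.

Lemma sojourn_ge_rate (gv k : R) : gamma_v A0 B0 = gv%:E -> gv < k ->
  exists2 c, 0 < c & forall x, 0 <= x -> exists n0, forall n, (n0 <= n)%N ->
    ((c * expR (- k * x))%:E <=
     P [set w | (x%:E < sojourn (A ^~ w) (B ^~ w) n)%E])%E.
Proof.
move=> gvE gk; have [gam [gam0 gE above _]] := gamma_w_real.
have [gv' gv0 gvE'] := gamma_v_real.
have {gvE' gv'} gv0 : 0 <= gv by move: gvE'; rewrite gvE => -[->].
pose kap := (gv + k) / 2; have gkap : gv < kap by rewrite /kap; lra.
have [K Kb aK] := exists_short_interarrival.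
have beta0 : 0 < beta.
  rewrite ltNge; apply/negP => b0; move: aK; rewrite ltNge => /negP; apply.
  rewrite -lee_fin -mgf_truncE // (_ : mkset _ = set0) ?integral_set0 //.
  by apply/seteqP; split=> w //=; have := A_ge0 0%N w; lra.
have fB s : 0 <= s -> (\int[P]_w (expR (s * B0 w))%:E < +oo)%E by exact: (mgf_fin xB).
have fB' s : 0 <= s -> (\int[P]_w (expR (s * below_service beta (B0 w)))%:E < +oo)%E.
  by move=> s0; rewrite mgf_belowE // ltry.
have gt1 s : gam < s -> (1 < (\int[P]_w (expR (- s * A0 w))%:E) *
    (\int[P]_w (expR (s * B0 w))%:E))%E.
  move=> gs; have s0 : 0 <= s by apply: le_trans gam0 (ltW gs).
  by rewrite laplaceE // eBE // -EFinM lte_fin above.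
have gt1' s : 0 <= s <= gam -> (1 < (\int[P]_w (expR ((kap - s) * A0 w))%:E) *
    (\int[P]_w (expR (s * below_service beta (B0 w)))%:E))%E.
  move=> /andP[s0 sg]; rewrite mgf_belowE //.
  (* For [s < kap] the first factor exceeds 1 because A > 0 with positive probability. Otherwise, if
     the product were at most 1, continuity would give a root v <= s - kap of the equation for
     [Psi1], and s - v >= kap > gv would contradict the supremum. *)
  have [sk|ks] := ltP s kap.
    apply: (@lt_le_trans _ _ (\int[P]_w (expR ((kap - s) * A0 w))%:E)%E).
      rewrite -[X in (X < _)%E](expectation_cst1 P); apply: ltr_integral => //.
      - exact: measurable_expR_lin.
      - by move=> w; rewrite ler01 -expR0 ler_expR mulr_ge0 // subr_ge0 ltW.
      - by rewrite expectation_cst1 ltry.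
      apply: lt_le_trans A_gt0 _; apply: le_measure; rewrite ?inE.
      - exact: measurable_ltr_set.
      - by apply: measurable_ltr_set => //; exact: measurable_expR_lin.
      - by move=> w /= Aw; rewrite expR_gt1 mulr_gt0 // subr_gt0.
    apply: lee_pemulr; last by rewrite lee_fin; exact: mgf_below_ge1.
    by apply: integral_ge0 => w _; rewrite lee_fin expR_ge0.
  have u0 : 0 <= s - kap by rewrite subr_ge0.
  rewrite -[kap - s]opprB laplaceE // -EFinM lte_fin ltNge; apply/negP => le1.
  have m1 := mgf_below_ge1 (B_ge0 0%N) beta s0.
  have m0 : 0 < eB' s by apply: lt_le_trans m1.
  have [v] := @IVT _ lA 0 (s - kap) (eB' s)^-1 u0
    (@laplace_continuous _ _ _ _ _ (A_ge0 0%N) _)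
    ltac:(rewrite laplace0 min_r ?max_l ?laplace_le1 //
      -(ler_pM2r m0) mulVf ?gt_eqF // le1 /= -(ler_pM2r m0) mulVf ?gt_eqF // mul1r //).
  rewrite in_itv /= => /andP[v0 vu] hv.
  have : ((s - v)%:E <= gamma_v A0 B0)%E.
    apply: le_trans (Psi1_le (A_ge0 0%N) (B_ge0 0%N) xB s0 v0 _) _.
      by rewrite hv mulVf ?gt_eqF.
    by apply: ereal_sup_ubound; exists s => //=; rewrite gE lee_fin.
  by rewrite gvE lee_fin; lra.
have eta0 : 0 < k - kap by rewrite /kap; lra.
have [c c0 H] := sojourn_tail_lower A_ge0 B_ge0 AB_indep A_id B_id B_le
  gam0 (le_lt_trans gv0 gkap) beta0 q0 hq fB fB' gt1 gt1' eta0.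
exists c => // x x0; have [n0 Hn] := H x x0.
exists n0 => n nn; apply: le_trans (Hn n nn).
by rewrite (_ : kap + (k - kap) = k) //; ring.
Qed.

End decay_rate.

(** * Logarithmic asymptotics *)

Section log_tail.
Context d (T : measurableType d) (R : realType) (Q : probability T R).
Variable V : {RV Q >-> R}.

Let mtail x : measurable [set w | x < V w].
Proof. exact: measurable_ltr_set. Qed.

Lemma tail_homo x y : x <= y -> (Q [set w | (y < V w)%R] <= Q [set w | (x < V w)%R])%E.
Proof.
move=> xy; apply: le_measure; rewrite ?inE; [exact: mtail|exact: mtail|].
by move=> w /=; exact: le_lt_trans.
Qed.

(** The bounds are asked only from x = 1 on, which leaves room to move x by 1 to a continuity point.
    The lower bounds also keep the tail positive, so its logarithm is finite. *)
Lemma cvg_log_tail (g : R) :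
  (forall k, k < g -> exists2 C, 0 < C & forall x, 1 <= x ->
    (Q [set w | (x < V w)%R] <= (C * expR (- k * x))%:E)%E) ->
  (forall k, g < k -> exists2 c, 0 < c & forall x, 1 <= x ->
    ((c * expR (- k * x))%:E <= Q [set w | (x < V w)%R])%E) ->
  ((x^-1)%:E * lne (Q [set w | (x < V w)%R]))%E @[x --> +oo] --> (- g%:E)%E.
Proof.
move=> upper lower.
pose r x := fine (Q [set w | (x < V w)%R]).
have QE x : Q [set w | (x < V w)%R] = (r x)%:E by rewrite fineK // fin_num_measure.
have lnE (c k x : R) : 0 < c -> ln (c * expR (- k * x)) = ln c - k * x.
  by move=> c0; rewrite lnM ?posrE ?expR_gt0 // expRK mulNr.
have r0 x : 1 <= x -> 0 < r x.
  have [c c0 H] := lower (g + 1) ltac:(by rewrite ltrDl).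
  move=> /H; rewrite QE lee_fin; apply: lt_le_trans.
  by rewrite mulr_gt0 ?expR_gt0.
have cvg : x^-1 * ln (r x) @[x --> +oo] --> - g.
  apply/cvgrPdist_le => e e0.
  have e2 : 0 < e / 2 by rewrite divr_gt0.
  have [C C0 HC] := upper (g - e / 2) ltac:(by rewrite ltrBlDr ltrDl).
  have [c c0 Hc] := lower (g + e / 2) ltac:(by rewrite ltrDl).
  (* Beyond [M] the constants contribute at most [e / 2] after division by x; the shift of the rate
     uses the other half. *)
  pose M := Num.max 1 (Num.max (`|ln C| / (e / 2)) (`|ln c| / (e / 2))).
  near=> x; have : M <= x by near: x; apply: nbhs_pinfty_ge; exact: num_real.
  rewrite !ge_max => /and3P[x1 xC xc]; have x0 : 0 < x by apply: lt_le_trans x1.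
  have rx := r0 x x1.
  have up : ln (r x) <= ln C - (g - e / 2) * x.
    rewrite -lnE // ler_ln ?posrE ?mulr_gt0 ?expR_gt0 //.
    by have := HC x x1; rewrite QE lee_fin.
  have low : ln c - (g + e / 2) * x <= ln (r x).
    rewrite -lnE // ler_ln ?posrE ?mulr_gt0 ?expR_gt0 //.
    by have := Hc x x1; rewrite QE lee_fin.
  rewrite ler_pdivrMr // in xC; rewrite ler_pdivrMr // in xc.
  have lC := ler_norm (ln C); have lc := ler_norm (- ln c).
  rewrite normrN in lc.
  have xV : x^-1 * ln (r x) * x = ln (r x) by rewrite mulrAC mulVf ?gt_eqF // mul1r.
  rewrite ler_norml; apply/andP; split.
    by rewrite -(ler_pM2r x0) mulrBl xV; lra.
  by rewrite -(ler_pM2r x0) mulrBl xV; lra.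
have -> : (- g%:E = (- g)%:E)%E by [].
have cvgE : (x^-1 * ln (r x))%:E @[x --> +oo] --> (- g)%:E.
  by apply: cvg_EFin => //; apply: nearW.
apply: cvg_trans cvgE; apply: near_eq_cvg; near=> x.
have x1 : 1 <= x by near: x; apply: nbhs_pinfty_ge; exact: num_real.
by rewrite QE lne_EFin ?r0.
Unshelve. all: by end_near.
Qed.

End log_tail.

(** * Passage to the steady state *)

Local Open Scope ereal_scope.

Theorem theorem4p2 (R : realType)
    (d : measure_display) (T : measurableType d) (P : probability T R)
    (A B : nat -> {RV P >-> R})
    (A_ge0 : forall n w, (0 <= A n w)%R)
    (B_ge0 : forall n w, (0 <= B n w)%R)
    (AB_indep : mutually_independent P (joint_family A B))
    (A_id : identically_distributed P A)
    (B_id : identically_distributed P B)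
    (rho_lt1 : 'E_P[B 0%N] / 'E_P[A 0%N] < 1)
    (BA_gt0 : 0 < P [set w | (A 0%N w < B 0%N w)%R])
    (B_light : exists2 e : R, (0 < e)%R &
       forall s : R, (`|s| < e)%R -> 'M_P (B 0%N) s < +oo)
    (d' : measure_display) (T' : measurableType d') (Q : probability T' R)
    (V : {RV Q >-> R})
    (V_steady : steady_state_sojourn P A B Q V)
    (xB_atom : 0 < P [set w | (B 0%N w)%:E = right_endpoint (B 0%N)]) :
  (x^-1)%:E * lne (Q [set w | (x < V w)%R]) @[x --> +oo%R] -->
    - gamma_v (A 0%N) (B 0%N).
Proof.
have A_gt0 : 0 < P [set w | (0 < A 0%N w)%R].
  rewrite lt_def measure_ge0 andbT; apply/eqP => A0.
  have EA : 'E_P[A 0%N] = 0.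
    rewrite unlock; transitivity (\int[P]_w (0 : R)%:E); last by rewrite integral0.
    apply: ge0_ae_eq_integral => //.
    - exact/measurable_EFinP.
    - by move=> w _; rewrite lee_fin.
    - exists [set w | (0 < A 0%N w)%R]; split => //; first exact: measurable_ltr_set.
      move=> w /= h; rewrite lt_def A_ge0 andbT; apply/eqP => h'; apply: h => _.
      by rewrite h'.
  have EB : 0 < 'E_P[B 0%N].
    rewrite unlock [ltLHS](_ : _ = \int[P]_w (0 : R)%:E); last by rewrite integral0.
    apply: ltr_integral => //.
    - by move=> w; rewrite lexx B_ge0.
    - by rewrite integral0 ltry.
    apply: lt_le_trans BA_gt0 _; apply: le_measure; rewrite ?inE.
    - exact: measurable_ltr_set.
    - exact: measurable_ltr_set.
    - by move=> w /= h; exact: le_lt_trans (A_ge0 0%N w) h.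
  (* The inverse of 0 in [\bar R] is +oo, so a null A would make the load infinite. *)
  by move: rho_lt1; rewrite EA inve0 gt0_muley // ltNge leey.
have [beta beta0 xB] := right_endpoint_real (B_ge0 0%N) xB_atom.
have [q q0 hq] : exists2 q : R, (0 < q)%R &
    \int[P]_w (if B 0%N w == beta then 1 else 0)%R%:E = q%:E.
  have mb : measurable_fun setT (fun w => if B 0%N w == beta then 1 else 0 : R)%R.
    by apply: measurable_fun_ifT => //; exact: measurable_fun_eqr.
  have b01 w : (0 <= (if B 0%N w == beta then 1 else 0 : R) <= 1)%R.
    by case: ifP; rewrite ?lexx ?ler01.
  have hq := @eq_integral_fine_bounded _ _ _ P setT _ 1%R measurableT mb
    (fun w _ => b01 w).
  exists (fine (\int[P]_w (if B 0%N w == beta then 1 else 0)%R%:E)) => //.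
  rewrite -lte_fin -hq; apply: lt_le_trans xB_atom _; rewrite xB.
  have mS : measurable [set w | (B 0%N w)%:E = beta%:E].
    rewrite (_ : mkset _ = B 0%N @^-1` [set beta]); first exact: measurable_funPTI.
    by apply/seteqP; split=> w /=; [case | move->].
  rewrite -[X in P X]setIT -integral_indic //; apply: ge0_le_integral => //.
  - by apply/measurable_EFinP; exact: measurable_indic.
  - exact/measurable_EFinP.
  - move=> w _; rewrite lee_fin indicE; case: (boolP (w \in _)) => [/set_mem/= []->|_].
      by rewrite eqxx.
    by case/andP: (b01 w).
have [gv gv0 gvE] := gamma_v_real A_ge0 B_ge0 BA_gt0 xB q0 hq.
rewrite gvE; apply: cvg_log_tail => k.
  move=> /(sojourn_le_rate A_ge0 B_ge0 AB_indep A_id B_id A_gt0 BA_gt0 xB q0 hq gvE)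
    [C C0 H].
  exists (C * expR `|k|)%R; first by rewrite mulr_gt0 ?expR_gt0.
  (* The limit in n is taken at a continuity point [y] just below x; the shift changes the
     exponential by at most the factor [expR |k|]. The lower bound uses a point just above x. *)
  move=> x x1; have [y /andP[xy yx] Vy] := exists_no_atom V (a := (x - 1)%R) (b := x)
    ltac:(by rewrite ltrBlDr ltrDl).
  apply: le_trans (tail_homo V (ltW yx)) _.
  have y0 : (0 <= y)%R by lra.
  apply: (le_trans (y := (C * expR (- k * y))%:E)).
    apply: (cvge_to_le (V_steady _ Vy)); apply: nearW => n; exact: H.
  rewrite lee_fin -mulrA ler_pM2l // -expRD ler_expR.
  have : (`|- k * (y - x)| <= `|k| * 1)%R.
    by rewrite normrM normrN ler_wpM2l // ler_norml; lra.
  move=> /(le_trans (ler_norm _)); lra.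
move=> /(sojourn_ge_rate A_ge0 B_ge0 AB_indep A_id B_id A_gt0 BA_gt0 xB q0 hq gvE)
  [c c0 H].
exists (c * expR (- `|k|))%R; first by rewrite mulr_gt0 ?expR_gt0.
move=> x x1; have [y /andP[xy yx] Vy] := exists_no_atom V (a := x) (b := (x + 1)%R)
  ltac:(by rewrite ltrDl).
apply: le_trans (tail_homo V (ltW xy)).
have y0 : (0 <= y)%R by lra.
have [n0 Hn] := H y y0.
apply: (le_trans (y := (c * expR (- k * y))%:E)).
  rewrite lee_fin -mulrA ler_pM2l // -expRD ler_expR.
  have : (`|- k * (x - y)| <= `|k| * 1)%R.
    by rewrite normrM normrN ler_wpM2l // ler_norml; lra.
  move=> /(le_trans (ler_norm _)); lra.
by apply: (cvge_to_ge (V_steady _ Vy)); exists n0.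
Qed.
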